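(* Let $U\subset\mathbb{R}^2$ be a domain with Poisson bivector field $\alpha^{ij}=\epsilon^{ij}\phi$, $\phi\in C^\infty(U)$, such that all the symplectic leaves of $(U,\alpha)$ are simply connected. Let $x_f:U\times\mathbb{R}^2\to\mathbb{R}^2$ be $x_f^i(x,\pi)=x^i-\phi(x)\epsilon^{ij}\pi_j$, let $$h(x,\pi)=\begin{cases}\phi(x_f(x,\pi))/\phi(x)&\text{if }\phi(x)\ne0,\\ 1-\pi_2\partial_1\phi(x)+\pi_1\partial_2\phi(x)&\text{if }\phi(x)=0,\end{cases}$$ for $x_f(x,\pi)\in U$, and let $\mathcal{G}$ be the connected component containing $U\times\{(0,0)\}$ of the set $\{(x,\pi)\in U\times\mathbb{R}^2:\ x_f(x,\pi)\in U,\ h(x,\pi)>0\}$. Let $$l(x,\pi)=x,\qquad r(x,\pi)=x_f(x,\pi),\qquad (x,\pi)\bullet(\tilde x,\tilde\pi)=(x,\pi+h(x,\pi)\tilde\pi)\quad\text{if } r(x,\pi)=l(\tilde x,\tilde\pi),$$ and let $\omega_{\mathcal{G}}$ be the 2-form $$\omega_{\mathcal{G}}=\tfrac1h\big[\psi\,dx^1\wedge dx^2+(1-\pi_2\partial_1\phi)\,dx^1\wedge d\pi_1+\pi_1\partial_1\phi\,dx^1\wedge d\pi_2-\pi_2\partial_2\phi\,dx^2\wedge d\pi_1+(1+\pi_1\partial_2\phi)\,dx^2\wedge d\pi_2+\phi\,d\pi_1\wedge d\pi_2\big],$$ where $$\psi=\begin{cases}\dfrac{1+\pi_1\partial_2\phi-\pi_2\partial_1\phi-h}{\phi}&\text{if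 }\phi\ne0,\\[1ex] \pi_1\pi_2\,\partial_1\partial_2\phi-\frac12(\pi_1)^2(\partial_2)^2\phi-\frac12(\pi_2)^2(\partial_1)^2\phi&\text{if }\phi=0\end{cases}$$ (with $\phi$ and its derivatives evaluated at $x$). Then $(\mathcal{G},r,l,\bullet,\omega_{\mathcal{G}})$ is a symplectic groupoid for $(U,\alpha)$.
   Context: Here $\epsilon^{12}=-\epsilon^{21}=1$, $\epsilon^{11}=\epsilon^{22}=0$, $\partial_i=\partial/\partial x^i$, and the Poisson bracket on $U$ is determined by $\{x^1,x^2\}=\phi$. The function $\psi$ is smooth on $\mathcal{G}$. The 2-form $\omega_{\mathcal{G}}$ is the inverse of the Poisson bivector on $\mathcal{G}$ given by $\{x^1,x^2\}=\phi$, $\{x^i,\pi_j\}=-\delta^i_j-\pi_j\epsilon^{ik}\partial_k\phi$, $\{\pi_1,\pi_2\}=\psi$; the Poisson bracket of a symplectic form $\omega$ is $\{f,g\}=\xi_fg$ where $\iota_{\xi_f}\omega=\mathrm{d}f$. The inclusion of $U$ is $j(x)=(x,0)$. Definition. A symplectic manifold $(\mathcal{G},\omega_{\mathcal{G}})$ is a symplectic groupoid for a Poisson manifold $M$ if there are an injection $j:M\to\mathcal{G}$, surjections $l,r:\mathcal{G}\to M$ and a composition law $g\bullet h$ defined when $r(g)=l(h)$ such that, with $\mathcal{G}_{x,y}=l^{-1}(x)\cap r^{-1}(y)$: (i) $l\circ j=r\circ j=\mathrm{id}_M$; (ii) $g\in\mathcal{G}_{x,y}$, $h\in\mathcal{G}_{y,z}$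 imply $g\bullet h\in\mathcal{G}_{x,z}$; (iii) $j(x)\bullet g=g\bullet j(y)=g$ for $g\in\mathcal{G}_{x,y}$; (iv) each $g\in\mathcal{G}_{x,y}$ has an inverse $g^{-1}\in\mathcal{G}_{y,x}$ with $g\bullet g^{-1}=j(x)$; (v) $\bullet$ is associative whenever defined; (vi) $j$ is a smooth embedding, $l,r$ are smooth submersions, composition and inversion are smooth; (vii) $j(M)$ is a Lagrangian submanifold; (viii) $l$ is a Poisson map ($\{f,g\}\circ l=\{f\circ l,g\circ l\}$) and $r$ is an anti-Poisson map ($\{f,g\}\circ r=-\{f\circ r,g\circ r\}$); (ix) if $P:\mathcal{G}_0\to\mathcal{G}$ is the composition law on $\mathcal{G}_0=\{(g,h)\in\mathcal{G}\times\mathcal{G}:r(g)=l(h)\}$ and $\pi_1,\pi_2$ denote the two projections $\mathcal{G}\times\mathcal{G}\to\mathcal{G}$, then $P^*\omega_{\mathcal{G}}=\pi_1^*\omega_{\mathcal{G}}+\pi_2^*\omega_{\mathcal{G}}$ on $\mathcal{G}_0$; (x) $g\mapsto g^{-1}$ is an anti-Poisson map. *)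

(* Defs.v *)
From HB Require Import structures.
From Stdlib Require Import Relation_Operators.
From mathcomp Require Import all_boot all_order all_algebra.
From mathcomp Require Import all_classical all_reals all_analysis.

Set Implicit Arguments.
Unset Strict Implicit.
Unset Printing Implicit Defensive.

Import Order.TTheory GRing.Theory Num.Theory.
Import numFieldNormedType.Exports.

Local Open Scope classical_set_scope.
Local Open Scope ring_scope.

(* All manifolds here are open subsets of finite-dimensional normed spaces.
   Maps between them are total functions, only constrained on these subsets. *)

Section smooth_maps.
Context {R : realType}.
Implicit Types V W : normedModType R.

(* [A] is meant to be open: the conditions below only involve the germs of
   [f] at the points of [A]. *)
Fixpoint Cn {V W} (n : nat) (A : set V) (f : V -> W) : Prop :=
  match n with
  | 0 => forall x, A x -> {for x, continuous f}
  | n'.+1 => (forall x, A x -> differentiable f x) /\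
             (forall v, Cn n' A ('D_v f))
  end.

Definition smooth {V W} (A : set V) (f : V -> W) : Prop :=
  forall n, Cn n A f.

(* Smoothness on a subset that need not be open (e.g. a submanifold): [f]
   extends, locally around each point of [A], to a smooth map on an open set. *)
Definition smooth_sub {V W} (A : set V) (f : V -> W) : Prop :=
  forall a, A a -> exists (N : set V) (F : V -> W),
    [/\ open_nbhs a N, smooth N F & {in A `&` N, F =1 f}].

Definition smooth_embedding {V W} (A : set V) (f : V -> W) : Prop :=
  [/\ smooth A f,
      forall x, A x -> injective ('d f x) &
      exists k : W -> V,
        {in A, cancel f k} /\ {within f @` A, continuous k}].

Definition smooth_submersion {V W} (A : set V) (f : V -> W) : Prop :=
  smooth A f /\ forall x, A x -> set_surj setT setT ('d f x).

Definition curve_at {V} (A : set V) (a : V) (c : R -> V) : Prop :=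
  c 0 = a /\
  exists I : set R, [/\ open_nbhs 0 I, smooth I c & set_fun I A c].

(* Tangent vectors of a submanifold [A] at [a]: velocities of curves in [A]. *)
Definition tangent {V} (A : set V) (a : V) : set V :=
  [set v | exists2 c, curve_at A a c & derive1 c 0 = v].

End smooth_maps.

Section symplectic.
Context {R : realType} {V : normedModType R}.
Implicit Types (G N : set V) (omega : V -> V -> V -> R).

(* [omega p u v] is the value of the 2-form at [p] on the vectors [u], [v].
   In [symplectic_closed], [u], [v], [w] are constant vector fields, so that
   no Lie bracket terms occur in [d omega (u, v, w)]. *)
Record symplectic_manifold G omega : Prop := SymplecticManifold {
  symplectic_open : open G;
  symplectic_linear : forall p, G p -> forall a u v w,
    omega p (a *: u + v) w = a * omega p u w + omega p v w;
  symplectic_alternating : forall p, G p -> forall u v,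
    omega p u v = - omega p v u;
  symplectic_smooth : forall u v, smooth G (fun p => omega p u v);
  symplectic_closed : forall p, G p -> forall u v w : V,
    'D_u (fun q => omega q v w) p - 'D_v (fun q => omega q u w) p
      + 'D_w (fun q => omega q u v) p = 0;
  symplectic_nondegenerate : forall p, G p -> forall u,
    (forall v, omega p u v = 0) -> u = 0
}.

(* The vector field [xi_f] such that [omega (xi_f, -) = df]. *)
Definition hamiltonian_field omega (f : V -> R) (p : V) : V :=
  xget 0 [set xi | forall v, omega p xi v = 'd f p v].

Definition symplectic_bracket omega (f g : V -> R) (p : V) : R :=
  'd g p (hamiltonian_field omega f p).

Definition lagrangian omega N : Prop :=
  forall p, N p -> forall v,
    tangent N p v <-> (forall u, tangent N p u -> omega p u v = 0).

(* The pull-back of [omega] by [F], evaluated on the velocities at time 0 of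
   two curves [c1], [c2] with [c1 0 = c2 0]; it makes sense for a map [F]
   that is only defined on a submanifold containing [c1] and [c2]. *)
Definition pullback {E : normedModType R} (F : E -> V) omega
    (c1 c2 : R -> E) : R :=
  omega (F (c1 0)) (derive1 (F \o c1) 0) (derive1 (F \o c2) 0).

End symplectic.

Section poisson.
Context {R : realType} {m : nat}.
Implicit Types (M : set 'rV[R]_m) (alpha : 'rV[R]_m -> 'M[R]_m).

Definition partial (i : 'I_m) (f : 'rV[R]_m -> R) : 'rV[R]_m -> R :=
  'D_(delta_mx 0 i) f.

(* The last condition is the vanishing of the Schouten bracket of [alpha]. *)
Record poisson_manifold M alpha : Prop := PoissonManifold {
  poisson_open : open M;
  poisson_antisym : forall x, M x -> (alpha x)^T = - alpha x;
  poisson_smooth : forall i j, smooth M (fun x => alpha x i j);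
  poisson_jacobi : forall x, M x -> forall i j k,
    \sum_l (alpha x i l * partial l (fun y => alpha y j k) x
          + alpha x j l * partial l (fun y => alpha y k i) x
          + alpha x k l * partial l (fun y => alpha y i j) x) = 0
}.

Definition poisson_bracket alpha (f g : 'rV[R]_m -> R) (x : 'rV[R]_m) : R :=
  \sum_i \sum_j alpha x i j * partial i f x * partial j g x.

(* The vector field [{f, -}]. *)
Definition poisson_field alpha (f : 'rV[R]_m -> R) (x : 'rV[R]_m) : 'rV[R]_m :=
  \row_j \sum_i alpha x i j * partial i f x.

(* The flow of some Hamiltonian vector field on [M] leads from [x] to [y];
   the time can be taken to be 1 by rescaling the Hamiltonian. *)
Definition hamiltonian_arc M alpha (x y : 'rV[R]_m) : Prop :=
  exists (f : 'rV[R]_m -> R) (c : R -> 'rV[R]_m),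
    [/\ smooth M f, c 0 = x, c 1 = y &
        forall t : R, 0 <= t <= 1 ->
          M (c t) /\ is_derive t (1 : R) c (poisson_field alpha f (c t))].

Definition symplectic_leaf M alpha (x : 'rV[R]_m) : set 'rV[R]_m :=
  [set y | clos_refl_trans _ (hamiltonian_arc M alpha) x y].

End poisson.

Section simply_connected.
Variables (R : realType) (T : topologicalType).

Definition path_in (A : set T) (x y : T) (c : R -> T) : Prop :=
  [/\ {within `[0, 1], continuous c}, set_fun `[0, 1] A c, c 0 = x & c 1 = y].

(* For the subspace topology of [A]. The leaves of a planar Poisson structure
   are open sets and points, so this is also their topology as manifolds. *)
Definition simply_connected (A : set T) : Prop :=
  [/\ A !=set0,
      forall x y, A x -> A y -> exists c, path_in A x y c &
      forall x c, path_in A x x c -> exists H : R * R -> T,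
        [/\ {within `[0, 1] `*` `[0, 1], continuous H},
            set_fun (`[0, 1] `*` `[0, 1]) A H,
            forall t, 0 <= t <= 1 -> H (0, t) = c t /\ H (1, t) = x &
            forall s, 0 <= s <= 1 -> H (s, 0) = x /\ H (s, 1) = x]].

End simply_connected.

Arguments simply_connected R {T} A.

Section groupoid.
Context {R : realType} {m : nat} {V : normedModType R}.
Local Notation W := 'rV[R]_m.
Variables (M : set W) (alpha : W -> 'M[R]_m) (G : set V)
  (omega : V -> V -> V -> R).

Definition poisson_map (l : V -> W) : Prop :=
  forall f g : W -> R, smooth M f -> smooth M g -> forall p, G p ->
    poisson_bracket alpha f g (l p) =
    symplectic_bracket omega (f \o l) (g \o l) p.

Definition anti_poisson_map (r : V -> W) : Prop :=
  forall f g : W -> R, smooth M f -> smooth M g -> forall p, G p ->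
    poisson_bracket alpha f g (r p) =
    - symplectic_bracket omega (f \o r) (g \o r) p.

Definition anti_poisson_self_map (i : V -> V) : Prop :=
  forall f g : V -> R, smooth G f -> smooth G g -> forall p, G p ->
    symplectic_bracket omega f g (i p) =
    - symplectic_bracket omega (f \o i) (g \o i) p.

Variables (j : W -> V) (l r : V -> W) (comp : V -> V -> V).

Definition arrows (x y : W) : set V := [set g | [/\ G g, l g = x & r g = y]].

Definition composable : set (V * V) :=
  [set gh | [/\ G gh.1, G gh.2 & r gh.1 = l gh.2]].

Record symplectic_groupoid_with_inverse (inv : V -> V) : Prop :=
  SymplecticGroupoidWithInverse {
  groupoid_base : poisson_manifold M alpha;
  groupoid_total : symplectic_manifold G omega;
  groupoid_j : set_fun M G j /\ set_inj M j;
  groupoid_l : set_fun G M l /\ set_surj G M l;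
  groupoid_r : set_fun G M r /\ set_surj G M r;
  groupoid_unit_ends : forall x, M x -> l (j x) = x /\ r (j x) = x;
  groupoid_comp : forall x y z g h, M x -> M y -> M z ->
    arrows x y g -> arrows y z h -> arrows x z (comp g h);
  groupoid_unit : forall x y g, M x -> M y -> arrows x y g ->
    comp (j x) g = g /\ comp g (j y) = g;
  groupoid_inverse : forall x y g, M x -> M y -> arrows x y g ->
    arrows y x (inv g) /\ comp g (inv g) = j x;
  groupoid_assoc : forall g h k, G g -> G h -> G k ->
    r g = l h -> r h = l k -> comp (comp g h) k = comp g (comp h k);
  groupoid_j_embedding : smooth_embedding M j;
  groupoid_l_submersion : smooth_submersion G l;
  groupoid_r_submersion : smooth_submersion G r;
  groupoid_comp_smooth : smooth_sub composable (fun gh => comp gh.1 gh.2);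
  groupoid_inv_smooth : smooth G inv;
  groupoid_lagrangian : lagrangian omega (j @` M);
  groupoid_l_poisson : poisson_map l;
  groupoid_r_anti_poisson : anti_poisson_map r;
  groupoid_multiplicative : forall (gh : V * V) (c1 c2 : R -> V * V),
    composable gh -> curve_at composable gh c1 -> curve_at composable gh c2 ->
    pullback (fun gh => comp gh.1 gh.2) omega c1 c2 =
    pullback fst omega c1 c2 + pullback snd omega c1 c2;
  groupoid_inv_anti_poisson : anti_poisson_self_map inv
}.

Definition symplectic_groupoid : Prop :=
  exists inv : V -> V, symplectic_groupoid_with_inverse inv.

End groupoid.

(* The coordinates x^1, x^2, pi_1, pi_2 have indices 0 and 1 in 'I_2. *)
Section planar.
Context {R : realType}.
Local Notation plane := 'rV[R]_2.
Local Notation phase := (plane * plane)%type.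
Variables (U : set plane) (phi : plane -> R).

Definition eps : 'M[R]_2 := \matrix_(i, j) ((i < j)%N%:R - (j < i)%N%:R).

Definition planar_bivector (x : plane) : 'M[R]_2 := phi x *: eps.

Local Notation "'∂_1'" := (partial (0 : 'I_2)).
Local Notation "'∂_2'" := (partial (1 : 'I_2)).

Definition xf (q : phase) : plane :=
  \row_i (q.1 0 i - phi q.1 * \sum_j eps i j * q.2 0 j).

Definition hfun (q : phase) : R :=
  let: (x, p) := q in
  if phi x != 0 then phi (xf q) / phi x
  else 1 - p 0 1 * ∂_1 phi x + p 0 0 * ∂_2 phi x.

(* As [U] is connected, the components below all coincide. *)
Definition planar_total : set phase :=
  \bigcup_(x in U) connected_component [set q | [/\ U q.1, U (xf q) & 0 < hfun q]]
                                       (x, 0).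

Definition planar_comp (g g' : phase) : phase := (g.1, g.2 + hfun g *: g'.2).

Definition psi (q : phase) : R :=
  let: (x, p) := q in
  if phi x != 0 then
    (1 + p 0 0 * ∂_2 phi x - p 0 1 * ∂_1 phi x - hfun q) / phi x
  else p 0 0 * p 0 1 * ∂_1 (∂_2 phi) x
       - 2^-1 * p 0 0 ^+ 2 * ∂_2 (∂_2 phi) x
       - 2^-1 * p 0 1 ^+ 2 * ∂_1 (∂_1 phi) x.

Definition wedge (a b : phase -> R) (u v : phase) : R := a u * b v - a v * b u.

Definition dx (i : 'I_2) (u : phase) : R := u.1 0 i.
Definition dpi (i : 'I_2) (u : phase) : R := u.2 0 i.

Definition planar_form (q u v : phase) : R :=
  let: (x, p) := q in
  (hfun q)^-1 *
    (psi q * wedge (dx 0) (dx 1) u v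
     + (1 - p 0 1 * ∂_1 phi x) * wedge (dx 0) (dpi 0) u v
     + p 0 0 * ∂_1 phi x * wedge (dx 0) (dpi 1) u v
     - p 0 1 * ∂_2 phi x * wedge (dx 1) (dpi 0) u v
     + (1 + p 0 0 * ∂_2 phi x) * wedge (dx 1) (dpi 1) u v
     + phi x * wedge (dpi 0) (dpi 1) u v).

End planar.

(* Main.v *)
(* Write w(p) = (-p_2, p_1), so that r(x, p) = x + phi(x) w(p). The functions h
   and psi are linked by h = 1 + dphi(x)[w(p)] - phi(x) psi, and phi(x) h is the
   value of phi at r(x, p). Near a zero of phi, psi is minus the second Taylor
   quotient in s of phi(x + s w(p)), taken at s = phi(x); Taylor quotients of
   smooth functions are smooth (Hadamard), hence so are psi and h.
   The connected component in the definition of the total space consists of the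
   (x, p) such that either phi(x) = 0, or x and r(x, p) lie in the same
   component of the set where phi does not vanish; it is therefore stable under
   composition and inversion.
   Where phi does not vanish, the 2-form is the difference of the pull-backs of
   dx^1 dx^2 / phi by r and by l, which yields closedness and multiplicativity;
   at a zero of phi, closedness follows by continuity (or trivially, if phi
   vanishes identically nearby), and multiplicativity is a polynomial identity
   in the 2-jet of phi. The brackets are computed from the inverse bivector, and
   the inversion is anti-symplectic by multiplicativity applied to g and its
   inverse, whose product stays in the Lagrangian submanifold of units. *)
From HB Require Import structures.
Require Import Defs.
From mathcomp Require Import all_boot all_order all_algebra.
From mathcomp Require Import all_classical all_reals all_analysis.
From mathcomp Require Import ring.
Import Order.TTheory GRing.Theory Num.Theory.
Import numFieldNormedType.Exports.
Set Implicit Arguments.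
Unset Strict Implicit.
Unset Printing Implicit Defensive.
Local Open Scope classical_set_scope.
Local Open Scope ring_scope.

(* [simpl] would otherwise unfold the limits hidden in [partial]. *)
Arguments hfun : simpl never.
Arguments psi : simpl never.

(** * Calculus of smooth maps *)

Section Cn_calculus.
Context {R : realType}.
Implicit Types V W E : normedModType R.

(** Smoothness is expressed by derivatives along constant vectors, and the chain rule does not
    preserve this: differentiating [f \o g] produces derivatives of [f] along directions that vary
    with the point. The substitutions that occur here are all a linear map plus finitely many scalar
    functions times fixed vectors, and for these the derivatives of [f] along fixed vectors suffice.
    Smooth division uses no parameter integral: the Taylor quotients of all orders form a family
    stable under differentiation, and their continuity comes from the Lagrange remainder. To turn
    the division by [phi x] into a division by a coordinate, the parameter [s] of the fibre is first
    made independent of [x]. *)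

Lemma near_eq_differentiable V W (f g : V -> W) (x : V) :
  (\near x, f x = g x) -> differentiable f x -> differentiable g x.
Proof.
move=> fg df.
have gx : g x = f x by rewrite (nbhs_singleton fg).
have H : g \o shift x = cst (g x) + 'd f x +o_ 0 id.
  apply/eqaddoP => e e0.
  have /eqaddoP/(_ e e0) := diff_locally df.
  have fg0 : \forall y \near (0 : V), f (y + x) = g (y + x).
    by rewrite (near_shift x) /=; near=> y; rewrite /= sub0r subrK; near: y.
  apply: filter_app; near=> y.
  rewrite -[_ y in X in X -> _]/(f (y + x) - (f x + 'd f x y)).
  rewrite -[_ y in X in _ -> X]/(g (y + x) - (g x + 'd f x y)).
  by rewrite gx; have <- : f (y + x) = g (y + x) by near: y.
have dc := diff_continuous df.
apply/diff_locallyP; rewrite (diff_unique dc H); split => //.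
Unshelve. all: by end_near. Qed.

Lemma open_near V (A : set V) (P : V -> Prop) x : open A -> A x ->
  (forall y, A y -> P y) -> \near x, P x.
Proof. by move=> oA Ax AP; near=> y; apply: AP; near: y; exact: open_nbhs_nbhs. 
Unshelve. all: by end_near. Qed.

Lemma derive_eq_open V W (A : set V) (f g : V -> W) v x : open A ->
  (forall y, A y -> f y = g y) -> A x -> 'D_v f x = 'D_v g x.
Proof. by move=> oA fg Ax; apply: near_eq_derive; apply: (open_near oA). Qed.

(** Needed after every derivative rule: the rules give ['D_v] only at points of [A], and openness
    makes agreement on [A] enough for the next derivative. *)
Lemma Cn_ext n V W (A : set V) (f g : V -> W) : open A ->
  (forall x, A x -> f x = g x) -> Cn n A f -> Cn n A g.
Proof.
move=> oA; elim: n f g => [|n IH] f g fg.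
  move=> /= cf x Ax; rewrite /prop_for /continuous_at -(fg x Ax).
  apply: cvg_trans (cf x Ax); apply: near_eq_cvg.
  by apply: (open_near oA Ax) => y /fg.
move=> [df Df]; split.
  by move=> x Ax; apply: near_eq_differentiable (df x Ax); exact: (open_near oA).
move=> v; apply: IH (Df v) => x Ax; exact: (derive_eq_open v oA).
Qed.

Lemma Cn_sub n V W (A B : set V) (f : V -> W) : B `<=` A -> Cn n A f -> Cn n B f.
Proof.
move=> BA; elim: n f => [|n IH] f; first by move=> cf x /BA; exact: cf.
by move=> [df Df]; split=> [x /BA/df//|v]; exact: IH (Df v).
Qed.

Lemma Cn_local n V W (A : set V) (f : V -> W) :
  (forall x, A x -> exists2 B : set V, B x & Cn n B f) -> Cn n A f.
Proof.
elim: n f => [|n IH] f H.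
  by move=> x /H [B Bx /(_ x Bx)].
split=> [x /H [B Bx [df _]]|v]; first exact: df.
by apply: IH => x /H [B Bx [_ Df]]; exists B => //; exact: Df.
Qed.

Lemma CnS_continuous n V W (A : set V) (f : V -> W) : Cn n A f -> Cn 0 A f.
Proof.
case: n => [|n]; first by move=> cf.
by move=> [df _] x Ax; apply: differentiable_continuous; exact: df.
Qed.

Lemma CnW n V W (A : set V) (f : V -> W) : Cn n.+1 A f -> Cn n A f.
Proof.
elim: n f => [|n IH] f; first exact: CnS_continuous.
by move=> [df Df]; split=> // v; apply: IH; exact: Df.
Qed.

Lemma Cn_cst n V W (A : set V) (w : W) : Cn n A (fun=> w).
Proof.
elim: n w => [|n IH] w; first by move=> x _; exact: cvg_cst.
split=> [x _|v]; first exact: differentiable_cst.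
by have -> : 'D_v (fun=> w) = (fun=> 0 : W) by apply/funext => x; exact: derive_cst.
Qed.

Lemma derive_linear V W (f : {linear V -> W}) v x : continuous f -> 'D_v f x = f v.
Proof. by move=> cf; rewrite deriveE ?diff_lin//; exact: linear_differentiable. Qed.

Lemma Cn_linear n V W (A : set V) (f : {linear V -> W}) : continuous f -> Cn n A f.
Proof.
move=> cf; case: n => [|n]; first by move=> x _; exact: cf.
split=> [x _|v]; first exact: linear_differentiable.
have -> : 'D_v f = (fun=> f v) by apply/funext => x; exact: derive_linear.
exact: Cn_cst.
Qed.

Lemma CnD n V W (A : set V) (f g : V -> W) : open A -> Cn n A f -> Cn n A g ->
  Cn n A (fun x => f x + g x).
Proof.
move=> oA; elim: n f g => [|n IH] f g.
  by move=> cf cg x Ax; apply: cvgD; [exact: cf|exact: cg].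
move=> [df Df] [dg Dg]; split=> [x Ax|v].
  by apply: differentiableD; [exact: df|exact: dg].
apply: Cn_ext (IH _ _ (Df v) (Dg v)) => // x Ax.
by rewrite deriveD//; apply: diff_derivable; [exact: df|exact: dg].
Qed.

Lemma Cn_lin_comp n V W E (A : set V) (f : V -> W) (L : {linear W -> E}) :
  open A -> continuous L -> Cn n A f -> Cn n A (fun x => L (f x)).
Proof.
move=> oA cL; elim: n f => [|n IH] f.
  by move=> cf x Ax; apply: continuous_comp; [exact: cf|exact: cL].
move=> [df Df]; split=> [x Ax|v].
  by apply: (@differentiable_comp _ _ _ _ f L); [exact: df|exact: linear_differentiable].
apply: Cn_ext (IH _ (Df v)) => // x Ax.
rewrite [RHS]deriveE; last first.
  by apply: (@differentiable_comp _ _ _ _ f L); [exact: df|exact: linear_differentiable].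
rewrite (@diff_comp _ _ _ _ f L); [|exact: df|exact: linear_differentiable].
by rewrite diff_lin//= deriveE//; exact: df.
Qed.

Lemma CnZ n V W (A : set V) (c : R) (f : V -> W) : open A -> Cn n A f ->
  Cn n A (fun x => c *: f x).
Proof. by move=> oA; apply: (@Cn_lin_comp n V W W A f ( *:%R c)) => // x; exact: scaler_continuous. Qed.

Lemma CnN n V W (A : set V) (f : V -> W) : open A -> Cn n A f ->
  Cn n A (fun x => - f x).
Proof. by move=> oA /(CnZ (-1) oA); apply: Cn_ext => // x _; rewrite scaleN1r. Qed.

Lemma CnB n V W (A : set V) (f g : V -> W) : open A -> Cn n A f -> Cn n A g ->
  Cn n A (fun x => f x - g x).
Proof. by move=> oA Cf Cg; apply: CnD => //; exact: CnN. Qed.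

Lemma Cn_scalel n V W (A : set V) (f : V -> R) (w : W) : open A -> Cn n A f ->
  Cn n A (fun x => f x *: w).
Proof.
move=> oA; elim: n f => [|n IH] f.
  by move=> cf x Ax; apply: cvgZr_tmp; exact: cf.
move=> [df Df]; split=> [x Ax|v].
  by apply: differentiableZl; exact: df.
apply: Cn_ext (IH _ (Df v)) => // x Ax.
rewrite [RHS]deriveE ?diffZl ?deriveE//; try exact: df.
by apply: differentiableZl; exact: df.
Qed.

Lemma Cn_sum n V W (A : set V) (I : Type) (s : seq I) (P : pred I) (f : I -> V -> W) : open A ->
  (forall i, Cn n A (f i)) -> Cn n A (fun x => \sum_(i <- s | P i) f i x).
Proof.
move=> oA Cf; elim: s => [|i s IH].
  by apply: Cn_ext (Cn_cst _ _ 0) => // x _; rewrite big_nil.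
case Pi : (P i).
  by apply: Cn_ext (CnD oA (Cf i) IH) => // x _; rewrite big_cons Pi.
by apply: Cn_ext IH => // x _; rewrite big_cons Pi.
Qed.

Lemma CnM n V (A : set V) (f g : V -> R) : open A -> Cn n A f -> Cn n A g ->
  Cn n A (fun x => f x * g x).
Proof.
move=> oA; elim: n f g => [|n IH] f g.
  by move=> cf cg x Ax; apply: cvgM; [exact: cf|exact: cg].
move=> /[dup] Cf [df Df] /[dup] Cg [dg Dg]; split=> [x Ax|v].
  by apply: differentiableM; [exact: df|exact: dg].
apply: Cn_ext (CnD oA (IH _ _ (CnW Cf) (Dg v)) (IH _ _ (CnW Cg) (Df v))) => // x Ax.
by rewrite deriveM//; apply: diff_derivable; [exact: df|exact: dg].
Qed.

Lemma CnX n V (A : set V) (f : V -> R) k : open A -> Cn n A f -> Cn n A (fun x => f x ^+ k).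
Proof.
move=> oA Cf; elim: k => [|k IH].
  by apply: (Cn_ext oA _ (@Cn_cst n V R A 1)) => // x _; rewrite expr0.
by apply: Cn_ext (CnM oA Cf IH) => // x _; rewrite exprS.
Qed.

Lemma CnV n V (A : set V) (f : V -> R) : open A -> (forall x, A x -> f x != 0) ->
  Cn n A f -> Cn n A (fun x => (f x)^-1).
Proof.
move=> oA f0; elim: n => [|n IH].
  by move=> cf x Ax; apply: cvgV; [exact: f0|exact: cf].
move=> /[dup] Cf [df Df]; split=> [x Ax|v].
  by apply: differentiableV; [exact: df|exact: f0].
have CV := IH (CnW Cf).
apply: Cn_ext (CnN oA (CnM oA (CnM oA CV CV) (Df v))) => // x Ax.
rewrite deriveV ?f0//; last by apply: diff_derivable; exact: df.
by rewrite expr2 invfM -mulNr.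
Qed.

Lemma derive_comp V W E (f : W -> E) (g : V -> W) v x :
  differentiable g x -> differentiable f (g x) ->
  'D_v (fun y => f (g y)) x = 'd f (g x) ('D_v g x).
Proof.
move=> dg df; rewrite deriveE; last exact: (@differentiable_comp _ _ _ _ g f).
by rewrite (@diff_comp _ _ _ _ g f)//= deriveE.
Qed.

Lemma derive_affine V W (L : {linear V -> W}) m (gam : 'I_m -> V -> R) (e : 'I_m -> W)
    (x : V) (g := fun x => L x + \sum_i gam i x *: e i) :
  continuous L -> (forall i, differentiable (gam i) x) ->
  differentiable g x /\
  forall v, 'D_v g x = L v + \sum_i 'D_v (gam i) x *: e i.
Proof.
move=> cL dgam.
have gE : (fun x => \sum_i gam i x *: e i) = \sum_(i < m) (fun x => gam i x *: e i).
  by apply/funext => y; rewrite fct_sumE.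
have dL : differentiable L x by exact: linear_differentiable.
have dS : differentiable (fun x => \sum_i gam i x *: e i) x.
  by rewrite gE; apply: differentiable_sum => i; exact: differentiableZl.
split=> [|v]; first exact: differentiableD.
rewrite /g (deriveD (f := L) (g := fun x => \sum_i gam i x *: e i)); last 2 first.
- exact: diff_derivable.
- exact: diff_derivable.
rewrite derive_linear//; congr (_ + _); rewrite gE derive_sum; last first.
  by move=> i; apply: diff_derivable; exact: differentiableZl.
apply: eq_bigr => i _.
rewrite (deriveE v (dgam i)) (deriveE v (differentiableZl (e i) (dgam i))).
by rewrite diffZl.
Qed.

(* The range of [g] is an affine perturbation with finitely many directions
   [e i], so that the derivatives of [f \o g] only involve the derivatives of
   [f] in fixed directions. *)
Lemma Cn_comp n V W (A : set V) (B : set W) (f : W -> R) (L : {linear V -> W})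
    m (gam : 'I_m -> V -> R) (e : 'I_m -> W) (g := fun x => L x + \sum_i gam i x *: e i) :
  open A -> continuous L -> (forall x, A x -> B (g x)) -> Cn n B f ->
  (forall i, Cn n A (gam i)) -> Cn n A (fun x => f (g x)).
Proof.
move=> oA cL AB.
elim: n f => [|n IH] f.
  move=> cf cgam x Ax; apply: continuous_comp; last exact/cf/AB.
  have : Cn 0 A g.
    apply: CnD => //; first exact: Cn_linear.
    by apply: Cn_sum => // i; exact: Cn_scalel.
  exact.
move=> [df Df] Cgam.
have gamP x : A x -> differentiable g x /\
    forall v, 'D_v g x = L v + \sum_i 'D_v (gam i) x *: e i.
  by move=> Ax; apply: derive_affine => // i; have [+ _] := Cgam i; exact.
split=> [x Ax|v].
  by apply: (@differentiable_comp _ _ _ _ g f); [exact: (gamP x Ax).1|exact/df/AB].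
have CL : Cn n A (fun x => 'D_(L v) f (g x)).
  by apply: (IH ('D_(L v) f)) => [|i]; [exact: Df|exact/CnW/Cgam].
have Ce i : Cn n A (fun x => 'D_v (gam i) x * 'D_(e i) f (g x)).
  apply: CnM => //; first by have [_] := Cgam i; exact.
  by apply: (IH ('D_(e i) f)) => [|k]; [exact: Df|exact/CnW/Cgam].
apply: Cn_ext (CnD oA CL (@Cn_sum _ _ _ _ _ (index_enum _) xpredT _ oA Ce)) => // x Ax.
have dfx := df _ (AB _ Ax); have [dg dgE] := gamP x Ax.
rewrite (derive_comp v dg dfx) dgE linearD linear_sum deriveE//; congr (_ + _).
by apply: eq_bigr => i _; rewrite linearZ/=; congr (_ * _); exact: deriveE.
Qed.

Lemma Cn_comp_linear n V W (A : set V) (B : set W) (f : W -> R) (L : {linear V -> W}) :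
  open A -> continuous L -> (forall x, A x -> B (L x)) -> Cn n B f ->
  Cn n A (fun x => f (L x)).
Proof.
(* A linear substitution is the case without any direction [e i]. *)
move=> oA cL AB Cf; pose gam (i : 'I_0) : V -> R := fun=> 0.
have E x : L x + \sum_i gam i x *: (0 : W) = L x by rewrite big_ord0 addr0.
apply: (@Cn_ext n _ _ A (fun x => f (L x + \sum_i gam i x *: (0 : W)))) => //.
  by move=> x Ax; rewrite E.
by apply: (@Cn_comp n _ _ A B f L 0 gam) => // [x Ax|[]//]; rewrite E; exact: AB.
Qed.

Lemma derive_comp_linear V W E (f : W -> E) (L : {linear V -> W}) v x : continuous L ->
  differentiable f (L x) ->
  differentiable (fun x => f (L x)) x /\ 'D_v (fun x => f (L x)) x = 'D_(L v) f (L x).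
Proof.
move=> cL df; have dL : differentiable L x by exact: linear_differentiable.
split; first exact: (differentiable_comp dL df).
by rewrite (derive_comp v dL df) (derive_linear v x cL) deriveE.
Qed.

Lemma smooth_derive V W (A : set V) (f : V -> W) v : smooth A f -> smooth A ('D_v f).
Proof. by move=> Sf n; have [_ Df] := Sf n.+1; exact: Df. Qed.

Lemma smooth_differentiable V W (A : set V) (f : V -> W) x :
  smooth A f -> A x -> differentiable f x.
Proof. by move=> Sf Ax; have [df _] := Sf 1; exact: df. Qed.

Lemma smooth_continuous V W (A : set V) (f : V -> W) x :
  smooth A f -> A x -> {for x, continuous f}.
Proof. by move=> Sf Ax; exact: (Sf 0 x Ax). Qed.

Lemma smooth_linear V W (A : set V) (L : {linear V -> W}) : continuous L -> smooth A L.
Proof. by move=> cL n; exact: Cn_linear. Qed.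

Lemma smooth_sub_set V W (A B : set V) (f : V -> W) : B `<=` A -> smooth A f -> smooth B f.
Proof. by move=> BA Sf n; exact: Cn_sub (Sf n). Qed.

End Cn_calculus.

(** * Symmetry of second derivatives *)

Section second_derivatives.
Context {R : realType}.
Implicit Types V : normedModType R.

Lemma derive_scale V (W : normedModType R) (f : V -> W) (c : R) v x : differentiable f x ->
  'D_(c *: v) f x = c *: 'D_v f x.
Proof. by move=> df; rewrite !deriveE// linearZ. Qed.

Lemma derive_add V (W : normedModType R) (f : V -> W) u v x : differentiable f x ->
  'D_(u + v) f x = 'D_u f x + 'D_v f x.
Proof. by move=> df; rewrite !deriveE// linearD. Qed.

Lemma line_differentiable V (x u : V) (s : R) : differentiable (fun s : R => x + s *: u) s.
Proof.
apply: (@differentiableD _ _ _ (cst x) (fun s : R => s *: u)).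
  exact: differentiable_cst.
exact: (@differentiableZl _ _ _ id).
Qed.

Lemma derive_line V (x u : V) (s : R) : 'D_1 (fun s : R => x + s *: u) s = u.
Proof.
rewrite (@deriveD _ _ _ (cst x) (fun s : R => s *: u)); first last.
- by apply: diff_derivable; exact: (@differentiableZl _ _ _ id).
- exact: derivable_cst.
rewrite derive_cst add0r deriveE; last exact: (@differentiableZl _ _ _ id).
by rewrite (@diffZl _ _ _ id)// -deriveE// derive_id scale1r.
Qed.

Lemma is_derive_line V (W : normedModType R) (f : V -> W) (x u : V) (s : R) :
  differentiable f (x + s *: u) ->
  is_derive s 1 (fun s => f (x + s *: u)) ('D_u f (x + s *: u)).
Proof.
move=> df; have dl := line_differentiable x u s; split.
  exact: diff_derivable (differentiable_comp dl df).
by rewrite (derive_comp (1 : R) dl df) derive_line deriveE.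
Qed.

Lemma MVT_line V (f : V -> R) (x u : V) :
  (forall s : R, 0 <= s <= 1 -> differentiable f (x + s *: u)) ->
  exists2 s : R, 0 <= s <= 1 & f (x + u) - f x = 'D_u f (x + s *: u).
Proof.
move=> df; have dF (s : R) : 0 <= s <= 1 -> is_derive s 1 (fun s => f (x + s *: u)) ('D_u f (x + s *: u)).
  by move=> /df; exact: is_derive_line.
have [|s||s s01] := @MVT_segment R (fun s => f (x + s *: u)) (fun s => 'D_u f (x + s *: u)) 0 1.
- exact: ler01.
- by rewrite in_itv => /andP[s0 s1]; apply: dF; rewrite !ltW.
- apply: derivable_within_continuous => s; rewrite in_itv => /dF.
  by case.
- by rewrite scale1r scale0r addr0 subr0 mulr1 => ->; exists s; move: s01; rewrite ?in_itv.
Qed.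

(** Mean value theorem twice: for the increment [f (y + v) - f y] along [u], then for ['D_u f] along
    [v]. *)
Lemma second_difference V (A : set V) (f : V -> R) (x u v : V) : Cn 2 A f ->
  (forall s s' : R, 0 <= s <= 1 -> 0 <= s' <= 1 -> A (x + s *: u + s' *: v)) ->
  exists s s' : R, [/\ 0 <= s <= 1, 0 <= s' <= 1 &
    f (x + u + v) - f (x + u) - (f (x + v) - f x) =
    'D_v ('D_u f) (x + s *: u + s' *: v)].
Proof.
move=> [df D2] inA.
have z01 : 0 <= (0 : R) <= 1 by rewrite lexx ler01.
have o01 : 0 <= (1 : R) <= 1 by rewrite lexx ler01.
have inA0 (s : R) : 0 <= s <= 1 -> A (x + s *: u).
  by move=> s01; have := inA s 0 s01 z01; rewrite scale0r addr0.
have inA1 (s : R) : 0 <= s <= 1 -> A (x + s *: u + v).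
  by move=> s01; have := inA s 1 s01 o01; rewrite scale1r.
have dsh y : A (y + v) -> differentiable (fun y => f (y + v)) y.
  move=> Ay; apply: (@differentiable_comp _ _ _ _ (fun y => y + v) f); last exact: df.
  exact: (@differentiableD _ _ _ id (cst v)).
have Dsh y : A (y + v) -> 'D_u (fun y => f (y + v)) y = 'D_u f (y + v).
  move=> Ay; have dtr : differentiable (fun y : V => y + v) y.
    exact: (@differentiableD _ _ _ id (cst v)).
  rewrite (derive_comp u dtr (df _ Ay)) (@deriveD _ _ _ id (cst v))//.
  by rewrite derive_id derive_cst addr0 deriveE//; exact: df.
have [s s01|s s01 E] := @MVT_line V (fun y => f (y + v) - f y) x u.
  by apply: (@differentiableB _ _ _ (fun y => f (y + v)) f); [exact/dsh/inA1|exact/df/inA0].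
have [du _] := D2 u.
have [s' s'01|s' s'01 E'] := @MVT_line V ('D_u f) (x + s *: u) v.
  by apply: du; exact: inA.
exists s, s'; split=> //; rewrite -E'.
rewrite E (@deriveB _ _ _ (fun y => f (y + v)) f).
- by rewrite Dsh//; exact: inA1.
- by apply/diff_derivable/dsh/inA1.
- by apply/diff_derivable/df/inA0.
Qed.

(** Takes the place of a limit in [deriveC], where the mean value points depend on the scale in an
    uncontrolled way. *)
Lemma continuous_eq_at V (p q : V -> R) (x : V) :
  {for x, continuous p} -> {for x, continuous q} ->
  (forall r : R, 0 < r -> exists y z, [/\ ball x r y, ball x r z & p y = q z]) ->
  p x = q x.
Proof.
move=> cp cq H; apply/eqP; rewrite -subr_eq0 -normr_le0; apply/ler_addgt0Pr => e e0.
have e20 : 0 < e / 2 by rewrite divr_gt0.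
have /cvgrPdist_lt/(_ _ e20)/nbhs_ballP[r1 /= r10 N1] := cp.
have /cvgrPdist_lt/(_ _ e20)/nbhs_ballP[r2 /= r20 N2] := cq.
have [|y [z [xy xz pq]]] := H (Num.min r1 r2); first by rewrite lt_min r10.
have py : `|p x - p y| < e / 2 by apply: N1; apply: le_ball xy; rewrite ge_min lexx.
have qz : `|q x - q z| < e / 2 by apply: N2; apply: le_ball xz; rewrite ge_min lexx orbT.
rewrite add0r (le_trans (ler_distD (p y) _ _))// [e]splitr lerD ?ltW//.
by rewrite pq distrC.
Qed.

(** The second difference of [f] along [t *: u] and [t *: v] is symmetric, and each order of taking
    it gives [t * t] times one mixed derivative at a point close to [x]. *)
Lemma deriveC V (A : set V) (f : V -> R) (x u v : V) : open A -> Cn 2 A f -> A x ->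
  'D_u ('D_v f) x = 'D_v ('D_u f) x.
Proof.
move=> oA Cf Ax; have [df D2] := Cf.
have cont w w' : {for x, continuous ('D_w ('D_w' f))}.
  by have [_ D1] := D2 w'; exact: (D1 w x Ax).
apply: (@continuous_eq_at V ('D_u ('D_v f)) ('D_v ('D_u f))) => // r' r'0.
have /nbhs_ballP[r3 /= r30 N3] : nbhs x A by exact: open_nbhs_nbhs.
pose r : R := Num.min r' r3.
have r0 : 0 < r by rewrite lt_min r'0.
have rr y : ball x r y -> ball x r' y by apply: le_ball; rewrite ge_min lexx.
have rA y : ball x r y -> A y.
  by move=> ry; apply: N3; apply: le_ball ry; rewrite ge_min lexx orbT.
have n0 : 0 <= `|u| + `|v| by rewrite addr_ge0.
have [t t0 tr] : exists2 t : R, 0 < t & t * (`|u| + `|v|) < r.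
  (* The [+ 1] keeps the quotient meaningful when both directions vanish and makes the bound
     strict. *)
  move: (`|u| + `|v|) n0 => n n0; exists (r / (n + 1)).
    by rewrite divr_gt0// ltr_wpDl.
  by rewrite mulrAC ltr_pdivrMr ?ltr_wpDl// ltr_pM2l// ltrDl.
have inB (p q : V) (s s' : R) : `|p| + `|q| = `|u| + `|v| -> 0 <= s <= 1 -> 0 <= s' <= 1 ->
    ball x r (x + s *: (t *: p) + s' *: (t *: q)).
  move=> pq /andP[s0 s1] /andP[s'0 s'1].
  rewrite -ball_normE /= -addrA opprD addrA subrr sub0r normrN.
  apply: (le_lt_trans (ler_normD _ _)).
  have nE (w : V) (c : R) : 0 <= c -> `|c *: (t *: w)| = c * (t * `|w|).
    by move=> c0; rewrite normrZ normrZ ger0_norm// gtr0_norm.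
  rewrite !nE//; apply: le_lt_trans tr.
  by rewrite -pq mulrDr lerD// ler_piMl// mulr_ge0// ltW.
have [s1 [s1' [h1 h1' E1]]] := @second_difference V A f x (t *: u) (t *: v) Cf
  (fun s s' hs hs' => rA _ (inB u v s s' erefl hs hs')).
have [s2 [s2' [h2 h2' E2]]] := @second_difference V A f x (t *: v) (t *: u) Cf
  (fun s s' hs hs' => rA _ (inB v u s s' (addrC _ _) hs hs')).
have b1 := inB u v _ _ erefl h1 h1'; have b2 := inB v u _ _ (addrC _ _) h2 h2'.
exists (x + s2 *: (t *: v) + s2' *: (t *: u)), (x + s1 *: (t *: u) + s1' *: (t *: v)).
split; [exact: rr|exact: rr|].
have Dt (p q y : V) : A y -> 'D_(t *: p) ('D_(t *: q) f) y = t * t * 'D_p ('D_q f) y.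
  move=> Ay; have [dq _] := D2 q.
  have -> : 'D_(t *: p) ('D_(t *: q) f) y = 'D_(t *: p) (t *: ('D_q f : V -> R)) y.
    by apply: (derive_eq_open (A := A)) => // z Az; rewrite derive_scale//; exact: df.
  have dq' : derivable ('D_q f) y (t *: p) by exact/diff_derivable/dq.
  rewrite (deriveZ t dq') (derive_scale t p (dq y Ay)); exact: mulrA.
rewrite (Dt _ _ _ (rA _ b1)) in E1; rewrite (Dt _ _ _ (rA _ b2)) in E2.
have tt0 : t * t != 0 by rewrite mulf_neq0// gt_eqF.
apply: (mulfI tt0); refine (etrans (esym E2) (etrans _ E1)).
rewrite -(addrA x (t *: v)) (addrC (t *: v)) addrA.
move: (f _) (f _) (f _) (f _) => a b c d; ring.
Qed.

End second_derivatives.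

(** * Derivative rules as a relation, and products with a vanishing factor *)

Section derivative_rules.
Context {R : realType}.
Implicit Types V W : normedModType R.

(* The class [is_derive] as a plain predicate: with it, the rules below can be
   applied in goals where the derivative is still to be determined. *)
Definition has_derive V W (x v : V) (f : V -> W) (a : W) : Prop :=
  derivable f x v /\ 'D_v f x = a.

Lemma is_deriveP V W (x v : V) (f : V -> W) (a : W) : is_derive x v f a <-> has_derive x v f a.
Proof. by split=> -[? ?]; split. Qed.

Lemma has_derive_eq V W (f : V -> W) (x v : V) a b : has_derive x v f a -> a = b ->
  has_derive x v f b.
Proof. by move=> ? <-. Qed.

Lemma has_derive_const V W (c : W) (x v : V) : has_derive x v (fun=> c) 0.
Proof. by split; [exact: derivable_cst|exact: derive_cst]. Qed.

Lemma has_derive_add V W (f g : V -> W) x v a b : has_derive x v f a -> has_derive x v g b ->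
  has_derive x v (fun y => f y + g y) (a + b).
Proof. by move=> [df <-] [dg <-]; split; [exact: derivableD|exact: deriveD]. Qed.

Lemma has_derive_sub V W (f g : V -> W) x v a b : has_derive x v f a -> has_derive x v g b ->
  has_derive x v (fun y => f y - g y) (a - b).
Proof. by move=> [df <-] [dg <-]; split; [exact: derivableB|exact: deriveB]. Qed.

Lemma has_derive_mul V (f g : V -> R) x v a b : has_derive x v f a -> has_derive x v g b ->
  has_derive x v (fun y => f y * g y) (f x * b + g x * a).
Proof.
move=> [df <-] [dg <-]; split; first exact: (derivableM df dg).
exact: (deriveM df dg).
Qed.

Lemma has_derive_inv V (f : V -> R) x v a : f x != 0 -> has_derive x v f a ->
  has_derive x v (fun y => (f y)^-1) (- a / f x ^+ 2).
Proof.
move=> fx0 [df <-]; split; first exact: derivableV.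
by rewrite deriveV//= mulNr mulrC -mulNr.
Qed.

Lemma has_derive_pow V (f : V -> R) x v a n : has_derive x v f a ->
  has_derive x v (fun y => f y ^+ n) (n%:R * f x ^+ n.-1 * a).
Proof.
move=> /is_deriveP df; have := @is_deriveX R V f n x v a df.
rewrite (_ : f ^+ n = fun y => f y ^+ n); last first.
  by apply/funext => y; elim: n => [|n IH]; rewrite ?expr0// !exprS -IH.
by move=> /is_deriveP H; apply: has_derive_eq H _; rewrite /GRing.scale/= -mulr_natl.
Qed.

Lemma has_derive_lin V W (f : {linear V -> W}) x v : continuous f -> has_derive x v f (f v).
Proof.
move=> cf; split; first exact/diff_derivable/linear_differentiable.
exact: derive_linear.
Qed.

Lemma diff_has_derive V W (f : V -> W) x v : differentiable f x -> has_derive x v f ('D_v f x).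
Proof. by move=> df; split=> //; exact: diff_derivable. Qed.

Lemma has_derive_val V W (f : V -> W) x v a : has_derive x v f a -> 'D_v f x = a.
Proof. by case. Qed.

(** Continuity of [c] suffices because its increment is multiplied by [f], already of first order at
    a zero. It serves for products of a coordinate with a Taylor quotient not yet known to be
    differentiable. *)
Lemma diff_mul_vanish V (f c : V -> R) x : differentiable f x -> f x = 0 ->
  {for x, continuous c} ->
  differentiable (fun y => f y * c y) x /\
  forall v, 'D_v (fun y => f y * c y) x = 'D_v f x * c x.
Proof.
move=> df fx0 cc; set F := fun y => f y * c y.
have dfc := diff_continuous df.
have [K K0 HK] := linear_lipschitz dfc.
have lc : continuous (c x \*: 'd f x) by move=> y; exact/continuousZl_tmp/dfc.
have H : F \o shift x = cst (F x) + (c x \*: 'd f x) +o_ 0 id.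
  apply/eqaddoP => e e0.
  (* The increment of [c] is kept below 1, so that [C] bounds [c] nearby, and below [e / 2 / K],
     against the Lipschitz constant [K] of the differential. *)
  pose C := `|c x| + 1.
  have C0 : 0 < C by rewrite ltr_wpDl.
  have d0 : 0 < e / 2 / C by rewrite !divr_gt0.
  have k0 : 0 < Num.min 1 (e / 2 / K) by rewrite lt_min ltr01 !divr_gt0.
  have /eqaddoP/(_ _ d0) := diff_locally df.
  have : \forall h \near (0 : V), `|c x - c (h + x)| < Num.min 1 (e / 2 / K).
    have /cvgrPdist_lt/(_ _ k0)/nbhs_ballP[r r0 Hr] := cc.
    apply/nbhs_ballP; exists r => // h; rewrite -ball_normE /= sub0r normrN => hr.
    by apply: Hr; rewrite -ball_normE /= opprD addrCA subrr addr0 normrN.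
  apply: filterS2 => h.
  rewrite lt_min => /andP[c1 cK].
  rewrite -[_ h in X in X -> _]/(f (h + x) - (f x + 'd f x h)).
  rewrite -[_ h in X in _ -> X]/(f (h + x) * c (h + x) - (f x * c x + c x * 'd f x h)).
  rewrite fx0 mul0r !add0r /= => fh.
  rewrite (_ : _ - _ = (f (h + x) - 'd f x h) * c (h + x) +
    'd f x h * (c (h + x) - c x)); last by ring.
  rewrite (le_trans (ler_normD _ _))// !normrM (splitr e) mulrDl lerD//.
    rewrite (@le_trans _ _ (e / 2 / C * `|h| * C))//; last first.
      by rewrite mulrAC divfK// gt_eqF.
    rewrite ler_pM// /C -[c (h + x)](subrK (c x)) addrC (le_trans (ler_normD _ _))//.
    by rewrite addrC [X in _ <= X]addrC lerD2r distrC ltW.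
  rewrite (@le_trans _ _ (K * `|h| * (e / 2 / K)))//; last first.
    by rewrite mulrC !mulrA mulfVK// gt_eqF.
  by rewrite ler_pM// distrC ltW.
have dE : 'd F x = (c x \*: 'd f x) :> (V -> R) by exact: diff_unique.
have dF : differentiable F x by apply/diff_locallyP; rewrite dE.
by split=> // v; rewrite (deriveE v dF) (deriveE v df) dE /= mulrC.
Qed.

End derivative_rules.

(** * Smooth division by a variable *)

Section hadamard.
Context {R : realType} {Y : normedModType R}.
Local Notation P := (Y * R)%type.
Implicit Types (g f : P -> R) (z w : P) (A : set P).

Definition slice0 z : P := (z.1, 0).

Lemma slice0_is_linear : linear slice0.
Proof. by move=> a u v; rewrite /slice0; congr pair => /=; rewrite scaler0 addr0. Qed.

HB.instance Definition _ := GRing.isLinear.Build R P P *:%R slice0 slice0_is_linear.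

Lemma fst_continuous : continuous (fst : P -> Y).
Proof. by move=> z; exact: cvg_fst. Qed.

Lemma snd_continuous : continuous (snd : P -> R).
Proof. by move=> z; exact: cvg_snd. Qed.

Lemma slice0_continuous : continuous slice0.
Proof. 
move=> z; apply: differentiable_continuous.
apply: (@differentiable_pair _ _ _ _ fst (cst 0)); last exact: differentiable_cst.
exact: (linear_differentiable _ fst_continuous).
 Qed.

Definition sder g : P -> R := 'D_((0 : Y), (1 : R)) g.

Definition sdern n g : P -> R := iter n sder g.

Lemma sdernSr n g : sdern n.+1 g = sdern n (sder g).
Proof. exact: iterSr. Qed.

(* Remainder of the Taylor expansion of order [k] in the last variable at 0. *)
Fixpoint taylor_rem k g z : R :=
  match k with
  | 0 => g z
  | k'.+1 => taylor_rem k' g z - k'`!%:R^-1 * (z.2 ^+ k' * sdern k' g (slice0 z))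
  end.

(** The value on the slice is the Taylor coefficient of order [k], the one that makes the quotient
    continuous for smooth [g]. *)
Definition taylor_quo k g z : R :=
  if z.2 == 0 then k`!%:R^-1 * sdern k g (slice0 z) else taylor_rem k g z / z.2 ^+ k.

(** Only the last variable is contracted; this keeps [slice0 z] and the mean value points in [A]. *)
Definition star_shaped A := forall z (t : R), A z -> 0 <= t <= 1 -> A (z.1, t * z.2).

Lemma smooth_sdern A g n : smooth A g -> smooth A (sdern n g).
Proof. by elim: n g => // n IH g Sg; rewrite sdernSr; apply/IH/smooth_derive. Qed.

Section on_star_shaped.
Variables (A : set P) (oA : open A) (starA : star_shaped A).

Lemma slice0_in z : A z -> A (slice0 z).
Proof.
by move=> /starA/(_ _ )H; have := H 0; rewrite mul0r; apply; rewrite lexx ler01.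
Qed.

Lemma sdern_ext n g f z : (forall z, A z -> g z = f z) -> A z -> sdern n g z = sdern n f z.
Proof.
move=> gf; elim: n z => [|n IH] z Az; first exact: gf.
exact: (derive_eq_open _ oA).
Qed.

Lemma sdern_derive n g w z : smooth A g -> A z -> 'D_w (sdern n g) z = sdern n ('D_w g) z.
Proof.
elim: n g z => [//|n IH] g z Sg Az; rewrite (sdernSr n g) (sdernSr n ('D_w g)).
apply: etrans (IH (sder g) z (smooth_derive _ Sg) Az) _.
apply: sdern_ext Az => z' Az'.
exact: (@deriveC R _ A g z' w (0, 1) oA (Sg 2) Az').
Qed.

Lemma smooth_slice0 g : smooth A g -> smooth A (fun z => g (slice0 z)).
Proof.
move=> Sg n.
exact: (@Cn_comp_linear R n _ _ A A g slice0 oA slice0_continuous slice0_in (Sg n)).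
Qed.

Lemma has_derive_slice0 g w z : smooth A g -> A z ->
  has_derive z w (fun z => g (slice0 z)) ('D_(slice0 w) g (slice0 z)).
Proof.
move=> Sg Az; have dg := smooth_differentiable Sg (slice0_in Az).
have [d <-] := derive_comp_linear (L := slice0) w slice0_continuous dg.
exact: diff_has_derive.
Qed.

Lemma has_derive_snd_pow k w z : has_derive z w (fun z : P => z.2 ^+ k) (k%:R * z.2 ^+ k.-1 * w.2).
Proof.
apply: has_derive_pow; apply: (has_derive_lin (f := snd)); exact: snd_continuous.
Qed.

Lemma smooth_taylor_rem k g : smooth A g -> smooth A (taylor_rem k g).
Proof.
move=> Sg; elim: k => [//|k IH] n; apply: CnB => //.
apply: CnM => //; first exact: Cn_cst.
apply: CnM => //; last by apply: smooth_slice0; exact: smooth_sdern.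
by apply: CnX => //; apply: (@Cn_linear R n _ _ A snd); exact: snd_continuous.
Qed.

Lemma derive_taylor_rem_fst k g w z : smooth A g -> A z -> w.2 = 0 ->
  'D_w (taylor_rem k g) z = taylor_rem k ('D_w g) z.
Proof.
move=> Sg Az w0; elim: k => [//|k IH].
have Sk := smooth_sdern k Sg.
have dr := smooth_differentiable (smooth_taylor_rem k Sg) Az.
apply: has_derive_val; apply: has_derive_eq.
  apply: has_derive_sub; first exact: diff_has_derive.
  apply: has_derive_mul; first exact: has_derive_const.
  by apply: has_derive_mul; [exact: has_derive_snd_pow|exact: has_derive_slice0].
rewrite IH /= w0 mulr0 !mulr0 !addr0; congr (_ - _ * (_ * _)).
have -> : slice0 w = w by rewrite /slice0 -[0 in LHS]w0 -surjective_pairing.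
by rewrite sdern_derive//; exact: slice0_in.
Qed.

(** The derivative of a Taylor polynomial in the last variable is the Taylor polynomial of [sder g],
    one order lower. *)
Lemma derive_taylor_rem_snd k g z : smooth A g -> A z ->
  sder (taylor_rem k.+1 g) z = taylor_rem k (sder g) z.
Proof.
move=> Sg Az; elim: k => [|k IH].
  have dg := smooth_differentiable Sg Az.
  apply: has_derive_val; apply: has_derive_eq.
    apply: has_derive_sub; first exact: diff_has_derive.
    apply: has_derive_mul; first exact: has_derive_const.
    by apply: has_derive_mul; [exact: has_derive_snd_pow|exact: (has_derive_slice0 _ Sg)].
  rewrite (_ : slice0 (0, 1) = 0)// derive0 /sdern /= -/(sder g).
  change ('D_(0, 1) g z) with (sder g z); ring.
have Sk := smooth_sdern k.+1 Sg.
have dr := smooth_differentiable (smooth_taylor_rem k.+1 Sg) Az.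
apply: has_derive_val; apply: has_derive_eq.
  apply: has_derive_sub; first exact: diff_has_derive.
  apply: has_derive_mul; first exact: has_derive_const.
  by apply: has_derive_mul; [exact: has_derive_snd_pow|exact: has_derive_slice0].
rewrite -/(sder _ _) IH /= -sdernSr.
rewrite (_ : slice0 (0, 1) = 0)// derive0 factS natrM.
have k0 : k`!%:R != 0 :> R by rewrite pnatr_eq0 -lt0n fact_gt0.
rewrite -[sdern k.+1 g _]/(sder (sdern k g) _).
have : k.+1%:R != 0 :> R by rewrite pnatr_eq0.
by move: (k.+1%:R : R) => K K0; field; rewrite k0 K0.
Qed.

(** Exposes a factor [z.2] in front of a quotient that is continuous for smooth [g]: on the slice
    this is the situation of [diff_mul_vanish]. *)
Lemma taylor_quo_rec k g z :
  taylor_quo k g z = k`!%:R^-1 * sdern k g (slice0 z) + z.2 * taylor_quo k.+1 g z.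
Proof.
rewrite /taylor_quo; case: eqVneq => [->|s0]; first by rewrite mul0r addr0.
have k0 : k`!%:R != 0 :> R by rewrite pnatr_eq0 -lt0n fact_gt0.
by rewrite /= exprS; field; rewrite s0 k0 expf_neq0.
Qed.

(* Lagrange form, by induction on [k] from Cauchy's mean value theorem. *)
Lemma taylor_quo_lagrange k g z : smooth A g -> A z ->
  exists2 t : R, 0 <= t <= 1 & taylor_quo k g z = k`!%:R^-1 * sdern k g (z.1, t * z.2).
Proof.
have z01 : 0 <= (0 : R) <= 1 by rewrite lexx ler01.
elim: k g z => [|k IH] g z Sg Az.
  exists 1; first by rewrite lexx ler01.
  rewrite mul1r -surjective_pairing /taylor_quo fact0 invr1 !mul1r /sdern /= mulr1.
  by case: eqVneq => // z0; rewrite /slice0 -z0 -surjective_pairing.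
have [z0|z0] := eqVneq z.2 0.
  by exists 0 => //; rewrite /taylor_quo z0 eqxx mul0r.
(* [F] vanishes at 0 and at 1; Rolle for [F] is Cauchy's theorem for the remainder against
   [t ^+ k.+1]. *)
pose F (t : R) : R := taylor_rem k.+1 g (z.1, t * z.2) - t ^+ k.+1 * taylor_rem k.+1 g z.
have dF (t : R) : 0 <= t <= 1 -> has_derive t 1 F
   (z.2 * taylor_rem k (sder g) (z.1, t * z.2) - k.+1%:R * t ^+ k * taylor_rem k.+1 g z).
  move=> t01; have Azt := starA Az t01.
  have dr := smooth_differentiable (smooth_taylor_rem k.+1 Sg) Azt.
  apply: has_derive_sub.
    have lE (s : R) : (z.1, s * z.2) = (z.1, 0) + s *: ((0 : Y), z.2) :> P.
      by congr pair; rewrite /= ?scaler0 ?addr0 ?add0r.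
    rewrite (_ : (fun y : R => _) = fun s : R => taylor_rem k.+1 g ((z.1, 0) + s *: ((0 : Y), z.2))); last first.
      by apply/funext => s; rewrite lE.
    rewrite lE in dr; apply: has_derive_eq ((is_deriveP _ _ _ _).1 (is_derive_line dr)) _.
    rewrite -lE -derive_taylor_rem_snd// -[RHS]/(z.2 *: 'D_(0, 1) (taylor_rem k.+1 g) (z.1, t * z.2)).
    rewrite lE -(derive_scale z.2 _ dr); congr (derive _ _ _).
    by congr pair; rewrite /= ?scaler0 // [RHS]mulr1.
  apply: has_derive_eq.
    apply: has_derive_mul; last exact: has_derive_const.
    exact: (has_derive_pow k.+1 ((is_deriveP _ _ _ _).1 (is_derive_id t 1))).
  by rewrite mulr0 add0r mulr1 mulrC.
have [||||c c01 [_ Fc]] := @Rolle R F 0 1.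
- exact: ltr01.
- by move=> t; rewrite in_itv /= => /andP[t0 t1]; have [|] := dF t => //; rewrite !ltW.
- by apply: derivable_within_continuous => t; rewrite in_itv /= => /dF[].
- rewrite /F mul0r mul1r expr1n mul1r -surjective_pairing subrr expr0n mul0r subr0 /=.
  have : taylor_rem k.+1 g (z.1, 0) = 0.
    elim: k {F IH dF} => [|k /= ->]; rewrite /= /slice0 /=.
      by rewrite expr0 fact0 invr1 !mul1r subrr.
    by rewrite sub0r expr0n /= mul0r mulr0 oppr0.
  by move=> /= ->.
have {c01}[c0 c1] : 0 < c /\ c < 1 by move: c01; rewrite in_itv => /andP.
have [|_] := dF c; first by rewrite !ltW.
rewrite Fc => /esym/eqP; rewrite subr_eq0 => /eqP E.
have ccl : 0 <= c <= 1 by rewrite !ltW.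
have [t t01 Et] := IH (sder g) (z.1, c * z.2) (smooth_derive _ Sg) (starA Az ccl).
(* The induction hypothesis was used at height [c * z.2], so the two contraction factors
   multiply. *)
exists (t * c).
  have /andP[t0 t1] := t01.
  by rewrite mulr_ge0 ?(ltW c0)//= mulr_ile1 ?(ltW c0)// ltW.
rewrite sdernSr -mulrA; move: Et; rewrite /= /taylor_quo /= (negbTE z0) mulf_eq0 (gt_eqF c0) (negbTE z0) /=.
rewrite -[taylor_rem k g z - _]/(taylor_rem k.+1 g z).
set r := taylor_rem k.+1 g z in E *; set q := taylor_rem k _ _ in E *.
have k0 : k`!%:R != 0 :> R by rewrite pnatr_eq0 -lt0n fact_gt0.
have k10 : k.+1%:R != 0 :> R by rewrite pnatr_eq0.
have ck0 : c ^+ k != 0 by rewrite expf_neq0// gt_eqF.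
have zk0 : z.2 ^+ k != 0 by rewrite expf_neq0.
rewrite factS natrM exprS exprMn => H.
have rE : r = z.2 * q / (k.+1%:R * c ^+ k).
  by rewrite E mulrC mulKf// mulf_neq0.
rewrite rE; move: (sdern k (sder g) _) H => S H.
have -> : S = k`!%:R * (q / (c ^+ k * z.2 ^+ k)) by rewrite H mulVKf.
move: (k.+1%:R : R) k10 => K K0.
by field; rewrite z0 zk0 ck0 K0 k0.
Qed.

End on_star_shaped.
End hadamard.

(** * Smoothness of the Taylor quotients *)

Section hadamard_smooth.
Context {R : realType} {Y : normedModType R}.
Local Notation P := (Y * R)%type.
Implicit Types (g f : P -> R) (z w : P).
Variables (A : set P) (oA : open A) (starA : star_shaped A).

Let A' : set P := A `&` [set z | z.2 != 0].

Let oA' : open A'.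
Proof.
apply: openI => //.
have -> : [set z : P | z.2 != 0] = (snd : P -> R) @^-1` [set s | s != 0].
  by [].
apply: open_comp; first by move=> z _; exact: snd_continuous.
exact: open_neq.
Qed.

Lemma smooth_snd (B : set P) : smooth B (snd : P -> R).
Proof. by move=> n; apply: (@Cn_linear R n _ _ B snd); exact: snd_continuous. Qed.

Lemma taylor_quoE k g z : A' z -> taylor_rem k g z * (z.2 ^+ k)^-1 = taylor_quo k g z.
Proof. by move=> [_ /= z0]; rewrite /taylor_quo (negbTE z0). Qed.

Lemma smooth_taylor_quo_away k g : smooth A g -> smooth A' (taylor_quo k g).
Proof.
move=> Sg n; apply: Cn_ext oA' (@taylor_quoE k g) _.
apply: CnM oA' _ _.
  by apply: (@Cn_sub R n _ _ A) => [z []//|]; exact: smooth_taylor_rem.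
apply: CnV oA' _ _; first by move=> z [_ z0]; rewrite expf_neq0.
by apply: CnX oA' _; exact: smooth_snd.
Qed.

(** At a point of the slice, the Lagrange form expresses nearby values through [sdern k g] at
    contracted points, which are no farther from [z]. *)
Lemma taylor_quo_continuous k g z : smooth A g -> A z -> {for z, continuous (taylor_quo k g)}.
Proof.
move=> Sg Az; have [z0|z0] := eqVneq z.2 0; last first.
  exact: (smooth_taylor_quo_away k Sg 0 z (conj Az z0)).
have zE : z = (z.1, 0) by rewrite -z0 -surjective_pairing.
apply/cvgrPdist_lt => e e0.
have k0 : 0 < k`!%:R :> R by rewrite ltr0n fact_gt0.
have ek0 : 0 < e * k`!%:R by rewrite mulr_gt0.
have /cvgrPdist_lt/(_ _ ek0)/nbhs_ballP[r1 /= r10 H1] := smooth_sdern k Sg 0 z Az.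
have /nbhs_ballP[r2 /= r20 H2] : nbhs z A by exact: open_nbhs_nbhs.
apply/(@nbhs_ballP _ P z); exists (Num.min r1 r2) => /=; first by rewrite lt_min r10.
move=> z' zz'.
have Az' : A z' by apply: H2; apply: le_ball zz'; rewrite ge_min lexx orbT.
have [t t01 ->] := taylor_quo_lagrange oA starA k Sg Az'.
rewrite {1}/taylor_quo z0 eqxx /slice0 -zE -mulrBr normrM normfV (gtr0_norm k0).
rewrite mulrC ltr_pdivrMr//; apply: H1.
have [B1 B2] : ball z r1 z' by apply: le_ball zz'; rewrite ge_min lexx.
split=> //=; move: B2; rewrite -!ball_normE /= z0 !sub0r !normrN normrM.
have /andP[t0 t1] := t01.
by apply: le_lt_trans; rewrite ger0_norm// ler_piMl.
Qed.

(** The extra factor [z.2] avoids an order [k.-1]: the remainder of order [k.-1] of [sder g] is that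
    of order [k] plus one Taylor term, and for [k = 0] the coefficient [k%:R] removes that term. *)
Lemma derive_taylor_rem k g w z : smooth A g -> A z ->
  z.2 * 'D_w (taylor_rem k g) z = z.2 * taylor_rem k ('D_(w.1, 0) g) z +
   w.2 * (z.2 * taylor_rem k (sder g) z + k%:R * z.2 ^+ k * (k`!%:R^-1 * sdern k g (slice0 z))).
Proof.
move=> Sg Az.
have dr := smooth_differentiable (smooth_taylor_rem oA starA k Sg) Az.
have wE : w = (w.1, 0) + w.2 *: (0, 1).
  by case: w => u s; congr pair; rewrite /= ?scaler0 ?addr0 ?add0r//; rewrite [RHS]mulr1.
rewrite [in LHS]wE derive_add// derive_scale// mulrDr; congr (_ + _).
  by rewrite (derive_taylor_rem_fst oA starA).
rewrite -/(sder (taylor_rem k g) z) -[_ *: _]/(_ * _) mulrCA; congr (_ * _).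
case: k dr => [|k] dr; first by rewrite mulr0n !mul0r addr0.
rewrite (derive_taylor_rem_snd oA starA)// /= -(sdernSr k g) -[sdern k.+1 g _]/(sder (sdern k g) _).
have k0 : k`!%:R != 0 :> R by rewrite pnatr_eq0 -lt0n fact_gt0.
rewrite factS natrM exprS; have : k.+1%:R != 0 :> R by rewrite pnatr_eq0.
by move: (k.+1%:R : R) => K K0; field; rewrite k0 K0.
Qed.

(** Off the slice, the term with [k%:R] is a combination of the derivative of [z.2 ^- k] and the
    Taylor term of order [k]. On the slice, [taylor_quo_rec] and [diff_mul_vanish] give the same
    formula. *)
Lemma derive_taylor_quo k g w z : smooth A g -> A z ->
  differentiable (taylor_quo k g) z /\
  'D_w (taylor_quo k g) z = taylor_quo k ('D_(w.1, 0) g) z +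
    w.2 * (taylor_quo k (sder g) z - k%:R * taylor_quo k.+1 g z).
Proof.
move=> Sg Az.
have k0 : k`!%:R != 0 :> R by rewrite pnatr_eq0 -lt0n fact_gt0.
have [z0|z0] := eqVneq z.2 0; last first.
  split; first by apply: smooth_differentiable (smooth_taylor_quo_away k Sg) _.
  have dr := smooth_differentiable (smooth_taylor_rem oA starA k Sg) Az.
  rewrite -(derive_eq_open w oA' (@taylor_quoE k g))//.
  have -> : 'D_w (fun z => taylor_rem k g z * (z.2 ^+ k)^-1) z =
     (z.2 * 'D_w (taylor_rem k g) z - k%:R * w.2 * taylor_rem k g z) / z.2 ^+ k.+1.
    apply: has_derive_val; apply: has_derive_eq.
      apply: has_derive_mul; first exact: diff_has_derive.
      apply: has_derive_inv; first by rewrite expf_neq0.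
      exact: has_derive_snd_pow.
    move: ('D_w _ z) (taylor_rem k g z) => D r.
    case: k {dr k0} => [|k]; first by rewrite mulr0n !mul0r expr0 expr1; field.
    rewrite -pred_Sn expr2 !exprS; move: (k.+1%:R : R) => K.
    by field; rewrite z0 expf_neq0.
  rewrite derive_taylor_rem// /taylor_quo (negbTE z0) /= exprS; field.
  by rewrite z0 k0 expf_neq0.
pose p z := k`!%:R^-1 * sdern k g (slice0 z).
have Sk := smooth_sdern k Sg.
have dp : differentiable p z.
  apply: (@differentiableM _ _ (cst k`!%:R^-1) (fun z => sdern k g (slice0 z))) => //.
  exact: (smooth_differentiable (smooth_slice0 oA starA Sk)).
have Dp v : 'D_v p z = k`!%:R^-1 * 'D_(slice0 v) (sdern k g) z.
  have zE : slice0 z = z by rewrite /slice0 -z0 -surjective_pairing.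
  rewrite /p; apply: has_derive_val; apply: has_derive_eq.
    apply: has_derive_mul; first exact: has_derive_const.
    exact: (has_derive_slice0 starA v Sk Az).
  by rewrite mulr0 addr0 zE.
have ds : differentiable (snd : P -> R) z.
  by apply: linear_differentiable; exact: snd_continuous.
have [dq Dq] := diff_mul_vanish ds z0 (taylor_quo_continuous (k := k.+1) Sg Az).
have -> : taylor_quo k g = fun z => p z + z.2 * taylor_quo k.+1 g z.
  by apply/funext => y; exact: taylor_quo_rec.
split; first exact: differentiableD.
rewrite (has_derive_val (has_derive_add (diff_has_derive w dp) (diff_has_derive w dq))).
rewrite Dp Dq (derive_linear (f := snd)) ?/taylor_quo; last exact: snd_continuous.
have zE : slice0 z = z by rewrite /slice0 -z0 -surjective_pairing.
rewrite z0 eqxx zE /slice0 (sdern_derive oA k _ Sg Az) sdernSr.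
have K0 : k%:R + 1 != 0 :> R by rewrite natr1 pnatr_eq0.
by rewrite factS natrM -!natr1; field; rewrite k0 K0.
Qed.

(** The induction on the class runs over all [k] and [g] at once, since one derivative of the
    quotient of order [k] involves the quotient of order [k.+1] and derivatives of [g]. *)
Lemma smooth_taylor_quo k g : smooth A g -> smooth A (taylor_quo k g).
Proof.
move=> Sg n; elim: n k g Sg => [|n IH] k g Sg.
  by move=> z Az; exact: taylor_quo_continuous.
split=> [z Az|w]; first by have [] := derive_taylor_quo k 0 Sg Az.
apply: (@Cn_ext _ n _ _ _ _ _ oA (fun z Az => esym (derive_taylor_quo k w Sg Az).2)).
apply: CnD => //; first by apply: IH; exact: smooth_derive.
apply: CnM => //; first exact: Cn_cst.
apply: CnB => //; first by apply: IH; exact: smooth_derive.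
by apply: CnM => //; [exact: Cn_cst|exact: IH].
Qed.

End hadamard_smooth.

(** * The target map in coordinates *)

Section planar_coordinates.
Context {R : realType}.
Local Notation plane := 'rV[R]_2.
Local Notation phase := (plane * plane)%type.

Lemma forall_ord2 (P : 'I_2 -> Prop) : P 0 -> P 1 -> forall i, P i.
Proof.
move=> P0 P1 [[|[|//]] i2].
  by rewrite (_ : Ordinal i2 = 0)//; exact: val_inj.
by rewrite (_ : Ordinal i2 = 1)//; exact: val_inj.
Qed.

Lemma sum_ord2 (V : nmodType) (F : 'I_2 -> V) : \sum_i F i = F 0 + F 1.
Proof. by rewrite big_ord_recl big_ord1; congr (_ + F _); exact: val_inj. Qed.

Lemma plane_eqP (x y : plane) : x 0 0 = y 0 0 -> x 0 1 = y 0 1 -> x = y.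
Proof. by move=> e0 e1; apply/rowP; exact: forall_ord2. Qed.

Lemma plane_basis (x : plane) : x = \sum_i x 0 i *: delta_mx 0 i.
Proof. exact: row_sum_delta. Qed.

Lemma derive_plane (f : plane -> R) x (v : plane) : differentiable f x ->
  'D_v f x = v 0 0 * partial 0 f x + v 0 1 * partial 1 f x.
Proof.
move=> df; rewrite [in LHS](plane_basis v) sum_ord2 derive_add//.
by rewrite !derive_scale.
Qed.

(** The quarter turn [w], written with [eps] to match the definition of [xf]. *)
Definition rot (p : plane) : plane := \row_i (- \sum_j eps i j * p 0 j).

Lemma eps01 : (eps 0 1 : R) = 1. Proof. by rewrite mxE subr0. Qed.
Lemma eps10 : (eps 1 0 : R) = -1. Proof. by rewrite mxE sub0r. Qed.
Lemma epsii i : (eps i i : R) = 0. Proof. by rewrite mxE subrr. Qed.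

Lemma rot0 p : rot p 0 0 = - p 0 1.
Proof. by rewrite mxE sum_ord2 epsii eps01 mul0r add0r mul1r. Qed.

Lemma rot1 p : rot p 0 1 = p 0 0.
Proof. by rewrite mxE sum_ord2 epsii eps10 mul0r addr0 mulN1r opprK. Qed.

Lemma rotZ a p : rot (a *: p) = a *: rot p.
Proof. by apply: plane_eqP; rewrite [RHS]mxE !(rot0, rot1) ?mxE ?mulrN. Qed.

Lemma rotD p q : rot (p + q) = rot p + rot q.
Proof. by apply: plane_eqP; rewrite [RHS]mxE !(rot0, rot1) ?mxE ?opprD. Qed.

Lemma rot_is_linear : linear rot.
Proof. by move=> a p q; rewrite rotD rotZ. Qed.

HB.instance Definition _ := GRing.isLinear.Build R plane plane *:%R rot rot_is_linear.

Lemma xfE (phi : plane -> R) q : xf phi q = q.1 + phi q.1 *: rot q.2.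
Proof. by apply/rowP => i; rewrite !mxE mulrN. Qed.

Definition xcoord (i : 'I_2) (q : phase) : R := q.1 0 i.
Definition pcoord (i : 'I_2) (q : phase) : R := q.2 0 i.
Definition rcoord (i : 'I_2) (q : phase) : R := rot q.2 0 i.

Lemma xcoord_is_linear i : linear (xcoord i : phase -> R).
Proof. by move=> a u v; rewrite /xcoord /= !mxE. Qed.
Lemma pcoord_is_linear i : linear (pcoord i : phase -> R).
Proof. by move=> a u v; rewrite /pcoord /= !mxE. Qed.
Lemma rcoord_is_linear i : linear (rcoord i : phase -> R).
Proof. by move=> a u v; rewrite /rcoord /= rotD rotZ !mxE. Qed.

HB.instance Definition _ i :=
  GRing.isLinear.Build R phase R *:%R (xcoord i) (xcoord_is_linear i).
HB.instance Definition _ i :=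
  GRing.isLinear.Build R phase R *:%R (pcoord i) (pcoord_is_linear i).
HB.instance Definition _ i :=
  GRing.isLinear.Build R phase R *:%R (rcoord i) (rcoord_is_linear i).

Lemma xcoord_continuous i : continuous (xcoord i : phase -> R).
Proof.
move=> q; apply: (@continuous_comp _ _ _ (fst : phase -> plane) (fun x : plane => x 0 i)).
  exact: cvg_fst.
exact: coord_continuous.
Qed.

Lemma pcoord_continuous i : continuous (pcoord i : phase -> R).
Proof.
move=> q; apply: (@continuous_comp _ _ _ (snd : phase -> plane) (fun x : plane => x 0 i)).
  exact: cvg_snd.
exact: coord_continuous.
Qed.

Lemma rcoord_continuous i : continuous (rcoord i : phase -> R).
Proof.
move: i; apply: forall_ord2.
  have -> : rcoord 0 = (fun q : phase => - pcoord 1 q) by apply/funext => q; exact: rot0.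
  by move=> q; apply: continuousN; exact: pcoord_continuous.
have -> : rcoord 1 = (pcoord 0 : phase -> R) by apply/funext => q; exact: rot1.
exact: pcoord_continuous.
Qed.

Lemma phase_fst_continuous : continuous (fst : phase -> plane).
Proof. by move=> q; exact: cvg_fst. Qed.

Lemma open_preimage_in (V W : normedModType R) (A : set V) (B : set W) (f : V -> W) :
  open A -> open B -> (forall x, A x -> {for x, continuous f}) -> open (A `&` f @^-1` B).
Proof.
move=> oA oB cf; rewrite openE => x [Ax Bfx]; apply: filterI; first exact: open_nbhs_nbhs.
by apply: (cf x Ax); exact: open_nbhs_nbhs.
Qed.

Variables (U : set plane) (phi : plane -> R).
Hypotheses (oU : open U) (Sphi : smooth U phi).

Definition over_base : set phase := [set q | U q.1].
Definition over_both : set phase := [set q | U q.1 /\ U (xf phi q)].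

Lemma open_over_base : open over_base.
Proof. by apply: (@open_comp _ _ fst) => // q _; exact: phase_fst_continuous. Qed.

Lemma smooth_base (f : plane -> R) : smooth U f -> smooth over_base (fun q => f q.1).
Proof.
move=> Sf n; apply: (@Cn_comp_linear R n _ _ _ U f fst) => //.
  exact: open_over_base.
exact: phase_fst_continuous.
Qed.

Lemma has_derive_base (f : plane -> R) (q v : phase) : smooth U f -> U q.1 ->
  has_derive q v (fun q => f q.1) ('D_(v.1) f q.1).
Proof.
move=> Sf Uq; have df := smooth_differentiable Sf Uq.
have [d <-] := derive_comp_linear (L := fst) v phase_fst_continuous df.
exact: diff_has_derive.
Qed.

Definition xf_coef i (q : phase) : R := phi q.1 * rcoord i q.

Lemma smooth_xf_coef i : smooth over_base (xf_coef i).
Proof.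
move=> n; apply: CnM; [exact: open_over_base|exact: smooth_base|].
exact: (@smooth_linear R _ _ over_base (rcoord i) (@rcoord_continuous i) n).
Qed.

(** The form of substitution that [Cn_comp] accepts. *)
Lemma xf_affine q : xf phi q = q.1 + \sum_i xf_coef i q *: delta_mx 0 i.
Proof.
rewrite xfE [in LHS](plane_basis (rot q.2)) scaler_sumr; congr (_ + _).
by apply: eq_bigr => i _; rewrite scalerA.
Qed.

Lemma smooth_xf : smooth over_base (xf phi).
Proof.
move=> n; have oB := open_over_base.
apply: (@Cn_ext R n _ _ _ (fun q => q.1 + \sum_i xf_coef i q *: delta_mx 0 i)) => //.
  by move=> q _; rewrite xf_affine.
apply: CnD => //; first exact: (@smooth_linear R _ _ over_base fst phase_fst_continuous n).
by apply: Cn_sum => // i; apply: Cn_scalel => //; exact: smooth_xf_coef.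
Qed.

Definition dxf (q v : phase) : plane :=
  v.1 + 'D_(v.1) phi q.1 *: rot q.2 + phi q.1 *: rot v.2.

Lemma derive_xf (q v : phase) : U q.1 -> 'D_v (xf phi) q = dxf q v.
Proof.
move=> Uq; have dc i : differentiable (xf_coef i) q by exact: smooth_differentiable (smooth_xf_coef i) Uq.
have [_ dg] := derive_affine (L := fst) (gam := xf_coef) (fun i => delta_mx 0 i)
  phase_fst_continuous dc.
have -> : xf phi = fun q => q.1 + \sum_i xf_coef i q *: delta_mx 0 i.
  by apply/funext => y; exact: xf_affine.
rewrite dg /dxf -addrA; congr (_ + _).
rewrite [in RHS](plane_basis (rot q.2)) [in RHS](plane_basis (rot v.2)).
rewrite !scaler_sumr -big_split /=; apply: eq_bigr => i _.
rewrite !scalerA -scalerDl; congr (_ *: _).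
rewrite (has_derive_val (has_derive_mul (has_derive_base v Sphi Uq)
  (has_derive_lin q v (@rcoord_continuous i)))).
by rewrite addrC mulrC.
Qed.

Lemma open_over_both : open over_both.
Proof.
apply: (open_preimage_in open_over_base oU) => q Uq.
exact: differentiable_continuous (smooth_differentiable smooth_xf Uq).
Qed.

Lemma smooth_xf_comp (f : plane -> R) : smooth U f -> smooth over_both (fun q => f (xf phi q)).
Proof.
move=> Sf n; apply: (@Cn_ext R n _ _ _ (fun q => f (q.1 + \sum_i xf_coef i q *: delta_mx 0 i))).
- exact: open_over_both.
- by move=> q _; rewrite xf_affine.
apply: (@Cn_comp R n _ _ _ U f fst 2 xf_coef) => //.
- exact: open_over_both.
- exact: phase_fst_continuous.
- by move=> q [Uq Ux]; rewrite -xf_affine.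
- by move=> i; apply: Cn_sub (smooth_xf_coef i n) => q [].
Qed.

Lemma has_derive_xf_comp (f : plane -> R) (q v : phase) : U q.1 -> differentiable f (xf phi q) ->
  has_derive q v (fun q => f (xf phi q)) ('D_(dxf q v) f (xf phi q)).
Proof.
move=> Uq df; have dx := smooth_differentiable smooth_xf Uq.
split; first by apply: diff_derivable; exact: (differentiable_comp dx df).
by rewrite (derive_comp v dx df) derive_xf// deriveE.
Qed.

Lemma hfun_zero q : phi q.1 = 0 ->
  hfun phi q = 1 - q.2 0 1 * partial 0 phi q.1 + q.2 0 0 * partial 1 phi q.1.
Proof. by case: q => x p phi0; rewrite /hfun (phi0 : phi x = 0) eqxx. Qed.

Lemma hfun_neq0 q : phi q.1 != 0 -> hfun phi q = phi (xf phi q) / phi q.1.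
Proof. by case: q => x p phi0; rewrite /hfun (phi0 : phi x != 0). Qed.

Lemma psi_zero q : phi q.1 = 0 ->
  psi phi q = q.2 0 0 * q.2 0 1 * partial 0 (partial 1 phi) q.1
       - 2^-1 * q.2 0 0 ^+ 2 * partial 1 (partial 1 phi) q.1
       - 2^-1 * q.2 0 1 ^+ 2 * partial 0 (partial 0 phi) q.1.
Proof. by case: q => x p phi0; rewrite /psi (phi0 : phi x = 0) eqxx. Qed.

Lemma psi_neq0 q : phi q.1 != 0 -> psi phi q =
  (1 + q.2 0 0 * partial 1 phi q.1 - q.2 0 1 * partial 0 phi q.1 - hfun phi q) / phi q.1.
Proof. by case: q => x p phi0; rewrite /psi (phi0 : phi x != 0). Qed.

Lemma hfun_xf q : phi q.1 * hfun phi q = phi (xf phi q).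
Proof.
have [phi0|phi0] := eqVneq (phi q.1) 0; last by rewrite hfun_neq0// mulrC divfK.
by rewrite xfE phi0 scale0r addr0 mul0r phi0.
Qed.

Lemma hfun_psi q : hfun phi q =
  1 + q.2 0 0 * partial 1 phi q.1 - q.2 0 1 * partial 0 phi q.1 - phi q.1 * psi phi q.
Proof.
have [phi0|phi0] := eqVneq (phi q.1) 0; last by rewrite psi_neq0//; field.
by rewrite (hfun_zero phi0) phi0; ring.
Qed.

End planar_coordinates.

(** * Smoothness of the coefficients of the 2-form *)

Section smooth_psi.
Context {R : realType}.
Local Notation plane := 'rV[R]_2.
Local Notation phase := (plane * plane)%type.
Local Notation ext := (phase * R)%type.
Variables (U : set plane) (phi : plane -> R).
Hypotheses (oU : open U) (Sphi : smooth U phi).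

Lemma taylor_quo2 (Y : normedModType R) (g : Y * R -> R) z : z.2 != 0 ->
  taylor_quo 2 g z = (g z - g (slice0 z) - z.2 * sder g (slice0 z)) / z.2 ^+ 2.
Proof.
move=> z0; rewrite /taylor_quo (negbTE z0); congr (_ / _).
rewrite -[LHS]/(g z - 0`!%:R^-1 * (z.2 ^+ 0 * g (slice0 z))
  - 1`!%:R^-1 * (z.2 ^+ 1 * sder g (slice0 z))).
by rewrite fact0 (_ : 1`! = 1%N)// invr1 expr0 expr1 !mul1r.
Qed.

Definition base_pt : {linear ext -> plane} := [the {linear ext -> plane} of fst \o fst].

Definition fiber_coef i (z : ext) : R := z.2 * rcoord i z.1.

(** The point [x + s *: rot p] with free [s]; the target [xf phi (x, p)] is its value at
    [s = phi x]. *)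
Definition fiber_pt (z : ext) : plane := base_pt z + \sum_i fiber_coef i z *: delta_mx 0 i.

Lemma base_pt_continuous : continuous base_pt.
Proof.
by move=> z; apply: (@continuous_comp _ _ _ (fst : ext -> phase) (fst : phase -> plane)); exact: cvg_fst.
Qed.

Lemma fiber_ptE z : fiber_pt z = z.1.1 + z.2 *: rot z.1.2.
Proof.
rewrite /fiber_pt [in RHS](plane_basis (rot z.1.2)) scaler_sumr; congr (_ + _).
by apply: eq_bigr => i _; rewrite scalerA.
Qed.

Lemma rcoord_fst_continuous i : continuous (rcoord i \o fst : ext -> R).
Proof.
by move=> z; apply: continuous_comp; [exact: cvg_fst|exact: rcoord_continuous].
Qed.

Lemma smooth_fiber_coef A i : open A -> smooth A (fiber_coef i).
Proof.
move=> oA n; apply: CnM => //; first exact: (@smooth_linear R _ _ A snd snd_continuous n).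
exact: (@smooth_linear R _ _ A [the {linear ext -> R} of rcoord i \o fst] (@rcoord_fst_continuous i) n).
Qed.

Lemma smooth_fiber_comp (A : set ext) (f : plane -> R) : open A ->
  (forall z, A z -> U (fiber_pt z)) -> smooth U f -> smooth A (fun z => f (fiber_pt z)).
Proof.
move=> oA AU Sf n; apply: (@Cn_comp R n _ _ A U f base_pt 2 fiber_coef) => //.
- exact: base_pt_continuous.
- by move=> i; exact: smooth_fiber_coef.
Qed.

Lemma sder_fiber (f : plane -> R) z : differentiable f (fiber_pt z) ->
  sder (fun z => f (fiber_pt z)) z = 'D_(rot z.1.2) f (fiber_pt z).
Proof.
move=> df.
have dc i : differentiable (fiber_coef i) z.
  exact: (smooth_differentiable (smooth_fiber_coef i openT) Logic.I).
have [dg Dg] := derive_affine (gam := fiber_coef) (fun i => delta_mx 0 i) base_pt_continuous dc.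
rewrite /sder (derive_comp ((0 : phase), (1 : R)) dg df) Dg deriveE//; congr ('d f _ _).
rewrite [base_pt _]/= add0r [in RHS](plane_basis (rot z.1.2)); apply: eq_bigr => i _; congr (_ *: _).
rewrite (has_derive_val (has_derive_mul (has_derive_lin z ((0 : phase), (1 : R)) (f := snd) snd_continuous)
  (has_derive_lin z ((0 : phase), (1 : R)) (f := [the {linear ext -> R} of rcoord i \o fst]) (@rcoord_fst_continuous i)))).
by rewrite /= linear0 mulr0 add0r mulr1.
Qed.

(* Near a zero of [phi], [psi] is minus the Taylor quotient of order 2 in [s]
   of [phi (x + s *: rot p)], taken at [s = phi x]. *)
Lemma smooth_psi_near_zero q : U q.1 -> phi q.1 = 0 ->
  exists N : set phase, [/\ open N, N q, N `<=` over_base U & smooth N (psi phi)].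
Proof.
move=> Uq q0.
have /nbhs_ballP[r /= r0 rU] : nbhs q.1 U by exact: open_nbhs_nbhs.
have r20 : 0 < r / 2 by rewrite divr_gt0.
pose V (z : ext) := \sum_i fiber_coef i z *: (delta_mx 0 i : plane).
have VE z : V z = z.2 *: rot z.1.2.
  by apply: (addrI z.1.1); rewrite -fiber_ptE.
have SV : smooth setT V.
  by move=> n; apply: Cn_sum => [|i]; [exact: openT|apply: Cn_scalel; [exact: openT|exact: (smooth_fiber_coef i openT)]].
have oB : open (ball q.1 (r / 2)) by exact: ball_open.
have oB0 : open (ball (0 : plane) (r / 2)) by exact: ball_open.
(* Bounding the base point and the displacement separately, by half the radius each, makes [A]
   star-shaped in [s] and sends it into [U]. *)
pose A : set ext := (base_pt @^-1` ball q.1 (r / 2)) `&` (V @^-1` ball 0 (r / 2)).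
have oA : open A.
  apply: openI.
    by apply: open_comp => // z _; exact: base_pt_continuous.
  by apply: open_comp => // z _; exact: (smooth_continuous SV Logic.I).
have AU z : A z -> U (fiber_pt z).
  move=> [/= A1 A2]; apply: rU; rewrite fiber_ptE -VE.
  move: A1 A2; rewrite -!ball_normE /= sub0r normrN => A1 A2.
  rewrite opprD addrA (le_lt_trans (ler_normB _ _))// [r]splitr ltrD//.
have AU0 z : A z -> U z.1.1.
  move=> [/= A1 _]; apply: rU; apply: le_ball A1.
  by rewrite ler_pdivrMr// ler_peMr ?ler1n// ltW.
have starA : star_shaped A.
  move=> z t [/= A1 A2] /andP[t0 t1]; split => //=.
  move: A2; rewrite -!ball_normE /= !sub0r !normrN !VE /= -scalerA => A2.
  by rewrite normrZ (ger0_norm t0); apply: le_lt_trans A2; rewrite ler_piMl.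
pose g (z : ext) : R := phi (fiber_pt z).
have Sg : smooth A g by exact: smooth_fiber_comp.
pose N : set phase := over_base U `&` [set y | A (y, phi y.1)].
(* The substitution [s = phi x] in the form of [Cn_comp], with a single direction. *)
have emb_affine (y : phase) : (y, phi y.1) = (y, 0) + \sum_(i < 1) phi y.1 *: ((0 : phase), (1 : R)) :> ext.
  by rewrite big_ord1; congr pair; rewrite /= ?scaler0 ?addr0// add0r [RHS]mulr1.
pose inl : phase -> ext := fun y => (y, 0).
have inl_lin : linear inl by move=> a u v; congr pair; rewrite /= scaler0 addr0.
pose inlL : {linear phase -> ext} := HB.pack inl (GRing.isLinear.Build _ _ _ _ _ inl_lin).
have inl_cont : continuous inlL.
  move=> y; apply: differentiable_continuous.
  by apply: (@differentiable_pair _ _ _ _ id (cst 0)).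
have SB : smooth (over_base U) (fun y => phi y.1) by exact: smooth_base.
have oO := @open_over_base R U oU.
have emb_cont (y : phase) : over_base U y -> {for y, continuous (fun y : phase => (y, phi y.1) : ext)}.
  move=> Uy; apply: differentiable_continuous; apply: (@differentiable_pair _ _ _ _ id (fun y => phi y.1)) => //.
  exact: smooth_differentiable SB Uy.
have oN : open N by exact: (open_preimage_in oO oA emb_cont).
exists N; split => //.
- split=> //; rewrite /= q0; split; rewrite /= ?VE ?scale0r; exact: ballxx.
- by move=> y [].
have Squo : smooth N (fun y => taylor_quo 2 g (y, phi y.1)).
  move=> n; apply: (@Cn_ext R n _ _ _ (fun y => taylor_quo 2 g (inlL y + \sum_(i < 1) phi y.1 *: (0, 1)))) => //.
    by move=> y _; rewrite emb_affine.
  apply: (@Cn_comp R n _ _ N A (taylor_quo 2 g) inlL 1 (fun _ y => phi y.1)) => //.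
  - by move=> y [_ Ay]; rewrite -[inlL y]/(inl y) -emb_affine.
  - exact: smooth_taylor_quo.
  - by move=> _; apply: Cn_sub (SB n) => y [].
have psiE y : N y -> - taylor_quo 2 g (y, phi y.1) = psi phi y.
  move=> [Uy Ay]; have Ay0 := slice0_in starA Ay.
  have dphi x : U x -> differentiable phi x by exact: smooth_differentiable.
  have fp0 : fiber_pt (slice0 (y, phi y.1)) = y.1 by rewrite fiber_ptE /= scale0r addr0.
  have g1E z : A z -> sder g z = 'D_(rot z.1.2) phi (fiber_pt z).
    by move=> Az; apply: sder_fiber; exact/dphi/AU.
  set z0 := slice0 _ in Ay0 fp0.
  have [phi0|phi0] := eqVneq (phi y.1) 0; last first.
    rewrite taylor_quo2// psi_neq0// (g1E _ Ay0) /g fp0 [(z0.1).2]/= derive_plane//; last exact: dphi.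
    rewrite rot0 rot1 hfun_neq0// (_ : fiber_pt _ = xf phi y); last by rewrite fiber_ptE xfE.
    by rewrite -[(y, phi y.1).2]/(phi y.1); move: (phi (xf _ _)) => a; field.
  (* [g2] is [sder g] in terms of partial derivatives; one more derivative in [s] gives the Hessian
     of [phi] on [rot p], hence the second case of [psi] up to the factor [-1/2]. *)
  pose g2 z : R := rcoord 0 z.1 * partial 0 phi (fiber_pt z) + rcoord 1 z.1 * partial 1 phi (fiber_pt z).
  have dpart i : differentiable (partial i phi) y.1.
    exact: (smooth_differentiable (smooth_derive _ Sphi) Uy).
  have -> : taylor_quo 2 g (y, phi y.1) = 2^-1 * sder g2 z0.
    rewrite /taylor_quo [X in X == 0]/= phi0 eqxx; congr (_^-1 * _).
    rewrite -phi0 -/z0; apply: (derive_eq_open _ oA) => // z Az.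
    by apply: etrans (g1E z Az) _; rewrite derive_plane//; exact/dphi/AU.
  have Dg2 : sder g2 z0 = rot y.2 0 0 * 'D_(rot y.2) (partial 0 phi) y.1
      + rot y.2 0 1 * 'D_(rot y.2) (partial 1 phi) y.1.
    have dfp i : differentiable (fun z => partial i phi (fiber_pt z)) z0.
      apply: (smooth_differentiable (A := A)) => //; apply: smooth_fiber_comp => //.
      exact: smooth_derive.
    have E i : 'D_((0 : phase), (1 : R)) (fun z => partial i phi (fiber_pt z)) z0 =
        'D_(rot y.2) (partial i phi) y.1.
      have d : differentiable (partial i phi) (fiber_pt z0) by rewrite fp0.
      by apply: etrans (sder_fiber d) _; rewrite fp0.
    have rl i : has_derive z0 ((0 : phase), (1 : R)) (rcoord i \o fst : ext -> R) 0.
      apply: has_derive_eq.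
        exact: (has_derive_lin _ _ (f := [the {linear ext -> R} of rcoord i \o fst]) (@rcoord_fst_continuous i)).
      by rewrite /= linear0.
    have D := has_derive_add (has_derive_mul (rl 0) (diff_has_derive ((0 : phase), (1 : R)) (dfp 0)))
      (has_derive_mul (rl 1) (diff_has_derive ((0 : phase), (1 : R)) (dfp 1))).
    apply: etrans (has_derive_val D) _.
    refine (congr2 +%R _ _).
      exact: (etrans (congr2 +%R (congr1 ( *%R (rot y.2 0 0)) (E 0)) (mulr0 _)) (addr0 _)).
    exact: (etrans (congr2 +%R (congr1 ( *%R (rot y.2 0 1)) (E 1)) (mulr0 _)) (addr0 _)).
  rewrite Dg2 (psi_zero phi0) (derive_plane _ (dpart 0)) (derive_plane _ (dpart 1)) rot0 rot1.
  have -> : partial 1 (partial 0 phi) y.1 = partial 0 (partial 1 phi) y.1.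
    exact: (deriveC _ _ oU (Sphi 2) Uy).
  move: (partial 0 (partial 0 phi) _) (partial 0 (partial 1 phi) _) (partial 1 (partial 1 phi) _).
  by move=> a b c; field.
by move=> n; exact: (Cn_ext oN psiE (CnN oN (Squo n))).
Qed.

End smooth_psi.

(** * Smoothness and first derivatives of [h] *)

Section smooth_hfun.
Context {R : realType}.
Local Notation plane := 'rV[R]_2.
Local Notation phase := (plane * plane)%type.
Variables (U : set plane) (phi : plane -> R).
Hypotheses (oU : open U) (Sphi : smooth U phi).
Local Notation O := (over_both U phi).

Lemma smooth_pcoord (A : set phase) i : smooth A (pcoord i).
Proof. exact: (@smooth_linear R _ _ A (pcoord i) (@pcoord_continuous R i)). Qed.

Lemma smooth_lin_psi (A : set phase) : open A -> A `<=` over_base U ->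
  smooth A (fun q : phase => 1 + q.2 0 0 * partial 1 phi q.1 - q.2 0 1 * partial 0 phi q.1).
Proof.
move=> oA AU n; have Sp i : Cn n A (fun q : phase => partial i phi q.1).
  by apply: Cn_sub AU _; apply: (smooth_base oU); exact: smooth_derive.
apply: (CnB oA); last by apply: (CnM oA); [exact: (smooth_pcoord A 1 n)|exact: Sp].
apply: (CnD oA); first exact: (Cn_cst n A (1 : R)).
by apply: (CnM oA); [exact: (smooth_pcoord A 0 n)|exact: Sp].
Qed.

Lemma smooth_psi : smooth O (psi phi).
Proof.
move=> n; apply: Cn_local => q [Uq Ux].
have [q0|q0] := eqVneq (phi q.1) 0.
  by have [N [_ Nq _ SN]] := smooth_psi_near_zero oU Sphi Uq q0; exists N.
have oO := open_over_both oU Sphi.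
have OB : O `<=` over_base U by move=> y [].
have SB : smooth O (fun q => phi q.1).
  by apply: (smooth_sub_set OB); exact: (smooth_base oU Sphi).
pose A := O `&` (fun y : phase => phi y.1) @^-1` [set s | s != 0].
have oA : open A.
  by apply: (open_preimage_in oO (@open_neq R 0)) => y Oy; exact: (smooth_continuous SB Oy).
have AO : A `<=` O by move=> y [].
exists A => //.
have E y : A y -> (1 + y.2 0 0 * partial 1 phi y.1 - y.2 0 1 * partial 0 phi y.1
    - phi (xf phi y) * (phi y.1)^-1) * (phi y.1)^-1 = psi phi y.
  by move=> [_ y0]; rewrite psi_neq0// hfun_neq0.
apply: (Cn_ext oA E).
have SV : Cn n A (fun q => (phi q.1)^-1).
  by apply: CnV => //; [move=> y []|exact: (smooth_sub_set AO SB)].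
apply: (CnM oA) => //; apply: (CnB oA).
  by apply: smooth_lin_psi => // y /AO/OB.
apply: (CnM oA) => //; apply: Cn_sub AO _; exact: (smooth_xf_comp oU Sphi Sphi).
Qed.

(** Smoothness across the zeros of [phi] is inherited from [psi], because [hfun_psi] contains no
    division. *)
Lemma smooth_hfun : smooth O (hfun phi).
Proof.
have oO := open_over_both oU Sphi.
have OB : O `<=` over_base U by move=> y [].
move=> n; apply: (Cn_ext oO (fun q _ => esym (hfun_psi phi q))).
apply: (CnB oO); first exact: smooth_lin_psi.
apply: (CnM oO); last exact: smooth_psi.
by apply: Cn_sub OB _; exact: (smooth_base oU Sphi).
Qed.

(** At a zero of [phi] the term with ['D_v (psi phi)] drops out, so that the derivative of [h]
    depends there only on the 2-jet of [phi]. *)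
Lemma derive_hfun (q v : phase) : O q -> 'D_v (hfun phi) q =
  q.2 0 0 * 'D_(v.1) (partial 1 phi) q.1 + partial 1 phi q.1 * v.2 0 0
  - (q.2 0 1 * 'D_(v.1) (partial 0 phi) q.1 + partial 0 phi q.1 * v.2 0 1)
  - (phi q.1 * 'D_v (psi phi) q + psi phi q * 'D_(v.1) phi q.1).
Proof.
move=> Oq; have [Uq _] := Oq.
have -> : hfun phi = fun q => 1 + q.2 0 0 * partial 1 phi q.1 - q.2 0 1 * partial 0 phi q.1
  - phi q.1 * psi phi q by apply/funext => y; exact: hfun_psi.
have hp i : has_derive q v (pcoord i) (v.2 0 i).
  exact: (has_derive_lin q v (@pcoord_continuous R i)).
have hd i : has_derive q v (fun q : phase => partial i phi q.1) ('D_(v.1) (partial i phi) q.1).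
  by apply: (has_derive_base (U := U)) => //; exact: smooth_derive.
have hphi := has_derive_base v Sphi Uq.
have hpsi := diff_has_derive v (smooth_differentiable smooth_psi Oq).
have H := has_derive_sub (has_derive_sub (has_derive_add (has_derive_const (1 : R) q v)
  (has_derive_mul (hp 0) (hd 1))) (has_derive_mul (hp 1) (hd 0))) (has_derive_mul hphi hpsi).
by apply: etrans (has_derive_val H) _; rewrite add0r.
Qed.

Lemma derive_hfun_xf (q v : phase) : O q ->
  phi q.1 * 'D_v (hfun phi) q + hfun phi q * 'D_(v.1) phi q.1 =
  'D_(dxf phi q v) phi (xf phi q).
Proof.
move=> Oq; have [Uq Ux] := Oq.
have dx := smooth_differentiable Sphi Ux.
rewrite -(has_derive_val (has_derive_xf_comp oU Sphi v Uq dx)).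
have -> : (fun q => phi (xf phi q)) = fun q => phi q.1 * hfun phi q.
  by apply/funext => y; rewrite hfun_xf.
have dh := diff_has_derive v (smooth_differentiable smooth_hfun Oq).
exact: (esym (has_derive_val (has_derive_mul (has_derive_base v Sphi Uq) dh))).
Qed.

End smooth_hfun.

(** * The total space *)

Section total_space.
Context {R : realType}.
Local Notation plane := 'rV[R]_2.
Local Notation phase := (plane * plane)%type.

Lemma segment_component (V : normedModType R) (D : set V) (x v : V) :
  (forall t : R, 0 <= t <= 1 -> D (x + t *: v)) -> connected_component D x (x + v).
Proof.
move=> H; pose c (t : R) := x + t *: v.
have cc : continuous c.
  by move=> t; apply: differentiable_continuous; exact: line_differentiable.
have C : connected (c @` `[0, 1]).
  apply: connected_continuous_connected; first exact: segment_connected.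
  exact: continuous_subspaceT.
have sub : c @` `[0, 1] `<=` D by move=> _ [t t01 <-]; apply: H; rewrite /= in_itv in t01.
apply: (connected_component_max _ sub C).
  by exists 0; rewrite /= ?in_itv /= ?lexx ?ler01// /c scale0r addr0.
by exists 1; rewrite /= ?in_itv /= ?lexx ?ler01// /c scale1r.
Qed.

Lemma component_nbhs (V : normedModType R) (D : set V) (x : V) : open D -> D x ->
  nbhs x (connected_component D x).
Proof.
move=> oD Dx; have /nbhs_ballP[r /= r0 rD] : nbhs x D by exact: open_nbhs_nbhs.
apply/nbhs_ballP; exists r => //= y xy; rewrite -(subrKC x y); apply: segment_component => t /andP[t0 t1].
apply: rD; move: xy; rewrite -!ball_normE /= opprD addrA subrr sub0r normrN => xy.
rewrite normrZ (ger0_norm t0); apply: le_lt_trans xy.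
by rewrite distrC ler_piMl.
Qed.

Lemma rot_continuous : continuous (rot : plane -> plane).
Proof.
move=> p; apply: differentiable_continuous.
have -> : rot = (fun p : plane => - p 0 1 *: delta_mx 0 0 + p 0 0 *: delta_mx 0 1).
  by apply/funext => y; rewrite {1}(plane_basis (rot y)) sum_ord2 rot0 rot1.
have dN : differentiable (fun p : plane => - p 0 1) p.
  exact: (differentiableN (differentiable_coord p 0 1)).
exact: (differentiableD (differentiableZl (delta_mx 0 0 : plane) dN)
  (differentiableZl (delta_mx 0 1 : plane) (differentiable_coord p 0 0))).
Qed.

Lemma rotN p : rot (- p : plane) = - rot p.
Proof. by rewrite -scaleN1r rotZ scaleN1r. Qed.

Lemma rot_rot p : rot (rot p : plane) = - p.
Proof. by apply: plane_eqP; rewrite !(rot0, rot1) [RHS]mxE. Qed.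

Variables (U : set plane) (phi : plane -> R).
Hypotheses (oU : open U) (Sphi : smooth U phi).
Local Notation O := (over_both U phi).

Definition pre_total : set phase := [set q | [/\ U q.1, U (xf phi q) & 0 < hfun phi q]].

Definition regular_base : set plane := [set x | U x /\ phi x != 0].

Definition total : set phase :=
  [set q | pre_total q /\ (phi q.1 = 0 \/ connected_component regular_base q.1 (xf phi q))].

Lemma open_pre_total : open pre_total.
Proof.
have -> : pre_total = O `&` hfun phi @^-1` [set s | 0 < s].
  by apply/seteqP; split => [q [? ? ?]|q [[? ?] ?]].
apply: (open_preimage_in (open_over_both oU Sphi) (@open_gt R 0)).
by move=> q Oq; exact: (smooth_continuous (smooth_hfun oU Sphi) Oq).
Qed.

Lemma open_regular_base : open regular_base.
Proof.
have -> : regular_base = U `&` phi @^-1` [set s | s != 0] by [].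
apply: (open_preimage_in oU (@open_neq R 0)).
by move=> x Ux; exact: (smooth_continuous Sphi Ux).
Qed.

Lemma xf_unit x : xf phi (x, 0) = x.
Proof. by rewrite xfE linear0 scaler0 addr0. Qed.

Lemma hfun_unit x : hfun phi (x, 0) = 1.
Proof.
have [x0|x0] := eqVneq (phi x) 0; last by rewrite hfun_neq0//= xf_unit divff.
by rewrite hfun_zero//= !mxE !mul0r subr0 addr0.
Qed.

Lemma regular_xf q : pre_total q -> phi q.1 != 0 -> regular_base (xf phi q).
Proof. by move=> [Uq Ux h0] q0; split=> //; rewrite -hfun_xf mulf_neq0// gt_eqF. Qed.

Lemma regular_nbhs q : pre_total q -> phi q.1 != 0 ->
  \forall q' \near q, connected_component regular_base q.1 q'.1 /\
    connected_component regular_base (xf phi q) (xf phi q').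
Proof.
move=> Gq q0; have [Uq Ux _] := Gq.
have N1 := component_nbhs open_regular_base (conj Uq q0).
have N2 := component_nbhs open_regular_base (regular_xf Gq q0).
have C1 : nbhs q (fst @^-1` connected_component regular_base q.1).
  exact: (phase_fst_continuous N1).
have C2 : nbhs q (xf phi @^-1` connected_component regular_base (xf phi q)).
  exact: (smooth_continuous (smooth_xf oU Sphi) Uq N2).
exact: filterI C1 C2.
Qed.

Lemma component_regular x y : connected_component regular_base x y -> regular_base y.
Proof. exact: connected_component_sub. Qed.

(* On the segment from [x'] to [x' + phi x' *: rot p'], with [x'] close to a
   zero [x] of [phi], the ratio [phi / phi x'] stays close to
   [1 + t * 'D_(rot p) phi x], which is positive. *)
Lemma zero_nbhs q : pre_total q -> phi q.1 = 0 ->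
  \forall q' \near q, phi q'.1 != 0 -> connected_component regular_base q'.1 (xf phi q').
Proof.
move=> [Uq Ux h0] q0.
pose k (q : phase) := rcoord 0 q * partial 0 phi q.1 + rcoord 1 q * partial 1 phi q.1.
have oB : open (over_base U) by exact: open_over_base.
have Sk : smooth (over_base U) k.
  move=> n; have Sp i : Cn n (over_base U) (fun q : phase => partial i phi q.1).
    by apply: (smooth_base oU); exact: smooth_derive.
  have Sr i := @smooth_linear R _ _ (over_base U) (rcoord i) (@rcoord_continuous R i) n.
  by apply: (CnD oB); apply: (CnM oB); [exact: (Sr 0)|exact: Sp|exact: (Sr 1)|exact: Sp].
have kE q' : U q'.1 -> 'D_(rot q'.2) phi q'.1 = k q'.
  by move=> Uq'; rewrite derive_plane//; exact: (smooth_differentiable Sphi Uq').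
have h1 : 0 < 1 + k q.
  by move: h0; rewrite hfun_zero// /k /rcoord rot0 rot1; congr (0 < _); ring.
(* [m] is the drop allowed for [k] near [q]: as [m <= 1 + k q], the bound [1 + t * (k q - m) = (1 -
   t) + t * (1 + k q - m)] is nonnegative on the whole segment. *)
pose m : R := Num.min 1 (1 + k q).
have m0 : 0 < m by rewrite lt_min ltr01.
have /cvgrPdist_lt/(_ _ m0)/nbhs_ballP[r1 /= r10 K] := smooth_continuous Sk (Uq : over_base U q).
have /nbhs_ballP[r2 /= r20 H2] : nbhs q (over_base U) by exact: open_nbhs_nbhs.
pose r : R := Num.min r1 r2.
have r0 : 0 < r by rewrite lt_min r10.
have r_2 : 0 < r / 2 by rewrite divr_gt0.
have cx := smooth_continuous (smooth_xf oU Sphi) (Uq : over_base U q).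
(* If [q'.1] and its target are both within a quarter of [r], the displacement is below [r / 2] and
   the segment between them stays in the ball of radius [r]. *)
have Nx : nbhs q (xf phi @^-1` ball q.1 (r / 2 / 2)).
  apply: cx; rewrite xfE q0 scale0r addr0; apply/nbhs_ballP.
  by exists (r / 2 / 2) => //=; rewrite divr_gt0.
have N1 : nbhs q (ball q (r / 2 / 2)) by apply/nbhs_ballP; exists (r / 2 / 2) => //=; rewrite divr_gt0.
have step q' : ball q (r / 2 / 2) q' -> ball q.1 (r / 2 / 2) (xf phi q') -> phi q'.1 != 0 ->
    connected_component regular_base q'.1 (xf phi q').
  move=> [B1 B2] Bx q'0; rewrite xfE.
  have vr : `|phi q'.1 *: rot q'.2| < r / 2.
    rewrite (_ : _ *: _ = xf phi q' - q'.1); last by rewrite xfE addrC addKr.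
    move: B1 Bx; rewrite -!ball_normE /= => B1 Bx.
    rewrite (_ : _ - _ = (q.1 - q'.1) - (q.1 - xf phi q')); last first.
      by rewrite opprB [RHS]addrC addrA subrK.
    by rewrite (le_lt_trans (ler_normB _ _))// [r / 2]splitr ltrD.
  have inB (t : R) : 0 <= t <= 1 -> ball q r (q'.1 + t *: (phi q'.1 *: rot q'.2), q'.2).
    move=> /andP[t0 t1]; split => /=.
      move: B1; rewrite -!ball_normE /= opprD addrA => B1.
      rewrite (le_lt_trans (ler_normB _ _))// [r]splitr ltrD//.
        by apply: lt_le_trans B1 _; rewrite ler_pdivrMr// ler_peMr ?ler1n// ltW.
      by rewrite normrZ (ger0_norm t0); apply: le_lt_trans vr; rewrite ler_piMl.
    apply: le_ball B2; rewrite -mulrA ger_pMr//.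
    by rewrite -invfM invf_le1 ?ltr0n// -natrM ler1n.
  have inU (t : R) : 0 <= t <= 1 -> U (q'.1 + t *: (phi q'.1 *: rot q'.2)).
    by move=> /inB B; apply: H2 (le_ball _ B); rewrite ge_min lexx orbT.
  have kB (t : R) : 0 <= t <= 1 ->
      k q - m < k (q'.1 + t *: (phi q'.1 *: rot q'.2), q'.2).
    move=> /inB B; have := K _ (le_ball _ B); rewrite ge_min lexx => /(_ isT).
    by rewrite ltr_norml => /andP[_]; rewrite ltrBlDr ltrBlDl.
  apply: segment_component => t t01; have /andP[t0 t1] := t01; split; first exact: inU.
  have [|s s01] := @MVT_line R _ phi q'.1 (t *: (phi q'.1 *: rot q'.2)).
    move=> s /andP[s0 s1]; rewrite (scalerA s t).
    have st01 : 0 <= s * t <= 1 by rewrite mulr_ge0//= mulr_ile1.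
    exact: (smooth_differentiable Sphi (inU _ st01)).
  have /andP[s0 s1] := s01.
  have st01 : 0 <= s * t <= 1 by rewrite mulr_ge0//= mulr_ile1.
  rewrite (scalerA s t); set z := q'.1 + (s * t) *: _ => E.
  have dz : differentiable phi z by exact: (smooth_differentiable Sphi (inU _ st01)).
  rewrite (derive_scale _ _ dz) (derive_scale _ _ dz) (kE (z, q'.2) (inU _ st01)) in E.
  (* The displacement carries the factor [phi q'.1], hence so does the increment of [phi]; only the
     sign of the other factor is left. *)
  have -> : phi (q'.1 + t *: (phi q'.1 *: rot q'.2)) = phi q'.1 * (1 + t * k (z, q'.2)).
    apply: (addIr (- phi q'.1)); apply: etrans E _.
    rewrite -[LHS]/(t * (phi q'.1 * k (z, q'.2))).
    by move: (k _) (phi _) => a b; ring.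
  rewrite mulf_neq0// gt_eqF//.
  move: t0; rewrite le_eqVlt => /orP[/eqP <-|tp]; first by rewrite mul0r addr0 ltr01.
  have kz := kB _ st01.
  apply: (@le_lt_trans _ _ (1 + t * (k q - m))); last by rewrite ltrD2l ltr_pM2l.
  have m1 : m <= 1 by rewrite ge_min lexx.
  have m2 : m <= 1 + k q by rewrite ge_min lexx orbT.
  have -> : 1 + t * (k q - m) = (1 - t) + t * (1 + k q - m) by ring.
  by rewrite addr_ge0 ?subr_ge0// mulr_ge0 ?(ltW tp)// subr_ge0.
by apply: filterS (filterI N1 Nx) => q' [B1 Bx]; exact: step.
Qed.

Lemma open_total : open total.
Proof.
rewrite openE => q [Gq c].
have NG : nbhs q pre_total by apply: open_nbhs_nbhs; split => //; exact: open_pre_total.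
have [q0|q0] := eqVneq (phi q.1) 0.
  apply: filterS (filterI NG (zero_nbhs Gq q0)) => q' [Gq' H]; split=> //.
  by have [->|/H] := eqVneq (phi q'.1) 0; [left|right].
have {}c : connected_component regular_base q.1 (xf phi q) by case: c => // /eqP; rewrite (negbTE q0).
apply: filterS (filterI NG (regular_nbhs Gq q0)) => q' [Gq' [c1 c2]]; split=> //; right.
apply: connected_component_trans c2; apply: connected_component_trans c.
exact: connected_component_sym.
Qed.

(** Together with [open_total], this makes [total] open and closed relative to [pre_total], so a
    connected subset of [pre_total] meeting it lies in it. *)
Lemma open_pre_total_diff : open (pre_total `\` total).
Proof.
rewrite openE => q [Gq nt].
have q0 : phi q.1 != 0 by apply/negP => /eqP q0; apply: nt; split=> //; left.
have NG : nbhs q pre_total by apply: open_nbhs_nbhs; split => //; exact: open_pre_total.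
apply: filterS (filterI NG (regular_nbhs Gq q0)) => q' [Gq' [c1 c2]]; split=> // -[_ [q'0|c]].
  by have [_] := component_regular c1; rewrite q'0 eqxx.
apply: nt; split => //; right.
apply: connected_component_trans c1 _; apply: connected_component_trans c _.
exact: connected_component_sym.
Qed.

(** The image of the component under [phi] is an interval that avoids 0. *)
Lemma component_sign x y : connected_component regular_base x y -> 0 < phi y / phi x.
Proof.
move=> cxy; have cyx := connected_component_sym cxy.
have Dy := component_regular cxy; have Dx := component_regular cyx.
set C := connected_component regular_base x in cxy *.
have CD : C `<=` regular_base by exact: connected_component_sub.
have : connected (phi @` C).
  apply: connected_continuous_connected; first exact: component_connected.
  apply: continuous_in_subspaceT => z; rewrite inE => /CD[Uz _].
  exact: (smooth_continuous Sphi Uz).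
move/connected_intervalP => I.
have Cx : C x by exact: connected_component_refl.
have no0 (a b : R) : (phi @` C) a -> (phi @` C) b -> a < 0 -> 0 < b -> False.
  move=> Ia Ib a0 b0; have [|z Cz z0] := I _ _ Ia Ib 0; first by rewrite !ltW.
  by have [_] := CD _ Cz; rewrite z0 eqxx.
have Ix : (phi @` C) (phi x) by exists x.
have Iy : (phi @` C) (phi y) by exists y.
have [[_ x0] [_ y0]] := (Dx, Dy).
have [xn|xp|xe] := ltgtP (phi x) 0; last by rewrite xe eqxx in x0.
  have [yn|yp|ye] := ltgtP (phi y) 0; last by rewrite ye eqxx in y0.
    by rewrite nmulr_rgt0// invr_lt0.
  by case: (no0 _ _ Ix Iy).
have [yn|yp|ye] := ltgtP (phi y) 0; last by rewrite ye eqxx in y0.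
  by case: (no0 _ _ Iy Ix).
by rewrite divr_gt0.
Qed.

Lemma pre_total_unit x : U x -> pre_total (x, 0).
Proof. by move=> Ux; split; rewrite ?xf_unit ?hfun_unit ?ltr01. Qed.

Lemma total_unit x : U x -> total (x, 0).
Proof.
move=> Ux; split; first exact: pre_total_unit.
have [x0|x0] := eqVneq (phi x) 0; [by left|right].
by rewrite xf_unit; exact: connected_component_refl.
Qed.

(** One inclusion uses that [total] is relatively open and closed and contains the units. For the
    other, each point is joined to the unit over its own source: by scaling [p] over a zero of
    [phi], and elsewhere by moving the target through its component with the source fixed. *)
Lemma planar_totalE : planar_total U phi = total.
Proof.
apply/seteqP; split => [q [x Ux Kq]|q tq].
  set K := connected_component _ _ in Kq.
  have KG : K `<=` pre_total by exact: connected_component_sub.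
  have KC : connected K by exact: component_connected.
  have K0 : K (x, 0) by apply: connected_component_refl; exact: pre_total_unit.
  have KE : K `&` total = K; last by move: Kq; rewrite -KE => -[].
  apply: KC.
  - by exists (x, 0); split=> //; exact: total_unit.
  - by exists total => //; exact: open_total.
  - exists (~` (pre_total `\` total)); first by apply: open_closedC; exact: open_pre_total_diff.
    apply/seteqP; split => y [Ky b]; split=> //; first by move=> [].
    by apply: contrapT => ty; apply: b; split=> //; exact: KG.
have [[Uq Ux h0] c] := tq.
exists q.1 => //; rewrite -/pre_total.
have [q0|q0] := eqVneq (phi q.1) 0.
  have -> : q = (q.1, 0) + (0, q.2) by case: q {tq Uq Ux h0 c q0} => a b; congr pair; rewrite /= ?addr0 ?add0r.
  rewrite [((q.1, 0) + (0, q.2)).1]/= addr0.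
  apply: segment_component => t /andP[t0 t1].
  have -> : (q.1, 0) + t *: (0, q.2) = (q.1, t *: q.2) :> phase.
    by congr pair; rewrite /= ?scaler0 ?addr0 ?add0r.
  split => //=; first by rewrite xfE /= q0 scale0r addr0.
  (* Over a zero of [phi], [h] is affine in [p] with value 1 at [p = 0], hence positive along the
     segment. *)
  move: h0; rewrite !hfun_zero//= !mxE.
  move: (partial 0 phi _) (partial 1 phi _) (q.2 0 0) (q.2 0 1) => a b p0 p1 h0.
  have -> : 1 - t * p1 * a + t * p0 * b = (1 - t) + t * (1 - p1 * a + p0 * b) by ring.
  move: t1; rewrite le_eqVlt => /orP[/eqP ->|t1].
    by rewrite subrr add0r mul1r.
  apply: ltr_wpDr; last by rewrite subr_gt0.
  by apply: mulr_ge0 => //; exact: ltW.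
have {}c : connected_component regular_base q.1 (xf phi q) by case: c => // /eqP; rewrite (negbTE q0).
set C := connected_component regular_base q.1 in c.
(* The arrow from [q.1] to [y]: the equation [y = x + phi x *: rot p] solved for [p], the inverse of
   [rot] being [- rot]. *)
pose s (y : plane) : phase := (q.1, - rot ((phi q.1)^-1 *: (y - q.1))).
have xs y : xf phi (s y) = y.
  rewrite xfE /= rotN rot_rot opprK scalerA divff// scale1r addrC subrK //.
have cs : continuous s.
  move=> y; apply: differentiable_continuous; apply: (@differentiable_pair _ _ _ _ (cst q.1)); first exact: differentiable_cst.
  have da : differentiable (fun y : plane => (phi q.1)^-1 *: (y - q.1)) y.
    apply: (@differentiableZ _ _ _ (fun y : plane => y - q.1)).
    by apply: (@differentiableB _ _ _ id (cst q.1)).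
  apply: (@differentiableN _ _ _ (fun y => rot ((phi q.1)^-1 *: (y - q.1)))).
  apply: (@differentiable_comp _ _ _ _ (fun y : plane => (phi q.1)^-1 *: (y - q.1)) rot) => //.
  exact: (linear_differentiable _ rot_continuous).
have CC : connected (s @` C).
  apply: connected_continuous_connected; first exact: component_connected.
  exact: continuous_subspaceT.
have sub : s @` C `<=` pre_total.
  move=> _ [y Cy <-]; split => //; rewrite ?xs; first by have [] := component_regular Cy.
  by rewrite hfun_neq0//= xs; exact: component_sign.
apply: (connected_component_max _ sub CC).
  exists q.1; first exact: connected_component_refl.
  by rewrite /s subrr scaler0 linear0 oppr0.
exists (xf phi q) => //; rewrite /s xfE addrC addKr scalerA mulVf// scale1r rot_rot opprK.
by rewrite -surjective_pairing.
Qed.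

End total_space.

(** * The groupoid law *)

Section groupoid_law.
Context {R : realType}.
Local Notation plane := 'rV[R]_2.
Local Notation phase := (plane * plane)%type.
Variables (U : set plane) (phi : plane -> R).
Hypotheses (oU : open U) (Sphi : smooth U phi).
Local Notation G := (total U phi).
Local Notation comp := (planar_comp phi).
Implicit Types (g k : phase).

(** The second component solves [q.2 + hfun phi q *: p = 0]. *)
Definition inverse (q : phase) : phase := (xf phi q, - ((hfun phi q)^-1 *: q.2)).

Lemma total_hfun q : G q -> 0 < hfun phi q. Proof. by move=> [[]]. Qed.
Lemma total_hfun_neq0 q : G q -> hfun phi q != 0.
Proof. by move=> /total_hfun h0; rewrite gt_eqF. Qed.
Lemma total_base q : G q -> U q.1. Proof. by move=> [[]]. Qed.
Lemma total_both q : G q -> over_both U phi q. Proof. by move=> [[]]. Qed.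

(** The factor [hfun phi g] in the law turns [phi g.1] into [phi k.1], so the displacement of [k] is
    appended to that of [g]. *)
Lemma xf_comp g k : xf phi g = k.1 -> xf phi (comp g k) = xf phi k.
Proof.
move=> e; rewrite [RHS]xfE -e -hfun_xf (xfE phi (comp g k)) (xfE phi g) /=.
by rewrite rotD rotZ scalerDr addrA scalerA.
Qed.

(** Off the zeros of [phi] the quotients of [phi] at target and source telescope; at a zero, [g] and
    [k] have the same source and [h - 1] is linear in [p]. *)
Lemma hfun_comp g k : hfun phi g != 0 -> xf phi g = k.1 ->
  hfun phi (comp g k) = hfun phi g * hfun phi k.
Proof.
move=> h0 e; have [g0|g0] := eqVneq (phi g.1) 0.
  have ek : k.1 = g.1 by rewrite -e xfE g0 scale0r addr0.
  have k0 : phi k.1 = 0 by rewrite ek.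
  rewrite (hfun_zero k0) (hfun_zero (q := comp g k) g0) (hfun_zero g0) ek /= !mxE.
  by rewrite (hfun_zero g0); ring.
have k0 : phi k.1 != 0 by rewrite -e -hfun_xf mulf_neq0.
rewrite (hfun_neq0 (q := comp g k) g0) (xf_comp e) (hfun_neq0 k0) [comp g k]/planar_comp /=.
rewrite (hfun_neq0 g0) e; field.
by rewrite g0 k0.
Qed.

Lemma total_comp g k : G g -> G k -> xf phi g = k.1 -> G (comp g k).
Proof.
move=> Gg Gk e; have [[Ug Uxg hg] cg] := Gg; have [[Uk Uxk hk] ck] := Gk.
split; first by split => //; [rewrite xf_comp|rewrite hfun_comp ?gt_eqF// mulr_gt0].
rewrite (xf_comp e); have [g0|g0] := eqVneq (phi g.1) 0; [by left|right].
have {}cg : connected_component (regular_base U phi) g.1 k.1.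
  by rewrite -e; case: cg => // /eqP; rewrite (negbTE g0).
have [_ k0] := component_regular cg.
have {}ck : connected_component (regular_base U phi) k.1 (xf phi k).
  by case: ck => // /eqP; rewrite (negbTE k0).
exact: connected_component_trans cg ck.
Qed.

Lemma xf_inverse q : hfun phi q != 0 -> xf phi (inverse q) = q.1.
Proof.
move=> h0; rewrite xfE /= rotN rotZ scalerN scalerA -hfun_xf mulfK// xfE.
by rewrite addrK.
Qed.

Lemma hfun_inverse q : hfun phi q != 0 -> hfun phi (inverse q) = (hfun phi q)^-1.
Proof.
move=> h0; have [q0|q0] := eqVneq (phi q.1) 0.
  have e : xf phi q = q.1 by rewrite xfE q0 scale0r addr0.
  have i0 : phi (inverse q).1 = 0 by rewrite /= e.
  rewrite (hfun_zero i0) [(inverse q).1]/= e [(inverse q).2]/= !mxE.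
  have hE := hfun_zero q0; move: (partial 0 phi _) (partial 1 phi _) (hfun phi q) h0 hE => a b h h0 hE.
  apply: (mulfI h0); rewrite mulfV//.
  have -> : h * (1 - - (h^-1 * q.2 0 1) * a + - (h^-1 * q.2 0 0) * b) = h - (- (q.2 0 1 * a) + q.2 0 0 * b).
    by field.
  by rewrite hE; ring.
have i0 : phi (inverse q).1 != 0 by rewrite /= -hfun_xf mulf_neq0.
by rewrite (hfun_neq0 i0) xf_inverse// (hfun_neq0 q0) [(inverse q).1]/= invf_div.
Qed.

Lemma total_inverse q : G q -> G (inverse q).
Proof.
move=> Gq; have [[Uq Ux h0] c] := Gq; have hn0 := total_hfun_neq0 Gq.
split; first by split=> //; rewrite ?xf_inverse ?hfun_inverse ?invr_gt0.
rewrite xf_inverse// [(inverse q).1]/=.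
have [q0|q0] := eqVneq (phi q.1) 0.
  by left; rewrite -hfun_xf q0 mul0r.
right; apply: connected_component_sym.
by case: c => // /eqP; rewrite (negbTE q0).
Qed.

Lemma comp_inverse q : hfun phi q != 0 -> comp q (inverse q) = (q.1, 0).
Proof. by move=> h0; rewrite /planar_comp /= scalerN scalerA divff// scale1r subrr. Qed.

Lemma inverseK q : hfun phi q != 0 -> inverse (inverse q) = q.
Proof.
move=> h0; rewrite {1}/inverse xf_inverse// hfun_inverse// invrK /= scalerN opprK scalerA.
by rewrite divff// scale1r -surjective_pairing.
Qed.

(** The coefficients of [m.2] on the two sides agree because [h] is multiplicative. *)
Lemma comp_assoc g k m : hfun phi g != 0 -> xf phi g = k.1 ->
  comp (comp g k) m = comp g (comp k m).
Proof.
by move=> h0 e; rewrite /planar_comp hfun_comp//= scalerDr addrA scalerA.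
Qed.

Lemma smooth_phase (V : normedModType R) (A : set V) (f g : V -> plane) : open A ->
  smooth A f -> smooth A g -> smooth A (fun x => (f x, g x) : phase).
Proof.
move=> oA Sf Sg n; elim: n f g Sf Sg => [|n IH] f g Sf Sg.
  move=> x Ax; apply: differentiable_continuous.
  apply: differentiable_pair; exact: (smooth_differentiable _ Ax).
have d x : A x -> differentiable (fun x => (f x, g x) : phase) x.
  by move=> Ax; apply: differentiable_pair; exact: (smooth_differentiable _ Ax).
split=> // v.
apply: (Cn_ext oA _ (IH ('D_v f) ('D_v g) (smooth_derive v Sf) (smooth_derive v Sg))) => x Ax.
have df := smooth_differentiable Sf Ax; have dg := smooth_differentiable Sg Ax.
by rewrite (deriveE v (d x Ax)) diff_pair// (deriveE v df) (deriveE v dg).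
Qed.

Lemma smooth_snd_phase (A : set phase) : smooth A (snd : phase -> plane).
Proof.
by apply: (@smooth_linear R _ _ A snd) => q; exact: cvg_snd.
Qed.

Lemma smooth_scale_plane (V : normedModType R) (A : set V) (c : V -> R) (f : V -> plane) :
  open A -> smooth A c -> smooth A f -> smooth A (fun x => c x *: f x).
Proof.
move=> oA Sc Sf n; apply: (@Cn_ext R n _ _ A (fun x => \sum_i (c x * f x 0 i) *: delta_mx 0 i)) => //.
  move=> x _; rewrite [in RHS](plane_basis (f x)) scaler_sumr.
  by apply: eq_bigr => i _; rewrite scalerA.
apply: Cn_sum => // i; apply: Cn_scalel => //; apply: CnM => //.
have Si : smooth A (fun x => xcoord i (f x, 0 : plane)).
  move=> k; apply: (@Cn_lin_comp R k _ _ _ A (fun x => (f x, 0 : plane) : phase) (xcoord i)) => //.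
    exact: xcoord_continuous.
  apply: (@smooth_phase V A f (fun=> 0)) => // m; exact: Cn_cst.
exact: (Si n).
Qed.

Lemma smooth_inverse : smooth (G) inverse.
Proof.
have oG := open_total oU Sphi.
have GO : G `<=` over_both U phi by exact: total_both.
have GB : G `<=` over_base U by exact: total_base.
apply: smooth_phase => //; first exact: (smooth_sub_set GB (smooth_xf oU Sphi)).
move=> n; apply: (CnN oG); apply: smooth_scale_plane => //; last exact: smooth_snd_phase.
move=> k; apply: CnV => //; first exact: total_hfun_neq0.
exact: (smooth_sub_set GO (smooth_hfun oU Sphi)).
Qed.

End groupoid_law.

(** * The 2-form and its Poisson brackets *)

Section form_and_brackets.
Context {R : realType}.
Local Notation plane := 'rV[R]_2.
Local Notation phase := (plane * plane)%type.

Definition vec2 (a b : R) : plane := \row_i (if i == 0 then a else b).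
Lemma vec2_0 a b : vec2 a b 0 0 = a. Proof. by rewrite mxE. Qed.
Lemma vec2_1 a b : vec2 a b 0 1 = b. Proof. by rewrite mxE. Qed.

Definition covec (a0 a1 b0 b1 : R) (v : phase) : R :=
  a0 * v.1 0 0 + a1 * v.1 0 1 + b0 * v.2 0 0 + b1 * v.2 0 1.

Lemma covec_exists (L : {linear phase -> R}) :
  exists a0 a1 b0 b1, forall v, L v = covec a0 a1 b0 b1 v.
Proof.
exists (L (delta_mx 0 0, 0)), (L (delta_mx 0 1, 0)), (L (0, delta_mx 0 0)), (L (0, delta_mx 0 1)).
move=> v; have E : v = v.1 0 0 *: (delta_mx 0 0, 0) + v.1 0 1 *: (delta_mx 0 1, 0)
    + v.2 0 0 *: (0, delta_mx 0 0) + v.2 0 1 *: (0, delta_mx 0 1) :> phase.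
  case: v => a b; congr pair; rewrite /= !scaler0 ?addr0 ?add0r.
    by rewrite {1}(plane_basis a) sum_ord2.
  by rewrite {1}(plane_basis b) sum_ord2.
rewrite {1}E !linearD !linearZ /covec.
by congr (_ + _ + _ + _); exact: mulrC.
Qed.

Variable (phi : plane -> R).
Local Notation f0 q := (partial 0 phi q.1).
Local Notation f1 q := (partial 1 phi q.1).
Local Notation omega := (planar_form phi).

Lemma planar_formE (q u v : phase) : omega q u v = (hfun phi q)^-1 *
  (psi phi q * (u.1 0 0 * v.1 0 1 - v.1 0 0 * u.1 0 1)
   + (1 - q.2 0 1 * f0 q) * (u.1 0 0 * v.2 0 0 - v.1 0 0 * u.2 0 0)
   + q.2 0 0 * f0 q * (u.1 0 0 * v.2 0 1 - v.1 0 0 * u.2 0 1)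
   - q.2 0 1 * f1 q * (u.1 0 1 * v.2 0 0 - v.1 0 1 * u.2 0 0)
   + (1 + q.2 0 0 * f1 q) * (u.1 0 1 * v.2 0 1 - v.1 0 1 * u.2 0 1)
   + phi q.1 * (u.2 0 0 * v.2 0 1 - v.2 0 0 * u.2 0 1)).
Proof. by case: q. Qed.

Lemma planar_form_linear q a u v w : omega q (a *: u + v) w = a * omega q u w + omega q v w.
Proof. by rewrite !planar_formE /= !mxE; ring. Qed.

Lemma planar_form_alternating q u v : omega q u v = - omega q v u.
Proof. by rewrite !planar_formE; ring. Qed.

(* Contraction with the Poisson bivector of the symplectic groupoid. *)
Definition ham (q : phase) (a0 a1 b0 b1 : R) : phase :=
  (vec2 (- phi q.1 * a1 + (1 + q.2 0 0 * f1 q) * b0 + q.2 0 1 * f1 q * b1)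
        (phi q.1 * a0 - q.2 0 0 * f0 q * b0 + (1 - q.2 0 1 * f0 q) * b1),
   vec2 (- (1 + q.2 0 0 * f1 q) * a0 + q.2 0 0 * f0 q * a1 - psi phi q * b1)
        (- (q.2 0 1 * f1 q) * a0 - (1 - q.2 0 1 * f0 q) * a1 + psi phi q * b0)).

(** By [hfun_psi], [h] is up to sign the Pfaffian of the bracketed 2-form; contracting that form
    with the bivector yields [h] times the identity, and the prefactor [1 / h] normalises it. *)
Lemma planar_form_ham q a0 a1 b0 b1 v : hfun phi q != 0 ->
  omega q (ham q a0 a1 b0 b1) v = covec a0 a1 b0 b1 v.
Proof.
move=> h0; rewrite planar_formE /ham [(_, _).1]/= [(_, _).2]/= !vec2_0 !vec2_1 /covec.
apply: (mulfI h0); rewrite mulVKf// hfun_psi.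
move: (psi phi q) (phi q.1) (f0 q) (f1 q) (q.2 0 0) (q.2 0 1) => s f a b p0 p1.
by move: (v.1 0 0) (v.1 0 1) (v.2 0 0) (v.2 0 1) => x0 x1 y0 y1; ring.
Qed.

Lemma planar_form_nondegenerate q u : hfun phi q != 0 ->
  (forall v, omega q u v = 0) -> u = 0.
Proof.
move=> h0 H; have C a0 a1 b0 b1 : covec a0 a1 b0 b1 u = 0.
  by rewrite -(planar_form_ham _ _ _ _ _ h0) planar_form_alternating H oppr0.
have := (C 1 0 0 0, C 0 1 0 0, C 0 0 1 0, C 0 0 0 1).
rewrite /covec !mul0r !mul1r !add0r !addr0 => -[[[E0 E1] E2] E3].
by case: u E0 E1 E2 E3 {H C} => x y /= E0 E1 E2 E3; congr pair; apply: plane_eqP; rewrite ?mxE.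
Qed.

(** [hamiltonian_field] is a choice among solutions; nondegeneracy leaves only one. *)
Lemma hamiltonian_field_unique (F : phase -> R) q xi : hfun phi q != 0 ->
  (forall v, omega q xi v = 'd F q v) -> hamiltonian_field omega F q = xi.
Proof.
move=> h0 H; set X := hamiltonian_field omega F q.
have HX : forall v, omega q X v = 'd F q v.
  exact: (@xgetPex _ 0 [set xi | forall v, omega q xi v = 'd F q v] (ex_intro _ xi H)).
apply/eqP; rewrite -subr_eq0; apply/eqP; apply: (planar_form_nondegenerate h0) => v.
by rewrite addrC -scaleN1r planar_form_linear HX H mulN1r addNr.
Qed.

Lemma hamiltonian_fieldP (F : phase -> R) q v : hfun phi q != 0 ->
  omega q (hamiltonian_field omega F q) v = 'd F q v.
Proof.
move=> h0; have [a0 [a1 [b0 [b1 H]]]] := covec_exists ('d F q).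
rewrite (@hamiltonian_field_unique F q (ham q a0 a1 b0 b1) h0) ?H ?planar_form_ham//.
by move=> w; rewrite planar_form_ham// H.
Qed.

Lemma bracket_covec (F K : phase -> R) q a0 a1 b0 b1 : hfun phi q != 0 ->
  (forall v, 'd F q v = covec a0 a1 b0 b1 v) ->
  symplectic_bracket omega F K q = 'd K q (ham q a0 a1 b0 b1).
Proof.
move=> h0 H; rewrite /symplectic_bracket; congr ('d K q _).
by apply: hamiltonian_field_unique => // v; rewrite planar_form_ham// H.
Qed.

Lemma poisson_bracketE (f g : plane -> R) x : poisson_bracket (planar_bivector phi) f g x =
  phi x * (partial 0 f x * partial 1 g x - partial 1 f x * partial 0 g x).
Proof.
rewrite /poisson_bracket !sum_ord2 /planar_bivector.
have aE i j : (phi x *: eps) i j = phi x * eps i j by rewrite mxE.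
by rewrite !aE !epsii eps01 eps10; ring.
Qed.

Variables (U : set plane).
Hypotheses (oU : open U) (Sphi : smooth U phi).

Lemma fst_poisson (f g : plane -> R) q : U q.1 -> hfun phi q != 0 -> smooth U f -> smooth U g ->
  poisson_bracket (planar_bivector phi) f g q.1 =
  symplectic_bracket omega (f \o fst) (g \o fst) q.
Proof.
move=> Uq h0 Sf Sg.
have D (k : plane -> R) v : smooth U k -> 'd (k \o fst) q v = v.1 0 0 * partial 0 k q.1 + v.1 0 1 * partial 1 k q.1.
  move=> Sk; have dk := smooth_differentiable Sk Uq.
  have [d E] := derive_comp_linear (L := fst) v (@phase_fst_continuous R) dk.
  by rewrite -(derive_plane _ dk) -E deriveE.
rewrite (@bracket_covec _ _ q (partial 0 f q.1) (partial 1 f q.1) 0 0)//; last first.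
  by move=> v; rewrite D// /covec; ring.
rewrite poisson_bracketE D// [(ham _ _ _ _ _).1]/= vec2_0 vec2_1; ring.
Qed.

Lemma dxf0 (q v : phase) : U q.1 -> dxf phi q v 0 0 =
  v.1 0 0 - (v.1 0 0 * f0 q + v.1 0 1 * f1 q) * q.2 0 1 - phi q.1 * v.2 0 1.
Proof.
move=> Uq; rewrite /dxf derive_plane; last exact: (smooth_differentiable Sphi Uq).
by rewrite mxE [(v.1 + _) 0 0]mxE [(_ *: rot q.2) 0 0]mxE [(_ *: rot v.2) 0 0]mxE !rot0; ring.
Qed.

Lemma dxf1 (q v : phase) : U q.1 -> dxf phi q v 0 1 =
  v.1 0 1 + (v.1 0 0 * f0 q + v.1 0 1 * f1 q) * q.2 0 0 + phi q.1 * v.2 0 0.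
Proof.
move=> Uq; rewrite /dxf derive_plane; last exact: (smooth_differentiable Sphi Uq).
by rewrite mxE [(v.1 + _) 0 1]mxE [(_ *: rot q.2) 0 1]mxE [(_ *: rot v.2) 0 1]mxE !rot1.
Qed.

Lemma xf_anti_poisson (f g : plane -> R) q : U q.1 -> U (xf phi q) -> hfun phi q != 0 ->
  smooth U f -> smooth U g ->
  poisson_bracket (planar_bivector phi) f g (xf phi q) =
  - symplectic_bracket omega (f \o xf phi) (g \o xf phi) q.
Proof.
move=> Uq Ux h0 Sf Sg.
have D (k : plane -> R) v : smooth U k -> 'd (k \o xf phi) q v =
    dxf phi q v 0 0 * partial 0 k (xf phi q) + dxf phi q v 0 1 * partial 1 k (xf phi q).
  move=> Sk; have dk := smooth_differentiable Sk Ux.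
  have dx := smooth_differentiable (smooth_xf oU Sphi) (Uq : over_base U q).
  rewrite -(derive_plane _ dk) -(has_derive_val (has_derive_xf_comp oU Sphi v Uq dk)).
  by rewrite deriveE//; exact: (differentiable_comp dx dk).
set F0 := partial 0 f (xf phi q); set F1 := partial 1 f (xf phi q).
(* The covector is the gradient of [f] at the target, pulled back through [dxf]. *)
rewrite (@bracket_covec _ _ q (F0 * (1 - f0 q * q.2 0 1) + F1 * (f0 q * q.2 0 0))
  (- F0 * (f1 q * q.2 0 1) + F1 * (1 + f1 q * q.2 0 0)) (phi q.1 * F1) (- (phi q.1 * F0)))//; last first.
  by move=> v; rewrite D// dxf0// dxf1// /covec -/F0 -/F1; ring.
rewrite poisson_bracketE D// dxf0// dxf1// /ham [(_, _).1]/= [(_, _).2]/= !vec2_0 !vec2_1.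
(* Once [phi] at the target is [phi h] and [h] is expressed through [psi], a polynomial identity
   remains, valid at zeros of [phi] too. *)
rewrite -hfun_xf hfun_psi -/F0 -/F1.
move: (psi phi q) (phi q.1) (f0 q) (f1 q) (q.2 0 0) (q.2 0 1) F0 F1 => s c a b p0 p1 F0 F1.
by move: (partial 0 g _) (partial 1 g _) => G0 G1; ring.
Qed.

End form_and_brackets.

(** * Multiplicativity of the 2-form *)

Section multiplicativity.
Context {R : realType}.
Local Notation plane := 'rV[R]_2.
Local Notation phase := (plane * plane)%type.
Variables (U : set plane) (phi : plane -> R).
Hypotheses (oU : open U) (Sphi : smooth U phi).
Local Notation G := (total U phi).
Local Notation comp := (planar_comp phi).
Local Notation omega := (planar_form phi).

(** All data are free scalars, so that multiplicativity at a zero of [phi] becomes an identity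
    between polynomials in variables. *)
Definition form_num (s f f0 f1 p0 p1 u0 u1 u2 u3 v0 v1 v2 v3 : R) : R :=
  s * (u0 * v1 - v0 * u1) + (1 - p1 * f0) * (u0 * v2 - v0 * u2) + p0 * f0 * (u0 * v3 - v0 * u3)
  - p1 * f1 * (u1 * v2 - v1 * u2) + (1 + p0 * f1) * (u1 * v3 - v1 * u3) + f * (u2 * v3 - v2 * u3).

Lemma planar_form_num q u v : omega q u v = (hfun phi q)^-1 *
  form_num (psi phi q) (phi q.1) (partial 0 phi q.1) (partial 1 phi q.1) (q.2 0 0) (q.2 0 1)
    (u.1 0 0) (u.1 0 1) (u.2 0 0) (u.2 0 1) (v.1 0 0) (v.1 0 1) (v.2 0 0) (v.2 0 1).
Proof. exact: planar_formE. Qed.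

(* Multiplicativity at a zero of [phi]. The second derivatives of [phi] are
   [a + a], [b] and [c + c], so that the identity is free of divisions. *)
Lemma form_num_comp (a b c f0 f1 p0 p1 r0 r1 u0 u1 u2 u3 u4 u5 v0 v1 v2 v3 v4 v5 : R)
    (ps := fun x y : R => x * y * b - x ^+ 2 * c - y ^+ 2 * a)
    (h := 1 - p1 * f0 + p0 * f1) (k := 1 - r1 * f0 + r0 * f1)
    (dh := fun w0 w1 w2 w3 : R => p0 * (w0 * b + w1 * (c + c)) + f1 * w2
       - (p1 * (w0 * (a + a) + w1 * b) + f0 * w3) - ps p0 p1 * (w0 * f0 + w1 * f1)) :
  form_num (ps (p0 + h * r0) (p1 + h * r1)) 0 f0 f1 (p0 + h * r0) (p1 + h * r1)
    u0 u1 (u2 + (h * u4 + dh u0 u1 u2 u3 * r0)) (u3 + (h * u5 + dh u0 u1 u2 u3 * r1))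
    v0 v1 (v2 + (h * v4 + dh v0 v1 v2 v3 * r0)) (v3 + (h * v5 + dh v0 v1 v2 v3 * r1)) =
  k * form_num (ps p0 p1) 0 f0 f1 p0 p1 u0 u1 u2 u3 v0 v1 v2 v3 +
  h * form_num (ps r0 r1) 0 f0 f1 r0 r1
    (u0 - (u0 * f0 + u1 * f1) * p1) (u1 + (u0 * f0 + u1 * f1) * p0) u4 u5
    (v0 - (v0 * f0 + v1 * f1) * p1) (v1 + (v0 * f0 + v1 * f1) * p0) v4 v5.
Proof. by rewrite /form_num /dh /ps /h /k; ring. Qed.

Lemma psi_zero_half q (a b c : R) : phi q.1 = 0 ->
  partial 0 (partial 0 phi) q.1 = a + a -> partial 0 (partial 1 phi) q.1 = b ->
  partial 1 (partial 1 phi) q.1 = c + c ->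
  psi phi q = q.2 0 0 * q.2 0 1 * b - q.2 0 0 ^+ 2 * c - q.2 0 1 ^+ 2 * a.
Proof.
move=> q0 aE bE cE; rewrite (psi_zero q0) aE bE cE.
have half (x : R) : 2^-1 * (x + x) = x by rewrite -mulr2n -[x *+ 2]mulr_natl mulKf// pnatr_eq0.
by congr (_ - _ - _); rewrite -mulrA mulrCA half.
Qed.

Lemma halve (x : R) : exists y, x = y + y.
Proof. by exists (x / 2); rewrite -splitr. Qed.

Lemma psi_unit x : psi phi (x, 0) = 0.
Proof.
have Z i : ((x, 0) : phase).2 0 i = 0 by rewrite mxE.
have [x0|x0] := eqVneq (phi x) 0; last first.
  rewrite (psi_neq0 (q := (x, 0)) x0) !Z hfun_unit.
  have E (a b c : R) : (1 + 0 * a - 0 * b - 1) / c = 0.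
    by rewrite !mul0r addr0 subr0 subrr mul0r.
  exact: E.
have [a aE] := halve (partial 0 (partial 0 phi) x).
have [c cE] := halve (partial 1 (partial 1 phi) x).
have [b bE] : exists b, partial 0 (partial 1 phi) x = b by exists (partial 0 (partial 1 phi) x).
by rewrite (psi_zero_half (q := (x, 0)) x0 aE bE cE) !Z; ring.
Qed.

(** The differential of [comp] at [(g, k)], as [derive_planar_comp] shows; as a formula it applies
    to vectors [u], [u'] without choosing curves. *)
Definition dcomp (g k u u' : phase) : phase :=
  (u.1, u.2 + (hfun phi g *: u'.2 + 'D_u (hfun phi) g *: k.2)).

(** Infinitesimal form of [xf_comp]; the terms along [rot k.2] match by differentiating
    [phi h = phi \o xf phi]. *)
Lemma dxf_comp (g k u u' : phase) : over_both U phi g -> xf phi g = k.1 -> u'.1 = dxf phi g u ->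
  dxf phi (comp g k) (dcomp g k u u') = dxf phi k u'.
Proof.
move=> Og e e'; have H := derive_hfun_xf oU Sphi u Og.
rewrite {2}/dxf e' -e -H -hfun_xf /dxf [(comp g k).1]/= [(comp g k).2]/=.
rewrite [(dcomp g k u u').1]/= [(dcomp g k u u').2]/= !rotD !rotZ.
move: ('D_u (hfun phi) g) ('D_(u.1) phi g.1) (rot g.2) (rot k.2) (rot u.2) (rot u'.2) (phi g.1) (hfun phi g).
by move=> dh d a b c e1 f h; apply: plane_eqP; rewrite !mxE; ring.
Qed.

(** The target velocities are parameters [a], [b], so that for a composite they can be taken to be
    those of its second factor. *)
Lemma planar_form_regular q u v a b : U q.1 -> phi q.1 != 0 -> hfun phi q != 0 ->
  dxf phi q u = a -> dxf phi q v = b ->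
  omega q u v = (a 0 0 * b 0 1 - a 0 1 * b 0 0) / phi (xf phi q)
   - (u.1 0 0 * v.1 0 1 - u.1 0 1 * v.1 0 0) / phi q.1.
Proof.
move=> Uq q0 h0 <- <-; rewrite planar_formE -hfun_xf.
rewrite (dxf0 Sphi u Uq) (dxf1 Sphi u Uq) (dxf0 Sphi v Uq) (dxf1 Sphi v Uq) (psi_neq0 q0).
move: (phi q.1) (hfun phi q) q0 h0 (partial 0 phi q.1) (partial 1 phi q.1) (q.2 0 0) (q.2 0 1).
move=> f h f_n0 h_n0 c d p0 p1.
move: (u.1 0 0) (u.1 0 1) (u.2 0 0) (u.2 0 1) (v.1 0 0) (v.1 0 1) (v.2 0 0) (v.2 0 1).
by move=> u0 u1 u2 u3 v0 v1 v2 v3; field; rewrite f_n0 h_n0.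
Qed.

Lemma planar_form_comp (g k u u' v v' : phase) :
  over_both U phi g -> over_both U phi k -> hfun phi g != 0 -> hfun phi k != 0 ->
  xf phi g = k.1 -> u'.1 = dxf phi g u -> v'.1 = dxf phi g v ->
  omega (comp g k) (dcomp g k u u') (dcomp g k v v') = omega g u v + omega k u' v'.
Proof.
move=> Og Ok hg hk e eu ev; have [Ug Uxg] := Og; have [Uk Uxk] := Ok.
have [g0|g0] := eqVneq (phi g.1) 0; last first.
  have k0 : phi k.1 != 0 by rewrite -e -hfun_xf mulf_neq0.
  have hc : hfun phi (comp g k) != 0 by rewrite hfun_comp// mulf_neq0.
  (* On the right-hand side, the contributions at the middle point [xf phi g = k.1] cancel, leaving
     the source of [g] and the target of [k]. *)
  rewrite (@planar_form_regular (comp g k) _ _ _ _ Ug g0 hc (dxf_comp Og e eu) (dxf_comp Og e ev)).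
  rewrite (planar_form_regular Ug g0 hg (esym eu) (esym ev)).
  rewrite (planar_form_regular Uk k0 hk erefl erefl) (xf_comp e) e.
  by rewrite [RHS]addrC addrA subrK.
have ek : k.1 = g.1 by rewrite -e xfE g0 scale0r addr0.
have k0 : phi k.1 = 0 by rewrite ek.
have df i : differentiable (partial i phi) g.1.
  exact: (smooth_differentiable (smooth_derive _ Sphi) Ug).
have dphi : differentiable phi g.1 by exact: (smooth_differentiable Sphi Ug).
have [a aE] := halve (partial 0 (partial 0 phi) g.1).
have [c cE] := halve (partial 1 (partial 1 phi) g.1).
have [b bE] : exists b, partial 0 (partial 1 phi) g.1 = b by exists (partial 0 (partial 1 phi) g.1).
have b'E : partial 1 (partial 0 phi) g.1 = b.
  by apply: etrans bE; exact: (deriveC _ _ oU (Sphi 2) Ug).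
have psE (q : phase) : q.1 = g.1 -> psi phi q =
    q.2 0 0 * q.2 0 1 * b - q.2 0 0 ^+ 2 * c - q.2 0 1 ^+ 2 * a.
  by move=> qE; apply: psi_zero_half; rewrite qE.
have hD (w : phase) : 'D_w (hfun phi) g =
   g.2 0 0 * (w.1 0 0 * b + w.1 0 1 * (c + c)) + partial 1 phi g.1 * w.2 0 0
   - (g.2 0 1 * (w.1 0 0 * (a + a) + w.1 0 1 * b) + partial 0 phi g.1 * w.2 0 1)
   - (g.2 0 0 * g.2 0 1 * b - g.2 0 0 ^+ 2 * c - g.2 0 1 ^+ 2 * a) *
     (w.1 0 0 * partial 0 phi g.1 + w.1 0 1 * partial 1 phi g.1).
  rewrite (derive_hfun oU Sphi w Og) g0 mul0r add0r (psE g erefl).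
  rewrite (derive_plane _ (df 0)) (derive_plane _ (df 1)) (derive_plane _ dphi).
  by rewrite aE cE bE b'E.
have eu0 := dxf0 Sphi u Ug; have eu1 := dxf1 Sphi u Ug.
have ev0 := dxf0 Sphi v Ug; have ev1 := dxf1 Sphi v Ug.
rewrite -eu g0 mul0r subr0 in eu0; rewrite -eu g0 mul0r addr0 in eu1.
rewrite -ev g0 mul0r subr0 in ev0; rewrite -ev g0 mul0r addr0 in ev1.
have c2 i : (comp g k).2 0 i = g.2 0 i + hfun phi g * k.2 0 i by rewrite !mxE.
have d2 (w w' : phase) dh i : 'D_w (hfun phi) g = dh -> (dcomp g k w w').2 0 i =
    w.2 0 i + (hfun phi g * w'.2 0 i + dh * k.2 0 i).
  by move=> <-; rewrite !mxE.
have c1 : (comp g k).1 = g.1 by [].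
have cp : phi (comp g k).1 = 0 by [].
have cpsi := psE (comp g k) erefl; have chf := hfun_comp hg e.
have du1 : (dcomp g k u u').1 = u.1 by [].
have dv1 : (dcomp g k v v').1 = v.1 by [].
have du2 i := d2 u u' _ i (hD u); have dv2 i := d2 v v' _ i (hD v).
move: {hD d2 cp} (dcomp g k u u') (dcomp g k v v') du1 dv1 du2 dv2 => du dv du1 dv1 du2 dv2.
move: (comp g k) c1 c2 cpsi chf => gk c1 c2 cpsi chf.
have cf : phi gk.1 = 0 by rewrite c1.
rewrite !planar_form_num chf cpsi cf du1 dv1 !du2 !dv2 c1 !c2.
rewrite (psE k ek) (psE g erefl) ek g0 eu0 eu1 ev0 ev1.
have hgE := hfun_zero g0; have hkE := hfun_zero k0; rewrite ek in hkE.
have F := form_num_comp a b c (partial 0 phi g.1) (partial 1 phi g.1) (g.2 0 0) (g.2 0 1)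
  (k.2 0 0) (k.2 0 1) (u.1 0 0) (u.1 0 1) (u.2 0 0) (u.2 0 1) (u'.2 0 0) (u'.2 0 1)
  (v.1 0 0) (v.1 0 1) (v.2 0 0) (v.2 0 1) (v'.2 0 0) (v'.2 0 1).
rewrite /= -hgE -hkE in F; rewrite F invfM.
move: (hfun phi g) (hfun phi k) hg hk {F hgE hkE chf c2 du2 dv2} => h h' hn hn'.
move: (form_num _ _ _ _ _ _ _ _ _ _ _ _ _ _) => N.
move: (form_num _ _ _ _ _ _ _ _ _ _ _ _ _ _) => N'.
by field; rewrite hn hn'.
Qed.

Lemma derive_lin_comp (V W E : normedModType R) (L : {linear W -> E}) (a : V -> W) x w :
  continuous L -> differentiable a x -> has_derive x w (fun y => L (a y)) (L ('D_w a x)).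
Proof.
move=> cL da; have dL : differentiable L (a x) by exact: linear_differentiable.
split; first by apply: diff_derivable; exact: (differentiable_comp da dL).
by rewrite (derive_comp w da dL) diff_lin.
Qed.

Lemma derive_pair (V W W' : normedModType R) (f : V -> W) (g : V -> W') x v :
  differentiable f x -> differentiable g x ->
  'D_v (fun y => (f y, g y)) x = ('D_v f x, 'D_v g x).
Proof.
move=> df dg; rewrite (deriveE v (differentiable_pair df dg)) (diff_pair df dg).
by rewrite (deriveE v df) (deriveE v dg).
Qed.

Lemma derive_planar_comp (V : normedModType R) (a b : V -> phase) x w :
  differentiable a x -> differentiable b x -> differentiable (hfun phi) (a x) ->
  'D_w (fun y => comp (a y) (b y)) x = dcomp (a x) (b x) ('D_w a x) ('D_w b x).
Proof.
move=> da db dh.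
have dfst : differentiable (fun y => (a y).1) x.
  apply: (@differentiable_comp _ _ _ _ a fst) => //.
  by apply: linear_differentiable; exact: phase_fst_continuous.
pose S y : plane := (a y).2 + hfun phi (a y) *: (b y).2.
have dha : differentiable (fun y => hfun phi (a y)) x by exact: (differentiable_comp da dh).
have dp (c : V -> phase) i : differentiable c x -> differentiable (fun y => pcoord i (c y)) x.
  move=> dc; apply: (@differentiable_comp _ _ _ _ c (pcoord i)) => //.
  by apply: linear_differentiable; exact: pcoord_continuous.
pose s i y := pcoord i (a y) + hfun phi (a y) * pcoord i (b y).
have ds i : differentiable (s i) x.
  apply: (@differentiableD _ _ _ (fun y => pcoord i (a y))
     (fun y => hfun phi (a y) * pcoord i (b y))); first exact: dp.
  by apply: (@differentiableM _ _ (fun y => hfun phi (a y)) (fun y => pcoord i (b y))) => //; exact: dp.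
have SE : S = \sum_(i < 2) (fun y => s i y *: (delta_mx 0 i : plane)).
  apply/funext => y; rewrite fct_sumE (plane_basis (S y)); apply: eq_bigr => i _.
  by rewrite /S !mxE.
have dS : differentiable S x.
  by rewrite SE; apply: differentiable_sum => i; exact: differentiableZl.
have DS : 'D_w S x = ('D_w a x).2 + (hfun phi (a x) *: ('D_w b x).2 +
    'D_('D_w a x) (hfun phi) (a x) *: (b x).2).
  rewrite derive_mx; last exact: diff_derivable.
  apply/rowP => i; rewrite mxE.
  have -> : (fun t => S t 0 i) = s i by apply/funext => y; rewrite /S !mxE.
  have H := has_derive_add (derive_lin_comp w (@pcoord_continuous R i) da)
    (has_derive_mul (diff_has_derive w dha) (derive_lin_comp w (@pcoord_continuous R i) db)).
  apply: etrans (has_derive_val H) _.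
  have E : 'D_w (fun y => hfun phi (a y)) x = 'D_('D_w a x) (hfun phi) (a x).
    by rewrite (derive_comp w da dh) (deriveE _ dh).
  rewrite E !mxE /pcoord.
  by congr (_ + (_ + _)); exact: mulrC.
have Dfst : 'D_w (fun y => (a y).1) x = ('D_w a x).1.
  have cf := @phase_fst_continuous R.
  have df : differentiable (fst : phase -> plane) (a x) by exact: linear_differentiable.
  by rewrite (derive_comp w da df) diff_lin.
exact: (etrans (derive_pair w dfst dS) (congr2 pair Dfst DS)).
Qed.

Lemma dxf_inverse_fst q u : G q -> ('D_u (inverse phi) q).1 = dxf phi q u.
Proof.
move=> Gq; have oG := open_total oU Sphi.
have di := smooth_differentiable (smooth_inverse oU Sphi) Gq.
have cf := @phase_fst_continuous R.
have df : differentiable (fst : phase -> plane) (inverse phi q) by exact: linear_differentiable.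
rewrite -(derive_xf oU Sphi u (total_base Gq)).
by rewrite -[RHS]/('D_u (fun y => (inverse phi y).1) q) (derive_comp u di df) diff_lin.
Qed.

Lemma planar_form_inverse q u v : G q ->
  omega (inverse phi q) ('D_u (inverse phi) q) ('D_v (inverse phi) q) = - omega q u v.
Proof.
move=> Gq; have oG := open_total oU Sphi.
have Gi := total_inverse Gq; have h0 := total_hfun_neq0 Gq.
have di := smooth_differentiable (smooth_inverse oU Sphi) Gq.
have dh := smooth_differentiable (smooth_hfun oU Sphi) (total_both Gq).
have H := planar_form_comp (total_both Gq) (total_both Gi) h0 (total_hfun_neq0 Gi) erefl
  (dxf_inverse_fst u Gq) (dxf_inverse_fst v Gq).
have Z w : dcomp q (inverse phi q) w ('D_w (inverse phi) q) = (w.1, 0).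
  have did : differentiable (id : phase -> phase) q by [].
  have := @derive_planar_comp phase id (inverse phi) q w did di dh.
  rewrite derive_id => <-.
  have -> : 'D_w (fun y => comp y (inverse phi y)) q = 'D_w (fun y : phase => (y.1, 0) : phase) q.
    apply: (derive_eq_open _ oG) => // y Gy; exact: (comp_inverse (total_hfun_neq0 Gy)).
  have cf := @phase_fst_continuous R.
  have df : differentiable (fst : phase -> plane) q by exact: linear_differentiable.
  have dc : differentiable (cst 0 : phase -> plane) q by exact: differentiable_cst.
  by rewrite (derive_pair w df dc) (derive_linear (f := fst) w q cf) derive_cst.
move: H; rewrite !Z => H; apply/eqP; rewrite -addr_eq0 addrC -H comp_inverse//.
(* Both vectors have zero momentum part, so only the coefficient of [dx^1 dx^2] could contribute,
   and [psi] vanishes on units. *)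
apply/eqP; rewrite planar_formE [((_, _) : phase).1]/= [((_, _) : phase).2]/= !mxE.
by rewrite psi_unit; ring.
Qed.

(** As inversion reverses the sign of the form, it pushes the Hamiltonian field of
    [f \o inverse phi] to minus that of [f]; being an involution, it makes every test vector at the
    image a push-forward. *)
Lemma inverse_anti_poisson : anti_poisson_self_map G omega (inverse phi).
Proof.
move=> f g Sf Sg p Gp; have oG := open_total oU Sphi.
have Gi := total_inverse Gp; have h0 := total_hfun_neq0 Gp; have hi0 := total_hfun_neq0 Gi.
have di := smooth_differentiable (smooth_inverse oU Sphi) Gp.
have dii := smooth_differentiable (smooth_inverse oU Sphi) Gi.
have df := smooth_differentiable Sf Gi; have dg := smooth_differentiable Sg Gi.
have [X [XE HX]] : exists X, hamiltonian_field omega (f \o inverse phi) p = X /\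
    forall v, omega p X v = 'd (f \o inverse phi) p v.
  by eexists; split; [reflexivity|move=> v; exact: hamiltonian_fieldP].
have ip : inverse phi (inverse phi p) = p by exact: inverseK.
have surj w : 'D_('D_w (inverse phi) (inverse phi p)) (inverse phi) p = w.
  have dii' : differentiable (inverse phi) (inverse phi (inverse phi p)) by rewrite ip.
  have E := derive_comp w dii dii'; rewrite ip in E.
  refine (etrans (deriveE _ di) (etrans (esym E) _)).
  refine (etrans (@derive_eq_open R _ _ G _ id w (inverse phi p) oG _ Gi) (derive_id _ _)).
  by move=> y Gy; exact: (inverseK (total_hfun_neq0 Gy)).
have dcompE (K : phase -> R) v : differentiable K (inverse phi p) ->
    'd (K \o inverse phi) p v = 'd K (inverse phi p) ('D_v (inverse phi) p).
  move=> dK; refine (etrans (congr1 (fun F : phase -> R => F v) (diff_comp di dK)) _).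
  exact: (congr1 ('d K (inverse phi p)) (esym (deriveE v di))).
have N (a b : phase) q : omega q (- a) b = - omega q a b.
  have := planar_form_linear phi q (-1) a 0 b.
  have z : omega q 0 b = 0 by rewrite planar_formE !mxE !(mul0r, mulr0, subr0, addr0).
  by rewrite addr0 scaleN1r z addr0 mulN1r.
have HY : hamiltonian_field omega f (inverse phi p) = - 'D_X (inverse phi) p.
  apply: (hamiltonian_field_unique hi0) => v.
  pose v' := 'D_v (inverse phi) (inverse phi p).
  have Pf := etrans (congr1 (omega (inverse phi p) ('D_X (inverse phi) p)) (esym (surj v)))
    (planar_form_inverse X v' Gp).
  refine (etrans (N _ _ _) (etrans (congr1 -%R Pf) (etrans (opprK _) (etrans (HX v') _)))).
  exact: (etrans (dcompE f v' df) (congr1 ('d f (inverse phi p)) (surj v))).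
refine (etrans (congr1 ('d g (inverse phi p)) HY) (etrans (linearN _ _) (congr1 -%R _))).
by rewrite /symplectic_bracket XE; exact: (esym (dcompE g X dg)).
Qed.

End multiplicativity.

(** * Closedness of the 2-form *)

Section closed_form.
Context {R : realType}.
Implicit Type V : normedModType R.

(* [c *: da /\ db] is closed when [dc] is a combination of [da] and [db]. *)
Lemma closed_pullback V (A : set V) (a b c : V -> R) (al be : R) p (u v w : V)
    (F := fun (u v : V) (q : V) => c q * ('D_u a q * 'D_v b q - 'D_v a q * 'D_u b q)) :
  open A -> smooth A a -> smooth A b -> smooth A c -> A p ->
  (forall w, 'D_w c p = al * 'D_w a p + be * 'D_w b p) ->
  (forall u v w, derivable (F u v) p w) /\
  'D_u (F v w) p - 'D_v (F u w) p + 'D_w (F u v) p = 0.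
Proof.
move=> oA Sa Sb Sc Ap Dc.
have dc := smooth_differentiable Sc Ap.
have da x := smooth_differentiable (smooth_derive x Sa) Ap.
have db x := smooth_differentiable (smooth_derive x Sb) Ap.
(* Only the symmetry of the two Hessians matters: their terms cancel, and what is left is
   [dc /\ da /\ db], which vanishes by [Dc]. *)
have [A2 [HA symA]] : exists A2 : V -> V -> R,
    (forall x y, has_derive p x ('D_y a) (A2 x y)) /\ forall x y, A2 x y = A2 y x.
  exists (fun x y => 'D_x ('D_y a) p); split=> x y; first exact: diff_has_derive (da y).
  exact: (deriveC _ _ oA (Sa 2) Ap).
have [B2 [HB symB]] : exists B2 : V -> V -> R,
    (forall x y, has_derive p x ('D_y b) (B2 x y)) /\ forall x y, B2 x y = B2 y x.
  exists (fun x y => 'D_x ('D_y b) p); split=> x y; first exact: diff_has_derive (db y).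
  exact: (deriveC _ _ oA (Sb 2) Ap).
have H x y z := has_derive_mul (diff_has_derive z dc)
  (has_derive_sub (has_derive_mul (HA z x) (HB z y)) (has_derive_mul (HA z y) (HB z x))).
split; first by move=> x y z; have [] := H x y z.
have HD x y z := has_derive_val (H x y z).
refine (etrans (congr2 +%R (congr2 (fun s t => s - t) (HD v w u) (HD u w v)) (HD u v w)) _).
rewrite (Dc u) (Dc v) (Dc w) (symA v u) (symA w u) (symA w v) (symB v u) (symB w u) (symB w v).
generalize (derive a p u) (derive a p v) (derive a p w) (derive b p u) (derive b p v) (derive b p w) (c p).
by move=> au av aw bu bv bw cp; ring.
Qed.

Local Notation plane := 'rV[R]_2.
Local Notation phase := (plane * plane)%type.
Variables (U : set plane) (phi : plane -> R).
Hypotheses (oU : open U) (Sphi : smooth U phi).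
Local Notation G := (total U phi).
Local Notation omega := (planar_form phi).

Lemma smooth_planar_form u v : smooth G (fun q => omega q u v).
Proof.
have oG := open_total oU Sphi.
have GO : G `<=` over_both U phi by exact: total_both.
have GB : G `<=` over_base U by exact: total_base.
move=> n.
have Sh : Cn n G (fun q => (hfun phi q)^-1).
  apply: (CnV oG); first by move=> q /total_hfun_neq0.
  exact: Cn_sub GO (smooth_hfun oU Sphi n).
have Sps : Cn n G (psi phi) by exact: Cn_sub GO (smooth_psi oU Sphi n).
have Sb (f : plane -> R) : smooth U f -> Cn n G (fun q : phase => f q.1).
  by move=> Sf; exact: Cn_sub GB (smooth_base oU Sf n).
have Sd i : Cn n G (fun q : phase => partial i phi q.1).
  by apply: Sb; exact: smooth_derive.
have Sp i : Cn n G (fun q : phase => q.2 0 i) by exact: (smooth_pcoord G i n).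
have Sc (c : R) : Cn n G (fun _ : phase => c) by exact: Cn_cst.
apply: (Cn_ext oG (fun q _ => esym (planar_formE phi q u v))).
apply: (CnM oG) => //; apply: (CnD oG); last by apply: (CnM oG) => //; exact: Sb.
apply: (CnD oG); last by apply: (CnM oG) => //; apply: (CnD oG) => //; apply: (CnM oG).
apply: (CnB oG); last by apply: (CnM oG) => //; apply: (CnM oG).
apply: (CnD oG); last by apply: (CnM oG) => //; apply: (CnM oG).
apply: (CnD oG); last by apply: (CnM oG) => //; apply: (CnB oG) => //; apply: (CnM oG).
by apply: (CnM oG).
Qed.

Let d_omega (u v w : phase) (q : phase) : R :=
  'D_u (fun q => omega q v w) q - 'D_v (fun q => omega q u w) q + 'D_w (fun q => omega q u v) q.

Lemma derive_xf_coord q v i : U q.1 -> 'D_v (fun q => xf phi q 0 i) q = dxf phi q v 0 i.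
Proof.
move=> Uq; have dx := smooth_differentiable (smooth_xf oU Sphi) (Uq : over_base U q).
rewrite -(derive_xf oU Sphi v Uq) derive_mx; last exact: diff_derivable.
by rewrite mxE.
Qed.

Lemma smooth_xf_coord i : smooth (over_base U) (fun q => xf phi q 0 i).
Proof.
move=> n; have oB := open_over_base oU.
apply: (@Cn_ext R n _ _ _ (fun q => xcoord i q + xf_coef phi i q)) => //.
  move=> q _; rewrite xfE /xf_coef /rcoord /xcoord; move: (rot q.2) (phi q.1) => r f.
  by rewrite !mxE.
apply: (CnD oB); last exact: (smooth_xf_coef oU Sphi i n).
exact: (@smooth_linear R _ _ _ (xcoord i) (@xcoord_continuous R i) n).
Qed.

Lemma planar_form_closed_regular p u v w : G p -> phi p.1 != 0 -> d_omega u v w p = 0.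
Proof.
move=> Gp p0; have oG := open_total oU Sphi.
have Up := total_base Gp; have [_ Uxp] := total_both Gp.
have GO : G `<=` over_both U phi by exact: total_both.
have GB : G `<=` over_base U by exact: total_base.
have SB : smooth G (fun q : phase => phi q.1) by exact: (smooth_sub_set GB (smooth_base oU Sphi)).
have Sx : smooth G (fun q => phi (xf phi q)) by exact: (smooth_sub_set GO (smooth_xf_comp oU Sphi Sphi)).
pose A : set phase := G `&` (fun q : phase => phi q.1) @^-1` [set s | s != 0].
have oA : open A.
  by apply: (open_preimage_in oG (@open_neq R 0)) => q Gq; exact: (smooth_continuous SB Gq).
have AG : A `<=` G by move=> q [].
have xf0 q : A q -> phi (xf phi q) != 0.
  by move=> [Gq q0]; rewrite -hfun_xf; apply: mulf_neq0 => //; exact: (total_hfun_neq0 Gq).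
have Ap : A p by [].
pose k1 (q : phase) : R := (phi (xf phi q))^-1.
pose k2 (q : phase) : R := (phi q.1)^-1.
have Sk1 : smooth A k1.
  by move=> n; apply: (CnV oA xf0); exact: (smooth_sub_set AG Sx).
have Sk2 : smooth A k2.
  by move=> n; apply: (CnV oA); [move=> q []|exact: (smooth_sub_set AG SB)].
have Sr i : smooth A (fun q => xf phi q 0 i).
  by apply: smooth_sub_set (smooth_xf_coord i) => q /AG/GB.
have Sl i : smooth A (xcoord i).
  exact: (@smooth_linear R _ _ _ (xcoord i) (@xcoord_continuous R i)).
have Dl i x : 'D_x (xcoord i) p = x.1 0 i by exact: (derive_linear x p (@xcoord_continuous R i)).
(* [k1] is a function of the target point alone, so its differential is a combination of those of
   the target coordinates, as [closed_pullback] asks. *)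
have Dk1 x : 'D_x k1 p =
   - partial 0 phi (xf phi p) / phi (xf phi p) ^+ 2 * 'D_x (fun q => xf phi q 0 0) p
   + - partial 1 phi (xf phi p) / phi (xf phi p) ^+ 2 * 'D_x (fun q => xf phi q 0 1) p.
  have dx := smooth_differentiable Sphi Uxp.
  have H := has_derive_inv (xf0 p Ap) (has_derive_xf_comp oU Sphi x Up dx).
  apply: etrans (has_derive_val H) _.
  rewrite (derive_xf_coord x 0 Up) (derive_xf_coord x 1 Up) (derive_plane _ dx).
  by move: (dxf phi p x 0 0) (dxf phi p x 0 1) (partial 0 phi _) (partial 1 phi _) (phi (xf phi p) ^+ 2) => r s d e f; ring.
have Dk2 x : 'D_x k2 p = - partial 0 phi p.1 / phi p.1 ^+ 2 * 'D_x (xcoord 0) p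
   + - partial 1 phi p.1 / phi p.1 ^+ 2 * 'D_x (xcoord 1) p.
  have dx := smooth_differentiable Sphi Up.
  have H := has_derive_inv p0 (has_derive_base x Sphi Up).
  apply: etrans (has_derive_val H) _.
  rewrite (Dl 0 x) (Dl 1 x) (derive_plane _ dx).
  by move: (x.1 0 0) (x.1 0 1) (partial 0 phi _) (partial 1 phi _) (phi p.1 ^+ 2) => r s d e f; ring.
pose F (k a b : phase -> R) (x y q : phase) : R := k q * ('D_x a q * 'D_y b q - 'D_y a q * 'D_x b q).
pose F1 := F k1 (fun q => xf phi q 0 0) (fun q => xf phi q 0 1).
pose F2 := F k2 (xcoord 0) (xcoord 1).
have [d1 E1] : (forall x y z, derivable (F1 x y) p z) /\
    'D_u (F1 v w) p - 'D_v (F1 u w) p + 'D_w (F1 u v) p = 0.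
  exact: (closed_pullback u v w oA (Sr 0) (Sr 1) Sk1 Ap Dk1).
have [d2 E2] : (forall x y z, derivable (F2 x y) p z) /\
    'D_u (F2 v w) p - 'D_v (F2 u w) p + 'D_w (F2 u v) p = 0.
  exact: (closed_pullback u v w oA (Sl 0) (Sl 1) Sk2 Ap Dk2).
have FE x y z : 'D_z (fun q => omega q x y) p = 'D_z (F1 x y) p - 'D_z (F2 x y) p.
  rewrite -(deriveB (d1 x y z) (d2 x y z)); apply: (derive_eq_open z oA) => // q [Gq q0].
  have Uq := total_base Gq.
  apply: etrans (planar_form_regular Sphi Uq q0 (total_hfun_neq0 Gq) erefl erefl) _.
  rewrite -(derive_xf_coord x 0 Uq) -(derive_xf_coord x 1 Uq) -(derive_xf_coord y 0 Uq) -(derive_xf_coord y 1 Uq).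
  have D2 : F2 x y q = (x.1 0 0 * y.1 0 1 - x.1 0 1 * y.1 0 0) / phi q.1.
    have Dlq i z' : 'D_z' (xcoord i) q = z'.1 0 i by exact: (derive_linear z' q (@xcoord_continuous R i)).
    by rewrite /F2 /F (Dlq 0 x) (Dlq 1 y) (Dlq 0 y) (Dlq 1 x) mulrC (mulrC (y.1 0 0)).
  rewrite -D2 -[RHS]/(F1 x y q - F2 x y q); congr (_ - _).
  rewrite /F1 /F mulrC; congr (_ * (_ - _)); exact: mulrC.
have alg (a1 a2 a3 b1 b2 b3 : R) :
    (a1 - b1) - (a2 - b2) + (a3 - b3) = (a1 - a2 + a3) - (b1 - b2 + b3) by ring.
rewrite /d_omega FE FE FE; refine (etrans (alg _ _ _ _ _ _) _).
exact: (etrans (congr2 (fun s t => s - t) E1 E2) (subrr 0)).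
Qed.

(** All derivatives of [phi] vanish nearby as well, so [h = 1] and [psi = 0] there, and the form is
    the canonical one of the cotangent bundle. *)
Lemma planar_form_locally_constant (p x y : phase) : U p.1 -> (\forall q \near p, phi q.1 = 0) ->
  \forall q \near p, omega q x y = x.1 0 0 * y.2 0 0 - y.1 0 0 * x.2 0 0
    + (x.1 0 1 * y.2 0 1 - y.1 0 1 * x.2 0 1).
Proof.
move=> Up /nbhs_ballP[r /= r0 Hr].
pose B := ball p.1 r.
have oB : open B by exact: ball_open.
have B0 z : B z -> phi z = 0.
  move=> Bz; apply: (Hr (z, p.2)); split => //=; exact: ballxx.
have P0 i z : B z -> partial i phi z = 0.
  move=> Bz; rewrite /partial (derive_eq_open (A := B) (g := cst 0) _ oB)//.
  exact: derive_cst.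
have P00 i k z : B z -> partial i (partial k phi) z = 0.
  move=> Bz; rewrite {1}/partial (derive_eq_open (A := B) (g := cst 0) _ oB)//.
    exact: derive_cst.
  by move=> z' Bz'; exact: P0.
apply/nbhs_ballP; exists r => //= q [Bq _].
have Pi i := P0 i _ Bq; have Pik i k := P00 i k _ Bq; have f0 := B0 _ Bq.
rewrite planar_formE (psi_zero f0) (hfun_zero f0) (Pik 0 1) (Pik 1 1) (Pik 0 0).
rewrite (Pi 0) (Pi 1) f0.
move: (q.2 0 0) (q.2 0 1) => p0 p1; rewrite !mulr0 !subr0 !addr0 invr1; ring.
Qed.

Lemma planar_form_closed p u v w : G p -> d_omega u v w p = 0.
Proof.
move=> Gp; apply: contrapT => /eqP D0; have oG := open_total oU Sphi.
have Up := total_base Gp.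
have Sw (x y z : phase) : smooth G ('D_z (fun q => omega q x y)).
  by apply: smooth_derive; exact: smooth_planar_form.
have SD : smooth G (d_omega u v w).
  by move=> n; apply: (CnD oG); [apply: (CnB oG)|]; exact: Sw.
(* By continuity [d_omega] stays nonzero near [p]; the regular case then leaves only zeros of [phi]
   there. *)
have near0 : nbhs p (fun q : phase => phi q.1 = 0).
  have oN : open (G `&` d_omega u v w @^-1` [set s | s != 0]).
    by apply: (open_preimage_in oG (@open_neq R 0)) => q Gq; exact: (smooth_continuous SD Gq).
  have N : nbhs p (G `&` d_omega u v w @^-1` [set s | s != 0]) by exact: open_nbhs_nbhs.
  apply: filterS N => q [Gq Dq]; apply: contrapT => /eqP q0.
  by move/eqP: Dq; apply; exact: planar_form_closed_regular.
have C x y z : 'D_z (fun q => omega q x y) p = 0.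
  rewrite (near_eq_derive z (planar_form_locally_constant x y Up near0)).
  exact: derive_cst.
by move/eqP: D0; apply; rewrite /d_omega !C subrr addr0.
Qed.

End closed_form.

(** * The symplectic groupoid *)

Section symplectic_groupoid_axioms.
Context {R : realType}.
Local Notation plane := 'rV[R]_2.
Local Notation phase := (plane * plane)%type.
Variables (U : set plane) (phi : plane -> R).
Hypotheses (oU : open U) (Sphi : smooth U phi).
Local Notation G := (total U phi).
Local Notation comp := (planar_comp phi).
Local Notation omega := (planar_form phi).
Local Notation unit_section := (fun x : plane => (x, 0) : phase).

Lemma planar_bivectorE x i k : planar_bivector phi x i k = phi x * eps i k.
Proof. by rewrite mxE. Qed.

Lemma planar_poisson_manifold : poisson_manifold U (planar_bivector phi).
Proof.
split => //.
- move=> x Ux; apply/matrixP => i k; rewrite !mxE -mulrN; congr (_ * _).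
  by rewrite opprB.
- move=> i k n; apply: (Cn_ext oU (fun x _ => esym (planar_bivectorE x i k))).
  by apply: (CnM oU); [exact: Sphi|exact: Cn_cst].
move=> x Ux.
have dphi := smooth_differentiable Sphi Ux.
have D l i k : partial l (fun y => planar_bivector phi y i k) x = partial l phi x * eps i k.
  have E : (fun y => planar_bivector phi y i k) = fun y => phi y * eps i k.
    by apply/funext => y; exact: planar_bivectorE.
  rewrite /partial E.
  have H := has_derive_mul (diff_has_derive (delta_mx 0 l) dphi)
    (has_derive_const (eps i k) x (delta_mx 0 l)).
  by apply: etrans (has_derive_val H) _; rewrite mulr0 add0r mulrC.
move=> i j k; rewrite sum_ord2 !planar_bivectorE !D.
move: (partial 0 phi x) (partial 1 phi x) (phi x) => a b c.
have e00 := @epsii R 0; have e11 := @epsii R 1; have e01 := @eps01 R; have e10 := @eps10 R.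
(* With two values for three indices, two of them coincide, and the antisymmetry of [eps] makes the
   cyclic sum cancel. *)
move: k; apply: forall_ord2; move: j; apply: forall_ord2; move: i; apply: forall_ord2;
  rewrite ?e00 ?e11 ?e01 ?e10; ring.
Qed.

Lemma planar_symplectic_manifold : symplectic_manifold G omega.
Proof.
split.
- exact: open_total.
- by move=> p _ a u v w; exact: planar_form_linear.
- by move=> p _ u v; exact: planar_form_alternating.
- by move=> u v; exact: smooth_planar_form.
- by move=> p Gp u v w; exact: (planar_form_closed oU Sphi u v w Gp).
- by move=> p Gp u; exact: (planar_form_nondegenerate (total_hfun_neq0 Gp)).
Qed.

Lemma differentiable_unit_section x : differentiable unit_section x.
Proof.
have did : differentiable (id : plane -> plane) x by [].
exact: (differentiable_pair did (differentiable_cst (0 : plane) x)).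
Qed.

Lemma derive_unit_section v x : 'D_v unit_section x = (v, 0).
Proof.
have did : differentiable (id : plane -> plane) x by [].
by rewrite (derive_pair v did (differentiable_cst (0 : plane) x)) derive_id derive_cst.
Qed.

Lemma unit_section_embedding : smooth_embedding U unit_section.
Proof.
split.
- apply: (smooth_phase oU); first by move=> n; apply: (@Cn_linear R n _ _ U idfun) => x; exact: cvg_id.
  by move=> n; exact: Cn_cst.
- move=> x _ v w; have d := differentiable_unit_section x.
  by rewrite -(deriveE v d) -(deriveE w d) !derive_unit_section => -[].
exists fst; split => //.
apply: continuous_subspaceT; exact: phase_fst_continuous.
Qed.

Lemma fst_submersion : smooth_submersion G fst.
Proof.
have cf := @phase_fst_continuous R.
split; first exact: (@smooth_linear R _ _ G fst cf).
by move=> q _ v _; exists (v, 0) => //; rewrite diff_lin.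
Qed.

Lemma xf_submersion : smooth_submersion G (xf phi).
Proof.
have GB : G `<=` over_base U by exact: total_base.
split; first exact: (smooth_sub_set GB (smooth_xf oU Sphi)).
move=> q Gq v _; have Uq := total_base Gq; have hn := total_hfun_neq0 Gq.
have dx := smooth_differentiable (smooth_xf oU Sphi) (Uq : over_base U q).
suff [u uE] : exists u, dxf phi q u = v.
  exists u; [exact: Logic.I|exact: (etrans (esym (deriveE u dx)) (etrans (derive_xf oU Sphi u Uq) uE))].
have [q0|q0] := eqVneq (phi q.1) 0; last first.
  (* Where [phi] is nonzero, varying [p] alone moves the target in every direction. *)
  exists (0, - rot ((phi q.1)^-1 *: v)).
  have dphi := smooth_differentiable Sphi Uq.
  rewrite /dxf [((_, _) : phase).1]/= [((_, _) : phase).2]/= derive0 scale0r !add0r.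
  by rewrite rotN rot_rot opprK scalerA divff// scale1r.
have dE := hfun_zero q0.
(* At a zero of [phi] the differential sends a base vector [u] to [u + dphi(u) rot p], a rank-one
   perturbation of the identity with determinant [h]; the Sherman-Morrison formula gives
   [u = v - (dphi(v) / h) rot p]. *)
pose d := v 0 0 * partial 0 phi q.1 + v 0 1 * partial 1 phi q.1.
pose e := d / hfun phi q.
exists (vec2 (v 0 0 + e * q.2 0 1) (v 0 1 - e * q.2 0 0), 0).
have K : (v 0 0 + e * q.2 0 1) * partial 0 phi q.1 + (v 0 1 - e * q.2 0 0) * partial 1 phi q.1 = e.
  have -> : (v 0 0 + e * q.2 0 1) * partial 0 phi q.1 + (v 0 1 - e * q.2 0 0) * partial 1 phi q.1 =
      d + e * (1 - hfun phi q) by rewrite dE /d; ring.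
  by rewrite /e mulrBr mulr1 divfK// addrC subrK.
apply: plane_eqP.
  rewrite (dxf0 Sphi _ Uq) [((_, _) : phase).1]/= vec2_0 vec2_1 K q0; ring.
rewrite (dxf1 Sphi _ Uq) [((_, _) : phase).1]/= vec2_0 vec2_1 K q0; ring.
Qed.

Lemma planar_form_unit x u v : omega (x, 0) u v =
  u.1 0 0 * v.2 0 0 - v.1 0 0 * u.2 0 0 + (u.1 0 1 * v.2 0 1 - v.1 0 1 * u.2 0 1)
  + phi x * (u.2 0 0 * v.2 0 1 - v.2 0 0 * u.2 0 1).
Proof.
have Z i : ((x, 0) : phase).2 0 i = 0 by rewrite mxE.
rewrite planar_formE hfun_unit psi_unit !Z.
by rewrite !mul0r !subr0 !addr0 add0r !mul1r invr1 mul1r.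
Qed.

(** A curve of units has zero momentum near time 0; conversely, the straight line through [x] stays
    in the open set [U] for small times. *)
Lemma tangent_unit_section x v : U x -> tangent (unit_section @` U) (x, 0) v <-> v.2 = 0.
Proof.
move=> Ux; split.
  move=> [c [c0 [I [[oI I0] SI cI]]] <-]; rewrite derive1E.
  have dc := smooth_differentiable SI I0.
  have cs : continuous (snd : phase -> plane) by move=> z; exact: cvg_snd.
  have H := derive_lin_comp (L := snd) (1 : R) cs dc.
  refine (etrans (esym (has_derive_val H)) _).
  refine (etrans (@derive_eq_open R _ _ I _ (cst 0) (1 : R) 0 oI _ I0) (derive_cst _ _ _)).
  by move=> t /cI [y _ <-].
move=> v2; pose I : set R := [set t | U (x + t *: v.1)].
have oI : open I.
  apply: (@open_comp _ _ (fun t : R => x + t *: v.1)) => // t _.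
  apply: differentiable_continuous; exact: line_differentiable.
have I0 : I 0 by rewrite /I /= scale0r addr0.
exists (fun t : R => (x + t *: v.1, 0) : phase).
  split; first by rewrite scale0r addr0.
  exists I; split => //; last by move=> t It; exists (x + t *: v.1).
  apply: (smooth_phase oI); last by move=> n; exact: Cn_cst.
  move=> n; apply: (CnD oI); first exact: Cn_cst.
  by apply: (Cn_scalel _ oI); apply: (@Cn_linear R n _ _ I idfun) => t; exact: cvg_id.
rewrite derive1E (derive_pair (1 : R) (line_differentiable x v.1 0) (differentiable_cst (0 : plane) (0 : R))).
by rewrite derive_line derive_cst -v2 -surjective_pairing.
Qed.

Lemma unit_section_lagrangian : lagrangian omega (unit_section @` U).
Proof.
move=> _ [x Ux <-] v; rewrite (tangent_unit_section v Ux); split.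
  move=> v2 u /(tangent_unit_section u Ux) u2.
  by rewrite planar_form_unit u2 v2 !mxE !mulr0 !subr0 mulr0 !addr0.
(* Pairing with horizontal vectors reads off the momentum part of [v], the form at a unit being
   canonical up to a multiple of [dpi_1 dpi_2]. *)
move=> H; have T a b : a * v.2 0 0 + b * v.2 0 1 = 0.
  have := H (vec2 a b, 0) ((tangent_unit_section (vec2 a b, 0) Ux).2 erefl).
  rewrite planar_form_unit [((_, _) : phase).1]/= [((_, _) : phase).2]/= vec2_0 vec2_1 !mxE.
  by rewrite !mulr0 !mul0r !subr0 mulr0 addr0.
apply: plane_eqP; rewrite mxE.
  by have := T 1 0; rewrite mul1r mul0r addr0.
by have := T 0 1; rewrite mul1r mul0r add0r.
Qed.

Lemma comp_smooth : smooth_sub (composable G fst (xf phi)) (fun gh => comp gh.1 gh.2).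
Proof.
have oG := open_total oU Sphi.
have GO : G `<=` over_both U phi by exact: total_both.
have cfst : continuous (fst : phase * phase -> phase) by move=> z; exact: cvg_fst.
have csnd : continuous (snd : phase * phase -> phase) by move=> z; exact: cvg_snd.
have csnd' : continuous (snd : phase -> plane) by move=> z; exact: cvg_snd.
have cff : continuous (fst \o fst : phase * phase -> plane).
  by move=> z; apply: continuous_comp; [exact: cfst|exact: phase_fst_continuous].
have csf : continuous (snd \o fst : phase * phase -> plane).
  by move=> z; apply: continuous_comp; [exact: cfst|exact: csnd'].
have css : continuous (snd \o snd : phase * phase -> plane).
  by move=> z; apply: continuous_comp; [exact: csnd|exact: csnd'].
(* The formula for [comp] makes sense without the matching condition, so it is its own smooth
   extension to the open set of pairs with first factor in [G]. *)
move=> gk [Gg Gk e]; pose N : set (phase * phase) := fst @^-1` G.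
have oN : open N by apply: (@open_comp _ _ fst) => // z _; exact: cfst.
exists N, (fun gh => comp gh.1 gh.2); split => //.
apply: (smooth_phase oN).
  exact: (@smooth_linear R _ _ N [the {linear (phase * phase)%type -> plane} of fst \o fst] cff).
move=> n; apply: (CnD oN).
  exact: (@Cn_linear R n _ _ N [the {linear (phase * phase)%type -> plane} of snd \o fst] csf).
apply: (smooth_scale_plane oN).
  move=> m; apply: (@Cn_comp_linear R m _ _ N G (hfun phi) fst) => //.
  exact: Cn_sub GO (smooth_hfun oU Sphi m).
exact: (@smooth_linear R _ _ N [the {linear (phase * phase)%type -> plane} of snd \o snd] css).
Qed.

(** Differentiating the matching condition along the curve gives the compatibility of velocities
    required by [planar_form_comp]. *)
Lemma composable_curve gk (c : R -> phase * phase) : curve_at (composable G fst (xf phi)) gk c ->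
  [/\ differentiable (fun t => (c t).1) 0, differentiable (fun t => (c t).2) 0 &
    ('D_(1 : R) (fun t => (c t).2) 0).1 = dxf phi (c 0).1 ('D_(1 : R) (fun t => (c t).1) 0)].
Proof.
move=> [c0 [I [[oI I0] SI cI]]].
have dc := smooth_differentiable SI I0.
have cfst : continuous (fst : phase * phase -> phase) by move=> z; exact: cvg_fst.
have csnd : continuous (snd : phase * phase -> phase) by move=> z; exact: cvg_snd.
have da : differentiable (fun t => (c t).1) 0.
  exact: (differentiable_comp dc (linear_differentiable (f := fst) _ cfst)).
have db : differentiable (fun t => (c t).2) 0.
  exact: (differentiable_comp dc (linear_differentiable (f := snd) _ csnd)).
split => //; have [Gg _ _] := cI 0 I0; have Ug := total_base Gg.
have dx := smooth_differentiable (smooth_xf oU Sphi) (Ug : over_base U _).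
have E1 := has_derive_val (derive_lin_comp (L := fst) (1 : R) (@phase_fst_continuous R) db).
have E2 := derive_comp (1 : R) da dx.
rewrite -(derive_xf oU Sphi _ Ug) (deriveE _ dx).
refine (etrans (esym E1) (etrans _ E2)).
by apply: (derive_eq_open _ oI) => // t /cI [_ _ /esym].
Qed.

Lemma planar_multiplicative gh (c1 c2 : R -> phase * phase) :
  composable G fst (xf phi) gh -> curve_at (composable G fst (xf phi)) gh c1 ->
  curve_at (composable G fst (xf phi)) gh c2 ->
  pullback (fun gh => comp gh.1 gh.2) omega c1 c2 =
  pullback fst omega c1 c2 + pullback snd omega c1 c2.
Proof.
move=> [Gg Gk e] h1 h2.
have [d1 d1' e1] := composable_curve h1; have [d2 d2' e2] := composable_curve h2.
have [c10 _] := h1; have [c20 _] := h2.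
have dh := smooth_differentiable (smooth_hfun oU Sphi) (total_both Gg).
have dh1 : differentiable (hfun phi) (c1 0).1 by rewrite c10.
have dh2 : differentiable (hfun phi) (c2 0).1 by rewrite c20.
have D1 := derive_planar_comp (1 : R) d1 d1' dh1.
have D2 := derive_planar_comp (1 : R) d2 d2' dh2.
rewrite /pullback !derive1E.
rewrite c10 in e1 D1 *; rewrite c20 in e2 D2.
refine (etrans (congr2 (omega (comp gh.1 gh.2)) D1 D2) _).
exact: (planar_form_comp oU Sphi (total_both Gg) (total_both Gk) (total_hfun_neq0 Gg)
  (total_hfun_neq0 Gk) e e1 e2).
Qed.

Lemma planar_symplectic_groupoid :
  symplectic_groupoid U (planar_bivector phi) G omega unit_section fst (xf phi) comp.
Proof.
exists (inverse phi); split.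
- exact: planar_poisson_manifold.
- exact: planar_symplectic_manifold.
- by split=> [x Ux|x y _ _ [->//]]; exact: total_unit.
- split=> [q Gq|x Ux]; first exact: (total_base Gq).
  by exists (x, 0) => //; exact: total_unit.
- split=> [q Gq|x Ux]; first by have [] := total_both Gq.
  by exists (x, 0); [exact: total_unit|exact: xf_unit].
- by move=> x Ux; split=> //; exact: xf_unit.
- move=> x y z g k _ _ _ [Gg lg rg] [Gk lk rk].
  have e : xf phi g = k.1 by rewrite rg lk.
  by split; [exact: total_comp|exact: lg|rewrite (xf_comp e)].
- move=> x y g _ _ [Gg lg rg]; split.
    rewrite -[LHS]/(x, 0 + hfun phi (x, 0) *: g.2) hfun_unit scale1r add0r -lg.
    exact: (esym (surjective_pairing g)).
  rewrite -[LHS]/(g.1, g.2 + hfun phi g *: 0) scaler0 addr0.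
  exact: (esym (surjective_pairing g)).
- move=> x y g _ _ [Gg lg rg]; have h0 := total_hfun_neq0 Gg; split.
    by split; [exact: total_inverse|exact: rg|rewrite xf_inverse].
  by rewrite comp_inverse// lg.
- by move=> g k m Gg _ _ e _; exact: (comp_assoc _ (total_hfun_neq0 Gg) e).
- exact: unit_section_embedding.
- exact: fst_submersion.
- exact: xf_submersion.
- exact: comp_smooth.
- exact: smooth_inverse.
- exact: unit_section_lagrangian.
- move=> f g Sf Sg p Gp.
  exact: (fst_poisson (total_base Gp) (total_hfun_neq0 Gp) Sf Sg).
- move=> f g Sf Sg p Gp; have [Up Uxp] := total_both Gp.
  exact: (xf_anti_poisson oU Sphi Up Uxp (total_hfun_neq0 Gp) Sf Sg).
- exact: planar_multiplicative.
- exact: inverse_anti_poisson.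
Qed.

End symplectic_groupoid_axioms.

Theorem theorem7p12 (R : realType) (U : set 'rV[R]_2) (phi : 'rV[R]_2 -> R)
    (U_nonempty : U !=set0) (U_open : open U) (U_connected : connected U)
    (phi_smooth : smooth U phi)
    (leaves_simply_connected : forall x, U x ->
       simply_connected R (symplectic_leaf U (planar_bivector phi) x)) :
  symplectic_groupoid U (planar_bivector phi)
    (planar_total U phi) (planar_form phi)
    (fun x => (x, 0)) fst (xf phi) (planar_comp phi).
Proof. by rewrite planar_totalE//; exact: planar_symplectic_groupoid. Qed.
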